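(* Let $\Lambda=\{\lambda_1,\lambda_2,\dots\}$ be an infinite sequence of distinct real numbers with $\lambda_j>-1/2$ for all $j$, and set $p_j=\lambda_j+\frac12$. Let $W$ be a Brownian motion indexed by $\mathbb R$ and $B$ a standard Brownian motion related by $$W_u=\begin{cases}B_1+\int_1^{e^u}\frac{dB_s}{\sqrt s}&\text{if }u\ge0,\\ B_1-\int_{e^u}^1\frac{dB_s}{\sqrt s}&\text{if }u\le0,\end{cases}\qquad\text{and, equivalently,}\qquad B_t=\int_{-\infty}^{\log t}e^{r/2}\,dW_r,\ t>0.$$ Then the following assertions are equivalent. (1) $\displaystyle\sum_{j=1}^\infty\frac{p_j}{p_j^2+1}<\infty$. (2) There exists a transform $S$ of the form $S(W)_u=\int_{-\infty}^u\eta(u-v)\,dW_v$, $u\in\mathbb R$, with $\eta\in L^2(\mathbb R_+)$, such that $(S(W)_u,u\in\mathbb R)$ is an Ornstein--Uhlenbeck process and $$\mathcal H_u(W)=\mathcal H_u(S(W))\oplus\overline{\mathrm{Span}}\Big\{\int_{-\infty}^u e^{p_jr}\,dW_r,\ j=1,2,\dots\Big\}\quad\text{for all }u\in\mathbb R.$$ (3) There exists a transform $T$ of the form $T(B)_t=\int_0^t\rho(t/s)\,dB_s$, $t>0$, with $\rho\in\mathcal M$, such that $(T(B)_t,t\ge0)$ is a standard Brownian motion and $$H_t(B)=H_t(T(B))\oplus\overline{\mathrm{Span}}\Big\{\int_0^t s^{\lambda_j}\,dB_s,\ j=1,2,\dots\Big\}\quad\text{for all }t>0.$$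
   Context: $\mathcal M$ is the set of measurable functions $\rho:[1,\infty)\to\mathbb R$ with $\int_0^1\rho^2(1/v)\,dv<\infty$. Processes defined by such transforms are considered up to stochastic modification, taking the continuous version (with $T(B)_0=0$). A Brownian motion indexed by $\mathbb R$ is a centered continuous Gaussian process with independent increments such that $\mathbb E[(W_u-W_v)^2]=|u-v|$ for all $u,v\in\mathbb R$. An Ornstein--Uhlenbeck process here means a stationary centered Gaussian process $(X_u,u\in\mathbb R)$ with covariance $\mathbb E[X_uX_v]=e^{-|u-v|/2}$. $H_t(X)$ is the closed linear span in $L^2(\Omega,\mathcal F,\mathbb P)$ of $\{X_s,\ s\le t\}$, so $H_t(B)=\{\int_0^tf(s)\,dB_s:\ f\in L^2[0,t]\}$. $\mathcal H_u(S(W))$ is the closed linear span of $\{S(W)_r,\ r\le u\}$, and $\mathcal H_u(W)=\{\int_{-\infty}^u f(r)\,dW_r:\ f\in L^2(-\infty,u]\}$. $\overline{\mathrm{Span}}$ denotes the closed linear span and $\oplus$ the orthogonal direct sum in $L^2(\Omega,\mathcal F,\mathbb P)$. *)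

(* Defs.v *)
From HB Require Import structures.
From mathcomp Require Export all_boot all_order all_algebra.
From mathcomp Require Export all_classical all_reals all_analysis measurable_realfun.
Export Order.TTheory GRing.Theory Num.Theory numFieldNormedType.Exports.

Set Implicit Arguments.
Unset Strict Implicit.
Unset Printing Implicit Defensive.

Local Open Scope classical_set_scope.
Local Open Scope ring_scope.

Section functions.
Context {R : realType}.

Definition square_integrable (D : set R) (f : R -> R) : Prop :=
  measurable_fun D f /\
  (\int[lebesgue_measure]_(x in D) (f x ^+ 2)%:E < +oo)%E.

(* The class $\mathcal M$; the integral is over ]0, 1] because [0^-1 = 0]. *)
Definition class_M (rho : R -> R) : Prop :=
  measurable_fun (`[1, +oo[ : set R) rho /\
  (\int[lebesgue_measure]_(v in `]0%R, 1%R]) (rho (v^-1) ^+ 2)%:E < +oo)%E.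

(* A list [(c_1, (a_1, b_1)), ...] encodes the step function equal to the sum
   of the [c_k] times the indicator of ]a_k, b_k]. *)
Definition step_fun (s : seq (R * (R * R))) (x : R) : R :=
  \sum_(z <- s) z.1 * \1_(`]z.2.1, z.2.2]) x.

Definition step_in (D : set R) (s : seq (R * (R * R))) : Prop :=
  forall z, z \in s -> [/\ D z.2.1, D z.2.2 & z.2.1 <= z.2.2].

End functions.

(* A process is a family of random variables indexed by [R]; its index set [D]
   is a separate argument, and the values outside [D] play no role. *)
Section processes.
Context {d : measure_display} {Omega : measurableType d} {R : realType}.
Variable P : probability Omega R.
Implicit Types (X Y Z : {RV P >-> R}) (D : set R).

(* Point masses count as Gaussian, and they need a separate clause because the
   library's [normal_prob m 0] is the uniform law on [0, 1]. *)
Definition gaussian X : Prop :=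
  exists m s : R, if s == 0 then X = cst m %[ae P]
    else forall A, measurable A -> distribution P X A = normal_prob m s A.

Definition gaussian_process D (X : R -> {RV P >-> R}) : Prop :=
  forall n (t : 'I_n -> R) (c : 'I_n -> R), (forall i, D (t i)) ->
    gaussian (\sum_(i < n) c i *: X (t i)).

Definition centered D (X : R -> {RV P >-> R}) : Prop :=
  forall t, D t -> ('E_P[X t] = 0)%E.

Definition continuous_process D (X : R -> {RV P >-> R}) : Prop :=
  \forall w \ae P, {within D, continuous (fun t => X t w)}.

Definition mutually_independent n (X : 'I_n -> {RV P >-> R}) : Prop :=
  forall A : 'I_n -> set R, (forall i, measurable (A i)) ->
    P (\bigcap_(i in [set: 'I_n]) (X i @^-1` A i)) =
    (\prod_(i < n) P (X i @^-1` A i))%E.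

Definition independent_increments D (X : R -> {RV P >-> R}) : Prop :=
  forall n (t : nat -> R),
    (forall i, (i <= n)%N -> D (t i)) ->
    (forall i, (i < n)%N -> t i <= t i.+1) ->
    mutually_independent (fun i : 'I_n => X (t i.+1) - X (t i)).

Definition brownian D (W : R -> {RV P >-> R}) : Prop :=
  [/\ gaussian_process D W, centered D W, continuous_process D W,
      independent_increments D W &
      forall u v, D u -> D v -> 'E_P[((W u - W v) ^+ 2)%R]%E = `|u - v|%:E].

Definition standard_brownian (B : R -> {RV P >-> R}) : Prop :=
  brownian `[0, +oo[ B /\ B 0 = cst 0 %[ae P].

Definition stationary (X : R -> {RV P >-> R}) : Prop :=
  forall n (u : 'I_n -> R) (h : R) (A : set (n.-tuple R)), measurable A ->
    P ((fun w => [tuple X (u i + h) w | i < n]) @^-1` A) =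
    P ((fun w => [tuple X (u i) w | i < n]) @^-1` A).

Definition ornstein_uhlenbeck (X : R -> {RV P >-> R}) : Prop :=
  [/\ gaussian_process setT X, centered setT X, stationary X &
      forall u v, 'E_P[(X u * X v)%R]%E = (expR (- `|u - v| / 2))%:E].

Definition step_integral (W : R -> {RV P >-> R}) (s : seq (R * (R * R))) :
    {RV P >-> R} :=
  \sum_(z <- s) z.1 *: (W z.2.2 - W z.2.1).

(* [wiener_integral W D f X]: [X] is a version of the Wiener integral over [D]
   of [f] with respect to [W], i.e., the image of [f] under the L^2-isometry
   extending [step_integral W].  It is determined up to almost sure equality.
   [D] is meant to be a closed interval contained in the index set of [W]. *)
Definition wiener_integral (W : R -> {RV P >-> R}) D (f : R -> R) X : Prop :=
  square_integrable D f /\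
  exists s : nat -> seq (R * (R * R)),
    [/\ forall n, step_in D (s n),
        (\int[lebesgue_measure]_(x in D)
           ((f x - step_fun (s n) x) ^+ 2)%:E)%E @[n --> \oo] --> 0%E &
        'E_P[((X - step_integral W (s n)) ^+ 2)%R]%E @[n --> \oo] --> 0%E].

Definition linear_span (A : set {RV P >-> R}) : set {RV P >-> R} :=
  [set Y | exists n (c : 'I_n -> R) (Z : 'I_n -> {RV P >-> R}),
    (forall i, A (Z i)) /\ Y = \sum_(i < n) c i *: Z i].

(* A closed subspace of L^2 is represented by the set of all random variables
   whose almost sure class belongs to it. *)
Definition closed_span (A : set {RV P >-> R}) : set {RV P >-> R} :=
  [set Y | (Y : Omega -> R) \in Lfun P 2%:E /\
    forall e : R, 0 < e ->
      exists2 Z, linear_span A Z & ('E_P[((Y - Z) ^+ 2)%R] < e%:E)%E].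

Definition orthogonal_sum (H H1 H2 : set {RV P >-> R}) : Prop :=
  (forall X Y, H1 X -> H2 Y -> 'E_P[(X * Y)%R]%E = 0%E) /\
  H = [set Z | exists X Y, [/\ H1 X, H2 Y & Z = X + Y %[ae P]]].

(* For W indexed by the whole line this is in general not the closed span of
   the [W r], r <= u: the constant W_0 is unrelated to the increments used by
   the integral, and may depend on the increments after time u. *)
Definition wiener_space (W : R -> {RV P >-> R}) (u : R) : set {RV P >-> R} :=
  [set Y | exists f, wiener_integral W `]-oo, u] f Y].

End processes.

(* Main.v *)
Require Import Defs.
From HB Require Import structures.
From mathcomp Require Import ring lra.

Set Implicit Arguments.
Unset Strict Implicit.
Unset Printing Implicit Defensive.

Local Open Scope classical_set_scope.
Local Open Scope ring_scope.

(** Through the Wiener isometry the statement becomes one about square integrable functions on a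
    half line. Write k_z for the function [kexp z u], equal to exp (z (r - u)) for r <= u and to 0
    afterwards. Then <k_z, k_w> = 1 / (z + w), and the exponential integrals correspond to multiples
    of the k_{p_j}. Let b_n(z) be the Blaschke product of the factors (z - p_j) / (z + p_j), j < n,
    up to signs. The partial fractions of b_n(w) / (w + z) give a combination f_{n,z} of k_z and of
    the k_{p_j}, j < n ([bkernel]), with <f_{n,z}, k_w> = b_n(w) / (w + z). It is orthogonal to the
    first n exponentials, its squared norm is 1 / (2 z) whatever n, and b_n(z) f_{n,z} is the
    component of k_z orthogonal to them.

    If the series diverges, b_n(z) tends to 0 for every z > 0, so every k_z lies in the closed span
    of the k_{p_j} ([divergent_cl_pexps]). The k_z are total because indicators of intervals are
    limits of their combinations ([cl_exps_step]). The exponential integrals then fill the whole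
    space, and a variable of that space orthogonal to them has variance 0 ([divergent_orthogonal]),
    which is impossible for an Ornstein-Uhlenbeck process or for a Brownian motion at time 1.

    If the series converges, the ratios b_m / b_n tend to 1, and the f_{n,z} converge when z
    decreases to 1/2 along with n going to infinity. The limit is v -> eta (u - v) ([eta_at]). It is
    orthogonal to the exponentials, and two such functions have the inner product exp (- |u - r| /
    2) of the corresponding kernels of rate 1/2 ([dot_eta_at]), which is the Ornstein-Uhlenbeck
    covariance. Nothing is missing from the orthogonal sum ([cl_etas_pexps]): the kernels of rate
    1/2 ending before u are total ([cl_half_exps]), and the isometry that maps them to the functions
    [eta_at r] turns an approximation of k_z into one of f_{n,z} for n large. Finally k_z is b_n(z)
    f_{n,z} plus a combination of the k_{p_j}, and |b_n(z)| <= 1.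

    The statement on B is the same one after the isometry f -> exp (r / 2) f (exp r)
    ([Bincr_of_Wpairs]): T_t is sqrt t S_{log t} and rho (y) is sqrt y eta (log y).

    It remains to see that S and T have the right laws. For X in the closed span of the increments
    of W, the expectation of cos (X + phi) depends only on the variance of X ([gset_cos]), and such
    expectations determine joint laws ([joint_law]). Hence equal covariances give equal laws
    ([gset_joint_law]), and normality, stationarity and independence of increments follow by
    comparison with W. Continuity of T comes from a fourth order tail bound and the dyadic argument
    of Kolmogorov ([continuous_modification]). *)

(** * Semi-inner products, spans and closed spans *)

Section semi_hilbert.
Context {R : realType}.

(** Vectors of norm 0 are not identified, and bilinearity is asked only on [dom]. Square integrable
    functions can thus be handled among all functions, without almost everywhere classes. *)
Record semi_inner (V : lmodType R) := SemiInner {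
  dom : set V;
  dot : V -> V -> R;
  dom0 : dom 0;
  domD : forall x y, dom x -> dom y -> dom (x + y);
  domZ : forall c x, dom x -> dom (c *: x);
  dotC : forall x y, dot x y = dot y x;
  dotDl : forall x y z, dom x -> dom y -> dom z ->
    dot (x + y) z = dot x z + dot y z;
  dotZl : forall c x z, dom x -> dom z -> dot (c *: x) z = c * dot x z;
  dot_ge0 : forall x, 0 <= dot x x }.

Definition complete_inner (V : lmodType R) (h : semi_inner V) : Prop :=
  forall f : nat -> V, (forall n, dom h (f n)) ->
  (forall e : R, 0 < e -> exists N, forall m n, (N <= m)%N -> (N <= n)%N ->
     dot h (f m - f n) (f m - f n) < e) ->
  exists2 g, dom h g & forall e : R, 0 < e -> exists N, forall n, (N <= n)%N ->
     dot h (f n - g) (f n - g) < e.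

(** Built one generator at a time, so that linear facts go by induction without index sets. *)
Inductive span (V : lmodType R) (A : set V) : set V :=
| span0 : span A 0
| spanS c x y : A x -> span A y -> span A (c *: x + y).

Section one.
Variables (V : lmodType R) (h : semi_inner V).
Local Notation D := (dom h).
Local Notation "<| x , y |>" := (dot h x y) (at level 2, x, y at level 200).
Implicit Types (A : set V) (x y z : V).

(** The squared seminorm. Staying with squares avoids square roots, at the cost of a factor 2 in
    [n2_triangle]. *)
Definition n2 x := <|x, x|>.

Lemma n2_ge0 x : 0 <= n2 x. Proof. exact: dot_ge0. Qed.
Hint Resolve n2_ge0 : core.

Lemma domN x : D x -> D (- x).
Proof. by move=> Dx; rewrite -scaleN1r; apply: domZ. Qed.

Lemma domB x y : D x -> D y -> D (x - y).
Proof. by move=> Dx Dy; apply: domD => //; exact: domN. Qed.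

Lemma dom_span A : A `<=` D -> span A `<=` D.
Proof.
move=> AD x; elim=> [|c y z Ay _ Dz]; first exact: dom0.
by apply: domD => //; apply: domZ; apply: AD.
Qed.

Lemma dot0l x : D x -> <|0, x|> = 0.
Proof. by move=> Dx; rewrite -(scale0r 0) dotZl ?mul0r//; apply: dom0. Qed.

Lemma dotDr x y z : D x -> D y -> D z -> <|x, y + z|> = <|x, y|> + <|x, z|>.
Proof. by move=> *; rewrite dotC dotDl// !(dotC h x). Qed.

Lemma dotZr c x z : D x -> D z -> <|x, c *: z|> = c * <|x, z|>.
Proof. by move=> *; rewrite dotC dotZl// (dotC h x). Qed.

Lemma dotNl x z : D x -> D z -> <|- x, z|> = - <|x, z|>.
Proof. by move=> *; rewrite -scaleN1r dotZl// mulN1r. Qed.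

Lemma dotBl x y z : D x -> D y -> D z -> <|x - y, z|> = <|x, z|> - <|y, z|>.
Proof. by move=> *; rewrite dotDl ?dotNl//; apply: domN. Qed.

Lemma dotBr x y z : D x -> D y -> D z -> <|x, y - z|> = <|x, y|> - <|x, z|>.
Proof. by move=> *; rewrite dotC dotBl// !(dotC h x). Qed.

Lemma n2D x y : D x -> D y -> n2 (x + y) = n2 x + 2 * <|x, y|> + n2 y.
Proof.
move=> Dx Dy; rewrite /n2 dotDl ?dotDr//; last exact: domD.
rewrite (dotC h y x); ring.
Qed.

Lemma n2B x y : D x -> D y -> n2 (x - y) = n2 x - 2 * <|x, y|> + n2 y.
Proof.
move=> Dx Dy; rewrite /n2 dotBl ?dotBr//; last exact: domB.
rewrite (dotC h y x); ring.
Qed.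

Lemma n2Z c x : D x -> n2 (c *: x) = c ^+ 2 * n2 x.
Proof. by move=> Dx; rewrite /n2 dotZl ?dotZr//; [ring | exact: domZ]. Qed.

Lemma n2_0 : n2 0 = 0.
Proof. by rewrite /n2 dot0l//; exact: dom0. Qed.

Lemma n2N x : D x -> n2 (- x) = n2 x.
Proof. by move=> Dx; rewrite -scaleN1r n2Z//; ring. Qed.

Lemma n2_distC x y : D x -> D y -> n2 (x - y) = n2 (y - x).
Proof. by move=> Dx Dy; rewrite -opprB n2N//; exact: domB. Qed.

Lemma n2D_le x y : D x -> D y -> n2 (x + y) <= 2 * n2 x + 2 * n2 y.
Proof.
move=> Dx Dy; have := n2_ge0 (x - y); rewrite n2B// n2D//; lra.
Qed.

Lemma n2_triangle y x z : D x -> D y -> D z ->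
  n2 (x - z) <= 2 * n2 (x - y) + 2 * n2 (y - z).
Proof.
move=> Dx Dy Dz; rewrite -[x in n2 (x - z)](subrK y) -addrA.
by apply: n2D_le; apply: domB.
Qed.

Lemma cauchy_schwarz x y : D x -> D y -> <|x, y|> ^+ 2 <= n2 x * n2 y.
Proof.
move=> Dx Dy; set a := <|x, y|>.
have H s : 0 <= n2 x - 2 * s * a + s ^+ 2 * n2 y.
  have := n2_ge0 (x - s *: y); rewrite n2B ?n2Z//; last exact: domZ.
  rewrite dotZr// -/a; lra.
have [y0|y0] := eqVneq (n2 y) 0.
  rewrite y0 mulr0; rewrite y0 in H.
  have [->|a0] := eqVneq a 0; first by rewrite expr0n.
  (* When [y] has norm 0 the quadratic is affine in [s], and this [s] would give it the value -1. *)
  have := H ((n2 x + 1) / (2 * a)).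
  have -> : 2 * ((n2 x + 1) / (2 * a)) * a = n2 x + 1 by field.
  rewrite mulr0; lra.
have yp : 0 < n2 y by rewrite lt_def y0 n2_ge0.
have := H (a / n2 y).
have -> : n2 x - 2 * (a / n2 y) * a + (a / n2 y) ^+ 2 * n2 y =
  (n2 x * n2 y - a ^+ 2) / n2 y by field.
by rewrite pmulr_lge0 ?invr_gt0// subr_ge0.
Qed.

End one.
End semi_hilbert.

Section sequences.
Context {R : realType}.

Lemma cvg0P (u : nat -> R) : (forall n, 0 <= u n) ->
  (forall e, 0 < e -> exists N, forall n, (N <= n)%N -> u n < e) <->
  u n @[n --> \oo] --> 0.
Proof.
move=> u0; split=> [H|].
  apply/cvgrPdist_lt => e /H[N HN]; exists N => // n /= /HN.
  by rewrite sub0r normrN ger0_norm.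
move=> /cvgrPdist_lt H e /H[N _ HN]; exists N => n /HN /=.
by rewrite sub0r normrN ger0_norm.
Qed.

Lemma invS_cvg0 : (n.+1%:R : R)^-1 @[n --> \oo] --> 0.
Proof. exact: cvg_harmonic. Qed.

Lemma sqr_cvg0 (u : nat -> R) :
  u n ^+ 2 @[n --> \oo] --> 0 -> u n @[n --> \oo] --> 0.
Proof.
move=> H; apply/norm_cvg0P.
have -> : (fun n => `|u n|) = (fun n => Num.sqrt (u n ^+ 2)).
  by apply/funext => n; rewrite sqrtr_sqr.
rewrite -[X in _ --> X]sqrtr0.
by apply: (cvg_comp _ _ H); exact: sqrt_continuous.
Qed.

Lemma le_epsilon0 (x : R) : (forall e, 0 < e -> x <= e) -> x <= 0.
Proof. by move=> H; apply/ler_addgt0Pr => e /H; rewrite add0r. Qed.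

End sequences.

Section span.
Context {R : realType} {V : lmodType R}.
Implicit Types (A B : set V).

Lemma sub_span A : A `<=` span A.
Proof.
by move=> x Ax; rewrite -[x]addr0 -[x in x + _]scale1r; apply: spanS => //; exact: span0.
Qed.

Lemma spanD A x y : span A x -> span A y -> span A (x + y).
Proof.
by elim=> [|c z t Az _ IH] Hy; rewrite ?add0r// -addrA; apply: spanS => //; exact: IH.
Qed.

Lemma spanZ A c x : span A x -> span A (c *: x).
Proof.
elim=> [|c' z t Az _ IH]; first by rewrite scaler0; exact: span0.
by rewrite scalerDr scalerA; apply: spanS.
Qed.

Lemma spanN A x : span A x -> span A (- x).
Proof. by move=> ?; rewrite -scaleN1r; apply: spanZ. Qed.

Lemma spanB A x y : span A x -> span A y -> span A (x - y).
Proof. by move=> ? ?; apply: spanD => //; apply: spanN. Qed.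

Lemma span_sum A (I : Type) (r : seq I) (P : pred I) (f : I -> V) :
  (forall i, P i -> span A (f i)) -> span A (\sum_(i <- r | P i) f i).
Proof.
move=> H; elim/big_ind: _ => //; first exact: span0.
by move=> *; apply: spanD.
Qed.

Lemma span_subset A B : A `<=` span B -> span A `<=` span B.
Proof.
move=> AB x; elim=> [|c y z /AB By _ Bz]; first exact: span0.
by apply: spanD => //; apply: spanZ.
Qed.

Lemma span_mono A B : A `<=` B -> span A `<=` span B.
Proof. by move=> AB; apply: span_subset => x /AB; exact: sub_span. Qed.

Lemma span_setU A B x : span (A `|` B) x ->
  exists a b, [/\ span A a, span B b & x = a + b].
Proof.
elim=> [|c y z AB _ [a [b [Ha Hb ->]]]].
  by exists 0, 0; split; [exact: span0|exact: span0|rewrite addr0].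
case: AB => Hy.
  by exists (c *: y + a), b; split => //; [exact: spanS|rewrite addrA].
by exists a, (c *: y + b); split => //; [exact: spanS|rewrite addrCA].
Qed.

End span.

Lemma span_image {R : realType} {U V : lmodType R} (f : {linear U -> V})
  (A : set U) y : span (f @` A) y -> exists2 x, span A x & y = f x.
Proof.
elim=> [|c _ z [x Ax <-] _ [t At ->]].
  by exists 0; [exact: span0|rewrite linear0].
by exists (c *: x + t); [exact: spanS|rewrite linearP].
Qed.

Lemma image_span {R : realType} {U V : lmodType R} (f : {linear U -> V})
  (A : set U) x : span A x -> span (f @` A) (f x).
Proof.
elim=> [|c z y Az _ IH]; first by rewrite linear0; exact: span0.
by rewrite linearP; apply: spanS => //; exists z.
Qed.

Section closure.
Context {R : realType} {V : lmodType R} (h : semi_inner V).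
Local Notation D := (dom h).
Local Notation n2 := (n2 h).
Implicit Types (A B : set V) (x y z : V).

(** For [A] inside [dom] this is the full preimage of a closed subspace of the quotient by null
    vectors; [cl_eq0] is the invariance under null vectors. *)
Definition cl A : set V :=
  [set x | D x /\ forall e, 0 < e -> exists2 y, span A y & n2 (x - y) < e].

Lemma n2_cvgP (f : nat -> V) :
  (forall e, 0 < e -> exists N, forall n, (N <= n)%N -> n2 (f n) < e) <->
  n2 (f n) @[n --> \oo] --> 0.
Proof. by apply: cvg0P => n; exact: n2_ge0. Qed.

Lemma cl_dom A : cl A `<=` D. Proof. by move=> x []. Qed.

Lemma span_cl A x : A `<=` D -> span A x -> cl A x.
Proof.
move=> AD Ax; split; first exact: dom_span Ax.
by move=> e e0; exists x => //; rewrite subrr n2_0.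
Qed.

Lemma sub_cl A : A `<=` D -> A `<=` cl A.
Proof. by move=> AD x Ax; apply: span_cl => //; exact: sub_span. Qed.

Lemma cl_closed A x : A `<=` D -> D x ->
  (forall e, 0 < e -> exists2 y, cl A y & n2 (x - y) < e) -> cl A x.
Proof.
move=> AD Dx H; split=> // e e0.
have [|y [Dy Hy] xy] := H (e / 4); first by lra.
have [|z Az yz] := Hy (e / 4); first by lra.
exists z => //.
have := n2_triangle Dx Dy (dom_span AD Az); lra.
Qed.

Lemma clD A x y : A `<=` D -> cl A x -> cl A y -> cl A (x + y).
Proof.
move=> AD [Dx Hx] [Dy Hy]; split; first exact: domD.
move=> e e0.
have [|x' Ax xx'] := Hx (e / 4); first by lra.
have [|y' Ay yy'] := Hy (e / 4); first by lra.
exists (x' + y'); first exact: spanD.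
have Dx' := dom_span AD Ax; have Dy' := dom_span AD Ay.
have := n2D_le (domB Dx Dx') (domB Dy Dy').
by rewrite addrACA -opprD; lra.
Qed.

Lemma clZ A c x : A `<=` D -> cl A x -> cl A (c *: x).
Proof.
move=> AD [Dx Hx]; split; first exact: domZ.
move=> e e0; have c1 : 0 < c ^+ 2 + 1 by have := sqr_ge0 c; lra.
have [|y Ay xy] := Hx (e / (c ^+ 2 + 1)); first by rewrite divr_gt0.
exists (c *: y); first exact: spanZ.
have Dy := dom_span AD Ay.
rewrite -scalerBr n2Z; last exact: domB.
move: xy; rewrite ltr_pdivlMr// => xy; apply: le_lt_trans xy.
by rewrite mulrC ler_wpM2l ?n2_ge0// lerDl.
Qed.

Lemma clB A x y : A `<=` D -> cl A x -> cl A y -> cl A (x - y).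
Proof.
by move=> AD Ax Ay; apply: clD => //; rewrite -scaleN1r; apply: clZ.
Qed.

Lemma span_cl_sub A B : B `<=` D -> A `<=` cl B -> span A `<=` cl B.
Proof.
move=> BD AB x; elim=> [|c y z /AB By _ Bz].
  by apply: span_cl => //; exact: span0.
by apply: clD => //; apply: clZ.
Qed.

Lemma cl_sub A B : B `<=` D -> A `<=` cl B -> cl A `<=` cl B.
Proof.
move=> BD AB x [Dx Hx]; apply: cl_closed => // e /Hx[y Ay xy].
by exists y => //; exact: (span_cl_sub BD AB).
Qed.

Lemma cl_mono A B : A `<=` B -> cl A `<=` cl B.
Proof.
move=> AB x [Dx Hx]; split=> // e /Hx[y Ay xy]; exists y => //.
exact: span_mono Ay.
Qed.

Lemma cl_eq0 A x y : A `<=` D -> D y -> n2 (x - y) = 0 -> cl A x -> cl A y.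
Proof.
move=> AD Dy xy Ax; apply: cl_closed => // e e0; exists x => //.
by rewrite n2_distC ?xy//; exact: cl_dom Ax.
Qed.

Lemma dot_eq0 x y z : D x -> D y -> D z -> n2 (x - y) = 0 ->
  dot h x z = dot h y z.
Proof.
move=> Dx Dy Dz xy; apply/eqP; rewrite -subr_eq0 -dotBl// -sqrf_eq0.
rewrite eq_le sqr_ge0 andbT; apply: le_trans (cauchy_schwarz (domB Dx Dy) Dz) _.
by rewrite xy mul0r.
Qed.

Lemma cl_seq A x : A `<=` D -> cl A x -> exists f : nat -> V,
  (forall n, span A (f n)) /\ n2 (f n - x) @[n --> \oo] --> 0.
Proof.
move=> AD [Dx Hx].
have /choice[f Hf] : forall n : nat, exists y, span A y /\ n2 (y - x) < n.+1%:R^-1.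
  move=> n; have [|y Ay xy] := Hx (n.+1%:R^-1); first by rewrite invr_gt0.
  by exists y; rewrite n2_distC//; apply: dom_span Ay.
exists f; split; first by move=> n; case: (Hf n).
apply: (squeeze_cvgr _ (cvg_cst 0) invS_cvg0).
by near=> n; rewrite n2_ge0 /=; apply: ltW; case: (Hf n).
Unshelve. all: by end_near. Qed.

(** Expanding around the limits leaves three inner products, each with one factor whose norm tends
    to 0 and one whose norm converges; Cauchy-Schwarz disposes of them. *)
Lemma cvg_dot (f g : nat -> V) x y : (forall n, D (f n)) -> (forall n, D (g n)) ->
  D x -> D y -> n2 (f n - x) @[n --> \oo] --> 0 ->
  n2 (g n - y) @[n --> \oo] --> 0 ->
  dot h (f n) (g n) @[n --> \oo] --> dot h x y.
Proof.
move=> Df Dg Dx Dy fx gy.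
have E n : dot h (f n) (g n) = dot h (f n - x) (g n - y) + dot h (f n - x) y +
    dot h (g n - y) x + dot h x y.
  rewrite !(dotBl, dotBr)//; do ?exact: domB.
  rewrite (dotC h (g n) x) (dotC h y x); ring.
under eq_fun do rewrite E.
have cs (u v : nat -> V) (a : R) : (forall n, D (u n)) -> (forall n, D (v n)) ->
    n2 (u n) @[n --> \oo] --> 0 -> n2 (v n) @[n --> \oo] --> a ->
    dot h (u n) (v n) @[n --> \oo] --> 0.
  move=> Du Dv u0 va; apply: sqr_cvg0.
  apply: (@squeeze_cvgr _ _ _ _ (fun=> 0) (fun n => n2 (u n) * n2 (v n))).
  - by near=> n; rewrite sqr_ge0 /=; exact: cauchy_schwarz.
  - exact: cvg_cst.
  - by rewrite -(mul0r a); apply: cvgM.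
have := cvgD (cvgD (cvgD (cs _ _ _ _ _ fx gy) (cs _ _ _ _ _ fx (cvg_cst (n2 y))))
  (cs _ _ _ _ _ gy (cvg_cst (n2 x)))) (cvg_cst (dot h x y)).
rewrite !add0r; apply => // n; exact: domB.
Unshelve. all: by end_near. Qed.

Lemma n2_0_cvg x : n2 (x - x) @[_ --> \oo] --> 0.
Proof. by rewrite subrr n2_0; exact: cvg_cst. Qed.

Lemma cvg_dotl (f : nat -> V) x y : (forall n, D (f n)) -> D x -> D y ->
  n2 (f n - x) @[n --> \oo] --> 0 -> dot h (f n) y @[n --> \oo] --> dot h x y.
Proof.
by move=> Df Dx Dy fx; apply: cvg_dot => //; exact: n2_0_cvg.
Qed.

Lemma dot_cl_eq0 A x z : A `<=` D -> D z -> (forall y, A y -> dot h y z = 0) ->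
  cl A x -> dot h x z = 0.
Proof.
move=> AD Dz Hz /[dup] /cl_dom Dx /(cl_seq AD)[f [Af fx]].
have Df n : D (f n) by apply: dom_span (Af n).
have := cvg_dot Df (fun=> Dz) Dx Dz fx (@n2_0_cvg z).
suff -> : (fun n => dot h (f n) z) = (fun=> 0).
  by move=> /(cvg_unique _ (cvg_cst 0)) => <-.
apply/funext => n; elim: (Af n) => [|c y t Ay At IH]; first by rewrite dot0l.
have Dy := AD _ Ay; have Dt := dom_span AD At.
by rewrite dotDl//; [rewrite dotZl// IH Hz// mulr0 addr0|exact: domZ].
Qed.

Lemma cl_orthogonal A B : A `<=` D -> B `<=` D ->
  (forall x y, A x -> B y -> dot h x y = 0) ->
  forall x y, cl A x -> cl B y -> dot h x y = 0.
Proof.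
move=> AD BD H x y clx cly; apply: dot_cl_eq0 (clx) => //; first exact: cl_dom cly.
move=> a Aa; rewrite dotC; apply: dot_cl_eq0 cly => //; first exact: AD.
by move=> b Bb; rewrite dotC; exact: H.
Qed.

Lemma cauchy_lim (f : nat -> V) : complete_inner h -> (forall n, D (f n)) ->
  (forall e, 0 < e -> exists N, forall m n, (N <= m)%N -> (N <= n)%N ->
     n2 (f m - f n) < e) ->
  exists2 g, D g & n2 (f n - g) @[n --> \oo] --> 0.
Proof.
move=> hc Df /(hc f Df)[g Dg H]; by exists g => //; apply/n2_cvgP.
Qed.

Lemma cvg_cauchy_n2 (f : nat -> V) x : (forall n, D (f n)) -> D x ->
  n2 (f n - x) @[n --> \oo] --> 0 ->
  forall e, 0 < e -> exists N, forall m n, (N <= m)%N -> (N <= n)%N ->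
     n2 (f m - f n) < e.
Proof.
move=> Df Dx /n2_cvgP H e e0.
have [|N HN] := H (e / 4); first by lra.
exists N => m n /HN Hm /HN Hn; have := n2_triangle (Df m) Dx (Df n).
rewrite (n2_distC Dx (Df n)); lra.
Qed.

Lemma lim_cl A (f : nat -> V) x : A `<=` D -> (forall n, span A (f n)) -> D x ->
  n2 (f n - x) @[n --> \oo] --> 0 -> cl A x.
Proof.
move=> AD Af Dx /n2_cvgP H; split=> // e /H[N /(_ N (leqnn _)) fx].
by exists (f N) => //; rewrite n2_distC//; apply: dom_span (Af N).
Qed.

(** By Pythagoras the two components of an approximating sequence are Cauchy separately, so
    completeness provides their limits. The decomposition holds up to a vector of norm 0. *)
Lemma cl_setU_orthogonal A B z : complete_inner h -> A `<=` D -> B `<=` D ->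
  (forall x y, A x -> B y -> dot h x y = 0) -> cl (A `|` B) z ->
  exists x y, [/\ cl A x, cl B y & n2 (z - (x + y)) = 0].
Proof.
move=> hc AD BD AB clz; have Dz := cl_dom clz.
have ABD : A `|` B `<=` D by move=> ? [/AD|/BD].
have [f [ABf fz]] := cl_seq ABD clz.
have /choice[ab Hab] : forall n, exists p : V * V,
    [/\ span A p.1, span B p.2 & f n = p.1 + p.2].
  by move=> n; have [a [b ?]] := span_setU (ABf n); exists (a, b).
pose a n := (ab n).1; pose b n := (ab n).2.
have Aa n : span A (a n) by case: (Hab n).
have Bb n : span B (b n) by case: (Hab n).
have Da n : D (a n) := dom_span AD (Aa n).
have Db n : D (b n) := dom_span BD (Bb n).
have Df n : D (f n) := dom_span ABD (ABf n).
have fE n : f n = a n + b n by case: (Hab n).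
have pyth m n : n2 (f m - f n) = n2 (a m - a n) + n2 (b m - b n).
  rewrite !fE opprD addrACA (n2D (domB (Da m) (Da n)) (domB (Db m) (Db n))).
  suff -> : dot h (a m - a n) (b m - b n) = 0 by ring.
  apply: (cl_orthogonal AD BD) => //; apply: span_cl => //; exact: spanB.
have Cf := cvg_cauchy_n2 Df Dz fz.
have [x Dx ax] : exists2 x, D x & n2 (a n - x) @[n --> \oo] --> 0.
  apply: cauchy_lim => // e /Cf[N HN]; exists N => m n Nm Nn.
  by have := HN m n Nm Nn; rewrite pyth; have := n2_ge0 h (b m - b n); lra.
have [y Dy b_y] : exists2 y, D y & n2 (b n - y) @[n --> \oo] --> 0.
  apply: cauchy_lim => // e /Cf[N HN]; exists N => m n Nm Nn.
  by have := HN m n Nm Nn; rewrite pyth; have := n2_ge0 h (a m - a n); lra.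
exists x, y; split; [exact: lim_cl ax|exact: lim_cl b_y|].
apply/eqP; rewrite eq_le n2_ge0 andbT; apply: le_epsilon0 => e e0.
move/n2_cvgP : fz => /(_ (e / 8))[|N1 H1]; first by lra.
move/n2_cvgP : ax => /(_ (e / 16))[|N2 H2]; first by lra.
move/n2_cvgP : b_y => /(_ (e / 16))[|N3 H3]; first by lra.
pose n := maxn N1 (maxn N2 N3).
have := H1 n (leq_maxl _ _).
have := H2 n (leq_trans (leq_maxl _ _) (leq_maxr _ _)).
have := H3 n (leq_trans (leq_maxr _ _) (leq_maxr _ _)).
have := n2_triangle Dz (Df n) (domD Dx Dy).
rewrite (n2_distC Dz (Df n)) [in n2 (f n - (x + y))]fE opprD addrACA.
have := n2D_le (domB (Da n) Dx) (domB (Db n) Dy); lra.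
Qed.

End closure.

(** * Isometries as relations in a product space *)

Section product.
Context {R : realType} {V1 V2 : lmodType R}.
Variables (h1 : semi_inner V1) (h2 : semi_inner V2).

Definition prod_inner : semi_inner (V1 * V2)%type.
Proof.
apply: (@SemiInner _ _ [set p | dom h1 p.1 /\ dom h2 p.2]
    (fun p q => dot h1 p.1 q.1 + dot h2 p.2 q.2)).
- by split; exact: dom0.
- by move=> x y [? ?] [? ?]; split; exact: domD.
- by move=> c x [? ?]; split; exact: domZ.
- by move=> x y; rewrite (dotC h1) (dotC h2).
- by move=> x y z [? ?] [? ?] [? ?]; rewrite !dotDl// addrACA.
- by move=> c x z [? ?] [? ?]; rewrite !dotZl// mulrDr.
- by move=> x; rewrite addr_ge0// dot_ge0.
Defined.

Local Notation h := prod_inner.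

Lemma n2_prodE p : n2 h p = n2 h1 p.1 + n2 h2 p.2.
Proof. by []. Qed.

(** The relation [S] is the graph of a partial isometry. Graphs avoid choosing the image of a
    vector, which is determined only up to null vectors, and their closure in the product is the
    extended isometry. *)
Definition isometric (S : set (V1 * V2)) :=
  forall p q, S p -> S q -> dot h1 p.1 q.1 = dot h2 p.2 q.2.

Variable S : set (V1 * V2).
Hypotheses (SD : S `<=` dom h) (iS : isometric S).

Lemma span_isometric : isometric (span S).
Proof.
move=> p q Sp; elim=> [|c y z Sy Sz IH].
  by rewrite !(dotC _ _ 0) !dot0l//; case: (dom_span SD Sp).
have [Dp1 Dp2] := dom_span SD Sp; have [Dy1 Dy2] := SD Sy.
have [Dz1 Dz2] := dom_span SD Sz.
rewrite !dotDr ?dotZr ?IH//; try exact: domZ.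
congr (_ * _ + _).
elim: Sp {Dp1 Dp2 IH} => [|d s t Ss St IH]; first by rewrite !dot0l.
have [Ds1 Ds2] := SD Ss; have [Dt1 Dt2] := dom_span SD St.
by rewrite !dotDl ?dotZl ?IH ?(iS Ss Sy)//; exact: domZ.
Qed.

Lemma cvg_prod_fst (f : nat -> V1 * V2) p : n2 h (f n - p) @[n --> \oo] --> 0 ->
  n2 h1 ((f n).1 - p.1) @[n --> \oo] --> 0.
Proof.
move/n2_cvgP => H; apply/(n2_cvgP h1) => e /H[N HN]; exists N => n /HN.
by rewrite n2_prodE /=; have := n2_ge0 h2 ((f n).2 - p.2); lra.
Qed.

Lemma cvg_prod_snd (f : nat -> V1 * V2) p : n2 h (f n - p) @[n --> \oo] --> 0 ->
  n2 h2 ((f n).2 - p.2) @[n --> \oo] --> 0.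
Proof.
move/n2_cvgP => H; apply/(n2_cvgP h2) => e /H[N HN]; exists N => n /HN.
by rewrite n2_prodE /=; have := n2_ge0 h1 ((f n).1 - p.1); lra.
Qed.

Lemma cl_isometric : isometric (cl h S).
Proof.
move=> p q Cp Cq.
have [Dp1 Dp2] := cl_dom Cp; have [Dq1 Dq2] := cl_dom Cq.
have [f [Sf fp]] := cl_seq SD Cp; have [g [Sg gq]] := cl_seq SD Cq.
have Df n : dom h (f n) := dom_span SD (Sf n).
have Dg n : dom h (g n) := dom_span SD (Sg n).
have c1 := cvg_dot (fun n => (Df n).1) (fun n => (Dg n).1) Dp1 Dq1
  (cvg_prod_fst fp) (cvg_prod_fst gq).
have c2 := cvg_dot (fun n => (Df n).2) (fun n => (Dg n).2) Dp2 Dq2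
  (cvg_prod_snd fp) (cvg_prod_snd gq).
apply: cvg_unique c1 _ => //.
suff -> : (fun n => dot h1 (f n).1 (g n).1) = (fun n => dot h2 (f n).2 (g n).2) by [].
by apply/funext => n; exact: span_isometric.
Qed.

Lemma cl_n2 p : cl h S p -> n2 h1 p.1 = n2 h2 p.2.
Proof. by move=> ?; exact: cl_isometric. Qed.

Lemma span_fst F : span (fst @` S) F -> exists X, span S (F, X).
Proof.
by move=> /(@span_image _ _ _ (@fst V1 V2))[[G X] SX ->]; exists X.
Qed.

Lemma span_snd X : span (snd @` S) X -> exists F, span S (F, X).
Proof.
by move=> /(@span_image _ _ _ (@snd V1 V2))[[F Y] SX ->]; exists F.
Qed.

Lemma fst_dom : fst @` S `<=` dom h1. Proof. by move=> _ [p /SD[? ?] <-]. Qed.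

Lemma snd_dom : snd @` S `<=` dom h2. Proof. by move=> _ [p /SD[? ?] <-]. Qed.

Lemma cl_fst p : cl h S p -> cl h1 (fst @` S) p.1.
Proof.
move=> [[D1 D2] H]; split=> // e /H[q Sq pq]; exists q.1.
  by have := image_span (@fst V1 V2) Sq.
by move: pq; rewrite n2_prodE /=; have := n2_ge0 h2 (p.2 - q.2); lra.
Qed.

Lemma cl_snd p : cl h S p -> cl h2 (snd @` S) p.2.
Proof.
move=> [[D1 D2] H]; split=> // e /H[q Sq pq]; exists q.2.
  by have := image_span (@snd V1 V2) Sq.
by move: pq; rewrite n2_prodE /=; have := n2_ge0 h1 (p.1 - q.1); lra.
Qed.

(** An approximating sequence of first components is Cauchy; being isometric, so is the sequence of
    its partners, and completeness of the second space gives the limit. *)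
Lemma lift_fst F : complete_inner h2 -> cl h1 (fst @` S) F ->
  exists X, cl h S (F, X).
Proof.
move=> hc clF; have DF := cl_dom clF; have [f [Sf fF]] := cl_seq fst_dom clF.
have /choice[X SX] := fun n => span_fst (Sf n).
have Df n : dom h1 (f n) by have [] := dom_span SD (SX n).
have DX n : dom h2 (X n) by have [] := dom_span SD (SX n).
have [Y DY XY] : exists2 Y, dom h2 Y & n2 h2 (X n - Y) @[n --> \oo] --> 0.
  apply: cauchy_lim => // e /(cvg_cauchy_n2 Df DF fF)[N HN]; exists N => m n Nm Nn.
  have := HN m n Nm Nn; have := span_isometric (spanB (SX m) (SX n)) (spanB (SX m) (SX n)).
  by rewrite /n2/= => ->.
exists Y; apply: (@lim_cl _ _ _ _ (fun n => (f n, X n))) => //.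
have := cvgD fF XY; rewrite addr0; exact.
Qed.

Lemma lift_snd X : complete_inner h1 -> cl h2 (snd @` S) X ->
  exists F, cl h S (F, X).
Proof.
move=> hc clX; have DX := cl_dom clX; have [f [Sf fX]] := cl_seq snd_dom clX.
have /choice[F SF] := fun n => span_snd (Sf n).
have Df n : dom h2 (f n) by have [] := dom_span SD (SF n).
have DF n : dom h1 (F n) by have [] := dom_span SD (SF n).
have [G DG FG] : exists2 G, dom h1 G & n2 h1 (F n - G) @[n --> \oo] --> 0.
  apply: cauchy_lim => // e /(cvg_cauchy_n2 Df DX fX)[N HN]; exists N => m n Nm Nn.
  have := HN m n Nm Nn; have := span_isometric (spanB (SF m) (SF n)) (spanB (SF m) (SF n)).
  by rewrite /n2/= => ->.
exists G; apply: (@lim_cl _ _ _ _ (fun n => (F n, f n))) => //.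
have := cvgD FG fX; rewrite addr0; exact.
Qed.

End product.

(** On the closed graph the two components of a difference have equal norms, so an approximation of
    the first components alone approximates the pair. *)
Lemma cl_dense_fst {R : realType} {V1 V2 : lmodType R} (h1 : semi_inner V1)
  (h2 : semi_inner V2) (S S' : set (V1 * V2)) p :
  S `<=` dom (prod_inner h1 h2) -> isometric h1 h2 S ->
  S' `<=` cl (prod_inner h1 h2) S ->
  cl (prod_inner h1 h2) S p -> cl h1 (fst @` S') p.1 ->
  cl (prod_inner h1 h2) S' p.
Proof.
move=> SD iS S'S Cp [D1 Hp]; split; first exact: cl_dom Cp.
move=> e e0; have [|g /span_fst[X S'g] pg] := Hp (e / 2); first by lra.
exists (g, X) => //; rewrite n2_prodE.
have <- /= : n2 h1 (p - (g, X)).1 = n2 h2 (p - (g, X)).2.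
  apply: (cl_n2 SD iS); apply: clB => //.
  exact: span_cl_sub S'g.
lra.
Qed.

(** * Sequences with geometrically small increments *)

Section geometric_cauchy.
Context {R : realType}.
Variables (u : nat -> R) (C q : R) (N : nat).
Hypotheses (q0 : 0 < q) (q1 : q < 1).
Hypothesis uq : forall k, (N <= k)%N -> `|u k.+1 - u k| <= C * q ^+ k.

Let C0 : 0 <= C.
Proof.
have := le_trans (normr_ge0 _) (uq (leqnn N)).
by rewrite pmulr_lge0// exprn_gt0.
Qed.

Let K := C / (1 - q).

Let K0 : 0 <= K. Proof. by rewrite divr_ge0// subr_ge0 ltW. Qed.

Lemma geometric_dist m k : (N <= k)%N -> (k <= m)%N ->
  `|u m - u k| <= K * q ^+ k.
Proof.
(* The sharper bound is the exact sum of the increments' bounds from [k] to [m], which makes the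
   induction close. *)
move=> Nk km; suff H : `|u m - u k| <= K * (q ^+ k - q ^+ m).
  apply: le_trans H _; rewrite ler_wpM2l// gerBl exprn_ge0// ltW//.
rewrite -(subnK km) addnC; elim: (m - k)%N => [|j IH].
  by rewrite addn0 !subrr mulr0 normr0.
rewrite addnS -(subrK (u (k + j)%N) (u _)) -addrA.
apply: le_trans (ler_normD _ _) _.
have -> : K * (q ^+ k - q ^+ (k + j).+1) =
    C * q ^+ (k + j) + K * (q ^+ k - q ^+ (k + j)).
  by rewrite /K exprS; field; rewrite subr_eq0 gt_eqF.
by apply: lerD => //; apply: uq; apply: leq_trans Nk (leq_addr _ _).
Qed.

Lemma geometric_cvg : cvgn u.
Proof.
apply/cauchy_cvgP/cauchy_exP => e e0.
have Kq : K * q ^+ k @[k --> \oo] --> 0.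
  rewrite -(mulr0 K); apply: cvgMr; apply: cvg_expr.
  by rewrite ger0_norm// ltW.
move/cvgrPdist_lt : Kq => /(_ _ e0)[M _ HM].
exists (u (maxn N M)); exists (maxn N M) => // m /= Mm.
rewrite /ball /= distrC; apply: le_lt_trans (geometric_dist (leq_maxl _ _) Mm) _.
have := HM _ (leq_maxr N M).
by rewrite /= sub0r normrN ger0_norm// mulr_ge0// exprn_ge0// ltW.
Qed.

Lemma geometric_lim k : (N <= k)%N -> `|limn u - u k| <= K * q ^+ k.
Proof.
move=> Nk; have c : `|u m - u k| @[m --> \oo] --> `|limn u - u k|.
  by apply: cvg_norm; apply: cvgB; [exact: geometric_cvg|exact: cvg_cst].
rewrite -(cvg_lim (@Rhausdorff _) c); apply: limr_le; first exact: cvgP c.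
near=> m; apply: geometric_dist => //.
by near: m; exists k.
Unshelve. all: by end_near. Qed.

End geometric_cauchy.

Lemma limn_einf_le {R : realType} (u : (\bar R)^nat) (e : \bar R) N :
  (forall n, (N <= n)%N -> (u n <= e)%E) -> (limn_einf u <= e)%E.
Proof.
move=> H; rewrite limn_einf_lim; apply: lime_le; first exact: is_cvg_einfs.
near=> n; apply: (@le_trans _ _ (u n)).
  by apply: ereal_inf_lbound; exists n => //=.
by apply: H; near: n; exists N.
Unshelve. all: by end_near. Qed.

(** * Square integrable functions and their completeness *)

Section square_integrable_functions.
Context {d : measure_display} {T : measurableType d} {R : realType}.
Variable mu : {measure set T -> \bar R}.
Implicit Types (f g : T -> R).

Definition L2 f := measurable_fun [set: T] f /\
  (\int[mu]_x (f x ^+ 2)%:E < +oo)%E.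

(** [fine] sends an infinite integral to 0, so bilinearity holds on [L2] and not on all
    functions. *)
Definition ip f g : R := fine (\int[mu]_x (f x * g x)%:E).

Lemma measurable_EFin_sqr f : measurable_fun [set: T] f ->
  measurable_fun [set: T] (fun x => (f x ^+ 2)%:E).
Proof. by move=> mf; apply/measurable_EFinP; exact: measurable_funX. Qed.

Lemma sqr_EFin_ge0 f x : (0 <= (f x ^+ 2)%:E)%E.
Proof. by rewrite lee_fin sqr_ge0. Qed.
Hint Resolve sqr_EFin_ge0 : core.

Lemma sq_integrable f : L2 f -> mu.-integrable [set: T] (fun x => (f x ^+ 2)%:E).
Proof.
move=> [mf fy]; apply/integrableP; split; first exact: measurable_EFin_sqr.
by under eq_integral do rewrite gee0_abs//.
Qed.

Lemma ip_integrable f g : L2 f -> L2 g ->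
  mu.-integrable [set: T] (fun x => (f x * g x)%:E).
Proof.
move=> L2f L2g; have [mf _] := L2f; have [mg _] := L2g.
apply: (@le_integrable _ _ _ _ _ _ _ (fun x => (f x ^+ 2)%:E + (g x ^+ 2)%:E)%E) => //.
- by apply/measurable_EFinP; exact: measurable_funM.
- move=> x _; rewrite -EFinD /= !lee_fin [leRHS]ger0_norm ?addr_ge0 ?sqr_ge0//.
  rewrite ler_norml; apply/andP; split.
    have := sqr_ge0 (f x + g x); have := sqr_ge0 (f x); have := sqr_ge0 (g x); rewrite !expr2; nra.
  have := sqr_ge0 (f x - g x); have := sqr_ge0 (f x); have := sqr_ge0 (g x); rewrite !expr2; nra.
- by apply: integrableD => //; exact: sq_integrable.
Qed.

Lemma ipE f g : L2 f -> L2 g -> (\int[mu]_x (f x * g x)%:E)%E = (ip f g)%:E.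
Proof.
by move=> L2f L2g; rewrite fineK//; apply: integrable_fin_num => //; exact: ip_integrable.
Qed.

Lemma sqE f : L2 f -> (\int[mu]_x (f x ^+ 2)%:E)%E = (ip f f)%:E.
Proof. by move=> L2f; rewrite -ipE//. Qed.

Lemma L2_0 : L2 0.
Proof.
split; first exact: measurable_cst.
under eq_integral do rewrite expr0n /=.
by rewrite integral0.
Qed.

Lemma L2Z c f : L2 f -> L2 (c *: f).
Proof.
move=> L2f; have [mf fy] := L2f; split.
  by apply: measurable_funM => //; exact: measurable_cst.
under eq_integral do rewrite exprMn EFinM.
rewrite ge0_integralZl_EFin//; last 2 first.
- exact: measurable_EFin_sqr.
- exact: sqr_ge0.
by rewrite sqE// -EFinM ltry.
Qed.

Lemma L2D f g : L2 f -> L2 g -> L2 (f + g).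
Proof.
move=> L2f L2g; have [mf fy] := L2f; have [mg gy] := L2g; split.
  exact: measurable_funD.
have [m2f f2] := L2Z 2 L2f; have [m2g g2] := L2Z 2 L2g.
apply: (@le_lt_trans _ _ (\int[mu]_x ((2 *: f : T -> R) x ^+ 2)%:E +
    \int[mu]_x ((2 *: g : T -> R) x ^+ 2)%:E)%E); last first.
  exact: lte_add_pinfty.
rewrite -ge0_integralD//; [|exact: (measurable_EFin_sqr m2f)|exact: (measurable_EFin_sqr m2g)].
apply: ge0_le_integral => //.
- exact: (measurable_EFin_sqr (measurable_funD mf mg)).
- exact: (emeasurable_funD (measurable_EFin_sqr m2f) (measurable_EFin_sqr m2g)).
move=> x _; rewrite -EFinD lee_fin.
have -> : (f + g) x = f x + g x by [].
have -> : (2 *: f : T -> R) x = 2 * f x by [].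
have -> : (2 *: g : T -> R) x = 2 * g x by [].
have := sqr_ge0 (f x - g x); have := sqr_ge0 (f x); have := sqr_ge0 (g x).
rewrite !expr2; nra.
Qed.

Definition L2_inner : semi_inner (T -> R).
Proof.
apply: (@SemiInner _ _ L2 ip L2_0 L2D L2Z).
- by move=> f g; rewrite /ip; under eq_integral do rewrite mulrC.
- move=> f g k L2f L2g L2k; rewrite /ip.
  under eq_integral do rewrite mulrDl EFinD.
  rewrite integralD//; try exact: ip_integrable.
  by rewrite !ipE.
- move=> c f g L2f L2g; rewrite /ip.
  under eq_integral do rewrite -mulrA EFinM.
  rewrite integralZl//; last exact: ip_integrable.
  by rewrite !ipE.
- move=> f; rewrite fine_ge0//; apply: integral_ge0 => x _.
  by rewrite lee_fin -expr2 sqr_ge0.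
Defined.

End square_integrable_functions.

Section riesz_fischer.
Context {d : measure_display} {T : measurableType d} {R : realType}.
Variable mu : {measure set T -> \bar R}.
Implicit Types (f g : T -> R).
Local Notation h := (L2_inner mu).
Hint Resolve sqr_EFin_ge0 : core.

Lemma L2_le_integral f g : measurable_fun [set: T] f -> L2 mu g ->
  (\int[mu]_x (f x ^+ 2)%:E <= \int[mu]_x (g x ^+ 2)%:E)%E -> L2 mu f.
Proof. by move=> mf [mg gy] fg; split=> //; apply: le_lt_trans gy. Qed.

Lemma L2_sqE f : L2 mu f -> (\int[mu]_x (f x ^+ 2)%:E)%E = (n2 h f)%:E.
Proof. exact: sqE. Qed.

Lemma L2_ae_eq f g : measurable_fun [set: T] f -> measurable_fun [set: T] g ->
  f = g %[ae mu] ->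
  (\int[mu]_x (f x ^+ 2)%:E = \int[mu]_x (g x ^+ 2)%:E)%E.
Proof.
move=> mf mg fg; apply: ge0_ae_eq_integral => //; try exact: measurable_EFin_sqr.
by apply: filterS fg => x /= H _; rewrite (H I).
Qed.

Lemma n2_eq0_ae f : L2 mu f -> n2 h f = 0 -> f = 0 %[ae mu].
Proof.
move=> L2f f0; have [mf fy] := L2f.
have := L2_sqE L2f; rewrite f0 => H.
have [+ _] := ae_eq_integral_abs mu measurableT (measurable_EFin_sqr mf).
under eq_integral do rewrite gee0_abs//.
move=> /(_ H) H0; apply: filterS H0 => x /= /(_ I) [] /eqP.
by rewrite sqrf_eq0 => /eqP ->.
Qed.

Lemma ae_n2_eq0 f g : measurable_fun [set: T] f -> measurable_fun [set: T] g ->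
  f = g %[ae mu] -> n2 h (f - g) = 0.
Proof.
move=> mf mg fg; rewrite /n2 /= /ip.
have mfg : measurable_fun [set: T] (f - g) by exact: measurable_funB.
have -> : (\int[mu]_x ((f - g) x * (f - g) x)%:E =
   \int[mu]_x (((f - g) x) ^+ 2)%:E)%E by [].
rewrite (@L2_ae_eq _ 0) => //.
- by under eq_integral do rewrite expr0n /=; rewrite integral0.
- exact: measurable_cst.
by apply: filterS fg => x /= H /H fg; rewrite /GRing.add /= /GRing.opp /= fg subrr.
Qed.

Lemma ae_L2 f g : L2 mu f -> measurable_fun [set: T] g -> f = g %[ae mu] -> L2 mu g.
Proof.
move=> L2f mg fg; have [mf _] := L2f; apply: L2_le_integral L2f _ => //.
by rewrite (L2_ae_eq mf mg fg).
Qed.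

Lemma fatou_sqr (F : nat -> T -> R) g (e : \bar R) :
  (forall n, measurable_fun [set: T] (F n)) ->
  (forall x, F n x @[n --> \oo] --> g x) ->
  (exists N, forall n, (N <= n)%N -> (\int[mu]_x (F n x ^+ 2)%:E <= e)%E) ->
  (\int[mu]_x (g x ^+ 2)%:E <= e)%E.
Proof.
move=> mF Fg [N FN].
apply: le_trans (limn_einf_le FN).
have mF2 n := measurable_EFin_sqr (mF n).
have F0 n x : [set: T] x -> (0 <= (F n x ^+ 2)%:E)%E by [].
apply: le_trans (fatou mu measurableT mF2 F0).
rewrite le_eqVlt; apply/orP; left; apply/eqP; apply: eq_integral => x _.
have H : (F n x ^+ 2)%:E @[n --> \oo] --> (g x ^+ 2)%:E.
  apply: cvg_EFin; first by near=> n.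
  by apply: cvgM; exact: Fg.
by rewrite (cvg_limn_einf_sup H).1.
Unshelve. all: by end_near. Qed.

Lemma subsequence_geometric (f : nat -> T -> R) :
  (forall e : R, 0 < e -> exists N, forall m n, (N <= m)%N -> (N <= n)%N ->
     n2 h (f m - f n) < e) ->
  exists phi : nat -> nat, (forall k, (k <= phi k)%N) /\
    forall k, n2 h (f (phi k.+1) - f (phi k)) < (8^-1) ^+ k.
Proof.
move=> H; have /choice[N HN] : forall k : nat, exists N, forall m n, (N <= m)%N ->
    (N <= n)%N -> n2 h (f m - f n) < (8^-1 : R) ^+ k.
  by move=> k; apply: H; rewrite exprn_gt0// invr_gt0.
pose phi := fix phi k := if k is k'.+1 then maxn (phi k').+1 (N k) else N 0%N.
have phiN k : (N k <= phi k)%N by case: k => //= k; exact: leq_maxr.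
have phiS k : (phi k < phi k.+1)%N by exact: leq_maxl.
exists phi; split.
  by elim=> // k IH; exact: leq_ltn_trans IH (phiS k).
by move=> k; apply: HN => //; apply: leq_trans (phiN k) (ltnW (phiS k)).
Qed.

(** A subsequence with geometrically small increments converges almost everywhere, and Fatou's lemma
    shows that its pointwise limit is the limit in norm of the whole sequence. *)
Theorem L2_complete : complete_inner h.
Proof.
move=> f L2f Cf.
have [phi [phik phi8]] := subsequence_geometric Cf.
pose F k := f (phi k).
have L2F k : L2 mu (F k) by exact: L2f.
have L2D k : L2 mu (F k.+1 - F k) := domB (h := h) (L2F k.+1) (L2F k).
(* The weights 4^k against increments of squared norm below 8^-k leave the summable 2^-k; where
   [s x] is finite, the increments of [F] at [x] are at most a constant times 2^-k. *)
pose s x := (\sum_(0 <= k <oo) (((2 ^+ k *: (F k.+1 - F k) : T -> R)) x ^+ 2)%:E)%E.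
have L2s k : L2 mu (2 ^+ k *: (F k.+1 - F k)) := domZ (s := h) (2 ^+ k) (L2D k).
have ms k : measurable_fun setT
    (fun x => ((2 ^+ k *: (F k.+1 - F k) : T -> R) x ^+ 2)%:E).
  by apply: measurable_EFin_sqr; case: (L2s k).
have mS : measurable_fun setT s.
  by apply: (@ge0_emeasurable_sum _ _ _ _ _ xpredT).
have s0 x : (0 <= s x)%E by apply: nneseries_ge0.
have Is : (\int[mu]_x s x < +oo)%E.
  rewrite /s integral_nneseries//.
  apply: (@le_lt_trans _ _ (\sum_(0 <= k <oo) ((2^-1) ^+ k : R)%:E)%E).
    apply: lee_nneseries => [k _ _|k _]; first by apply: integral_ge0.
    rewrite L2_sqE// lee_fin n2Z; last exact: L2D.
    apply: (@le_trans _ _ ((2 ^+ k) ^+ 2 * (8^-1) ^+ k)).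
      by rewrite ler_wpM2l ?sqr_ge0 ?(ltW (phi8 k)).
    rewrite -exprM mulnC exprM -exprMn; suff -> : (2 ^+ 2 * 8^-1 : R) = 2^-1 by [].
    by field.
  have -> : (\sum_(0 <= k <oo) ((2^-1) ^+ k : R)%:E)%E = (2%:E : \bar R).
    apply/cvg_lim => //.
    have := @cvg_geometric_series R 1 2^-1.
    have -> : 1 / (1 - 2^-1) = 2 :> R by field.
    rewrite ger0_norm ?invr_ge0// => /(_ _)H.
    have {}H := H ltac:(lra).
    have -> : (fun n => \sum_(0 <= k < n) ((2^-1) ^+ k : R)%:E)%E =
        (fun n => (series (geometric 1 2^-1) n)%:E).
      apply/funext => n; rewrite /series/= -sumEFin; apply: eq_bigr => k _.
      by rewrite /geometric /= mul1r.
    by apply: cvg_EFin H; near=> n.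
  by rewrite ltry.
pose E := [set x | (s x < +oo)%E].
have mE : measurable E.
  by rewrite -[E]setTI; exact: emeasurable_fun_infty_o.
have aeE : \forall x \ae mu, E x.
  have : mu.-integrable setT s.
    by apply/integrableP; split=> //; under eq_integral do rewrite gee0_abs//.
  move=> /(integrable_ae measurableT); apply: filterS => x /(_ I).
  by rewrite ge0_fin_numE.
(* Set to 0 off the set of finiteness, the sequence converges at every point and its limit is
   measurable. *)
pose G k x := F k x * \1_E x.
have mG k : measurable_fun setT (G k).
  by apply: measurable_funM; [case: (L2F k)|exact: measurable_indic].
have cG x : cvgn (fun k => G k x).
  rewrite /G indicE; case: (boolP (x \in E)) => [|_]; last first.
    by under eq_fun do rewrite mulr0; exact: is_cvg_cst.
  rewrite inE => Ex; under eq_fun do rewrite mulr1.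
  have sfin : s x \is a fin_num by rewrite ge0_fin_numE.
  apply: (@geometric_cvg _ _ (fine (s x) + 1) 2^-1 0%N); rewrite ?invr_gt0//; first lra.
  move=> k _.
  have : (((2 ^+ k *: (F k.+1 - F k) : T -> R) x ^+ 2)%:E <= s x)%E.
    apply: le_trans (@nneseries_lim_ge _ _ xpredT 0%N k.+1 _) => //.
    by rewrite big_nat_recr//= leeDr//; apply: sume_ge0 => i _; exact: sqr_EFin_ge0.
  rewrite -(fineK sfin) lee_fin.
  have -> : (2 ^+ k *: (F k.+1 - F k) : T -> R) x = 2 ^+ k * (F k.+1 x - F k x) by [].
  set t := fine (s x); set D := F k.+1 x - F k x => H.
  have t0 : 0 <= t by exact: fine_ge0.
  have p2 : (0 : R) < 2 ^+ k by rewrite exprn_gt0.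
  have : `|2 ^+ k * D| <= t + 1.
    rewrite -ler_sqr ?nnegrE ?addr_ge0// real_normK ?num_real//. have : t <= (t + 1) ^+ 2 by rewrite expr2; nra. move: H; lra.
  rewrite normrM ger0_norm ?(ltW p2)// => HD.
  by rewrite exprVn ler_pdivlMr// mulrC.
pose g x := limn (fun k => G k x).
have mg : measurable_fun setT g.
  by apply: (measurable_fun_cvg mG) => x _; exact: cG.
have GF k : G k = F k %[ae mu].
  by apply: filterS aeE => x Ex _; rewrite /G indicE mem_set// mulr1.
have close (e : R) : 0 < e -> exists N, forall n, (N <= n)%N ->
    (\int[mu]_x ((f n - g) x ^+ 2)%:E <= e%:E)%E.
  move=> /Cf[N HN]; exists N => n Nn.
  have [mfn _] := L2f n.
  apply: (@fatou_sqr (fun k => f n - G k)).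
  - by move=> k; exact: measurable_funB.
  - by move=> x; apply: cvgB; [exact: cvg_cst|exact: cG].
  - exists N => k Nk.
    rewrite (@L2_ae_eq _ (f n - F k)).
    + rewrite L2_sqE; last exact: (domB (h := h) (L2f n) (L2F k)).
      by rewrite lee_fin ltW// HN//; exact: leq_trans Nk (phik k).
    + exact: measurable_funB.
    + by apply: measurable_funB => //; case: (L2F k).
    + by apply: filterS (GF k) => x /= H /H fg; rewrite /GRing.add /= /GRing.opp /= fg.
have L2fg n : (\int[mu]_x ((f n - g) x ^+ 2)%:E <= 1%:E)%E -> L2 mu (f n - g).
  by move=> H; split; [apply: measurable_funB => //; case: (L2f n)|apply: le_lt_trans H _; rewrite ltry].
have [|N1 HN1] := close 1; first exact: ltr01.
have L2g : L2 mu g.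
  have -> : g = f N1 - (f N1 - g) by rewrite subKr.
  by apply: (domB (h := h) (L2f N1)); apply: L2fg; exact: HN1.
exists g => // e e0; have [|N HN] := close (e / 2); first by rewrite divr_gt0.
exists N => n /HN; rewrite L2_sqE; last exact: (domB (h := h) (L2f n) L2g).
rewrite lee_fin /n2 => H; apply: le_lt_trans H _; lra.
Unshelve. all: by end_near. Qed.

End riesz_fischer.

(** * Changes of variable in Lebesgue integrals *)

Section substitution.
Context {R : realType}.
Local Notation mu := (@lebesgue_measure R).
Variables (phi w : R -> R) (D : set R).
Hypotheses (mphi : measurable_fun [set: R] phi) (mw : measurable_fun [set: R] w).
Hypotheses (w0 : forall x, 0 <= w x) (mD : measurable D).

Let dens (A : set (measurableTypeR R)) : \bar R :=
  (\int[mu]_(x in phi @^-1` A) (w x)%:E)%E.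

Let mpre (A : set R) : measurable A -> measurable (phi @^-1` A).
Proof. by move=> mA; rewrite -(setTI (_ @^-1` _)); exact: mphi. Qed.

Let wE0 x : (0 <= (w x)%:E)%E. Proof. by rewrite lee_fin. Qed.
Let mwE A : measurable_fun A (EFin \o w).
Proof. by apply: measurable_funTS; exact/measurable_EFinP. Qed.
Hint Resolve wE0 : core.

Let dens0 : dens set0 = 0%E.
Proof. by rewrite /dens preimage_set0 integral_set0. Qed.

Let dens_ge0 A : (0 <= dens A)%E.
Proof. by apply: integral_ge0. Qed.

Let dens_sigma_additive : semi_sigma_additive dens.
Proof.
move=> /= F mF tF mUF; rewrite /dens; apply: cvg_toP.
  apply: ereal_nondecreasing_is_cvgn => m n mn.
  by apply: lee_sum_nneg_natr => // k _ _; exact: dens_ge0.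
rewrite preimage_bigcup ge0_integral_bigcup//=.
- by move=> k; exact: (mpre (mF k)).
- exact: mwE.
- apply/trivIsetP => i j _ _ ij; rewrite -preimage_setI.
  by move/trivIsetP : tF => /(_ i j I I ij) ->; rewrite preimage_set0.
Qed.

HB.instance Definition _ := isMeasure.Build _ _ _
  dens dens0 dens_ge0 dens_sigma_additive.

Hypothesis phiD : forall x, D (phi x).
Hypothesis ocE : forall a b, a < b ->
  (\int[mu]_(x in phi @^-1` `]a, b]) (w x)%:E = mu (`]a, b] `&` D))%E.

Let mDc : measurable (~` D). Proof. exact: measurableC. Qed.

(** [dens] is the image under [phi] of the measure of density [w] and is carried by [D]. Adding to
    it Lebesgue measure outside [D] gives a measure that agrees with Lebesgue measure on half-open
    intervals, hence everywhere. *)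
Let dens_eq A : measurable A -> dens A = mu (A `&` D).
Proof.
pose nu : {measure set (measurableTypeR R) -> \bar R} := measure_add dens (mrestr mu mDc).
have nuE B : nu B = (dens B + mu (B `&` ~` D))%E by exact: measure_addE.
have E : forall B, measurable B -> mu B = nu B.
  apply: lebesgue_measure_unique => _ [[a b] _ <-]; rewrite nuE /=.
  have [ab|ba] := ltP a b; last first.
    by rewrite set_itv_ge ?dens0 ?set0I ?measure0 ?adde0// -leNgt bnd_simp.
  rewrite /dens ocE// -measureU; last 3 first.
  - exact: measurableI.
  - exact: measurableI.
  - by rewrite setIACA setICr !setI0.
  by rewrite -setIUr setUv setIT.
move=> mA; have mAD : measurable (A `&` D) by exact: measurableI.
have mADc : measurable (A `&` ~` D) by exact: measurableI.
have D1 : dens (A `&` D) = mu (A `&` D).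
  have := E _ mAD; rewrite nuE -setIA setICr setI0 measure0 adde0.
  by move=> ->.
have D2 : dens (A `&` ~` D) = 0%E.
  rewrite /dens (_ : _ @^-1` _ = set0) ?integral_set0//.
  by apply/seteqP; split => // x [_]; apply; exact: phiD.
have -> : dens A = (dens (A `&` D) + dens (A `&` ~` D))%E.
  rewrite -[LHS]/(dens _) -[in LHS](setIT A) -(setUv D) setIUr.
  by apply: measureU => //; rewrite setIACA setICr !setI0.
by rewrite D2 adde0 D1.
Qed.

Import HBNNSimple.

Let dens_nnsfun (g : {nnsfun R >-> R}) :
  (\int[mu]_x ((w x)%:E * (g (phi x))%:E) = \int[mu]_(x in D) (g x)%:E)%E.
Proof.
have mg (k : R) : measurable (g @^-1` [set k]) by [].
transitivity (\sum_(k \in range g) (k%:E * dens (g @^-1` [set k])))%E.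
  transitivity (\int[mu]_x (\sum_(k \in range g)
      ((k * (w x * \1_(phi @^-1` (g @^-1` [set k])) x))%:E)))%E.
    apply: eq_integral => x _; rewrite -EFinM [in LHS]fimfunE fsumEFin//; congr EFin.
    by rewrite mulr_fsumr; apply: eq_fsbigr => k _; rewrite mulrCA.
  rewrite ge0_integral_fsum//.
  - apply: eq_fsbigr => k; rewrite inE => -[y _ gy].
    have k0 : 0 <= k by rewrite -gy.
    under eq_integral do rewrite EFinM.
    rewrite ge0_integralZl_EFin//.
    + congr (_ * _)%E; rewrite /dens [RHS]integral_mkcond; apply: eq_integral => x _.
      by rewrite epatch_indic EFinM.
    + by move=> x _; rewrite lee_fin mulr_ge0.
    + apply/measurable_EFinP/measurable_funM => //.
      by apply: measurable_indic; exact: mpre.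
  - move=> k; apply/measurable_EFinP/measurable_funM => //.
    apply: measurable_funM => //.
    by apply: measurable_indic; exact: mpre.
  - move=> k x _; rewrite lee_fin.
    rewrite mulrCA mulr_ge0//.
    by have := nnfun_muleindic_ge0 g k (phi x); rewrite -EFinM lee_fin.
transitivity (\sum_(k \in range g) (k%:E * mu (g @^-1` [set k] `&` D)))%E.
  by apply: eq_fsbigr => k _; congr (_ * _)%E; exact: (dens_eq (mg k)).
under [RHS]eq_integral do rewrite fimfunE -fsumEFin//.
rewrite ge0_integral_fsum//.
- apply: eq_fsbigr => k; rewrite inE => -[y _ gy].
  have k0 : 0 <= k by rewrite -gy.
  under [RHS]eq_integral do rewrite EFinM.
  rewrite ge0_integralZl_EFin//.
  + by congr (_ * _)%E; apply/esym; exact: (integral_indic mu mD (mg k)).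
  + by apply/measurable_EFinP; apply: (measurable_indic (mg k)).
- move=> k; apply/measurable_EFinP/measurable_funM => //.
  exact: (measurable_indic (mg k)).
- by move=> k x _; exact: nnfun_muleindic_ge0.
Qed.

(** The identity passes from sets to simple functions and then to increasing limits. As the
    hypothesis concerns half-open intervals only, affine maps and the exponential become two
    instances. *)
Lemma ge0_integral_substitution (f : R -> \bar R) :
  measurable_fun [set: R] f -> (forall x, (0 <= f x)%E) ->
  (\int[mu]_x ((w x)%:E * f (phi x)) = \int[mu]_(x in D) f x)%E.
Proof.
move=> mf f0; have f0' x : [set: R] x -> (0 <= f x)%E by [].
pose f_ := nnsfun_approx measurableT mf.
have mphi_ (g : R -> \bar R) : measurable_fun setT g ->
    measurable_fun setT (fun x => g (phi x)).
  by move=> mg; apply: measurableT_comp mg mphi.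
have ndf x m n : (m <= n)%N -> ((f_ m x)%:E <= (f_ n x)%:E)%E.
  by move=> mn; rewrite lee_fin; exact/lefP/nd_nnsfun_approx.
have cvf x : (f_ n x)%:E @[n --> \oo] --> f x.
  exact: (@cvg_nnsfun_approx _ _ _ _ measurableT _ mf f0' x I).
have mfn n : measurable_fun setT (EFin \o f_ n) by exact/measurable_EFinP.
transitivity (limn (fun n => \int[mu]_x ((w x)%:E * (f_ n (phi x))%:E)))%E.
  rewrite -monotone_convergence//.
  - apply: eq_integral => x _; apply/esym/cvg_lim => //.
    by apply: cvgeZl => //; exact: cvf.
  - by move=> n; apply: emeasurable_funM; [exact: mwE|exact: (mphi_ _ (mfn n))].
  - by move=> n x _; rewrite mule_ge0// lee_fin.
  - by move=> x _ m n mn; rewrite lee_wpmul2l//; exact: ndf.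
transitivity (limn (fun n => \int[mu]_(x in D) (f_ n x)%:E))%E.
  by congr (limn _); apply/funext => n; exact: dens_nnsfun.
rewrite -monotone_convergence//.
- by apply: eq_integral => x _; apply/cvg_lim => //; exact: cvf.
- by move=> n; apply: measurable_funTS; exact: mfn.
- by move=> n x _; rewrite lee_fin.
- by move=> x _ m n mn; exact: ndf.
Qed.

End substitution.

Section lebesgue_substitutions.
Context {R : realType}.
Local Notation mu := (@lebesgue_measure R).
Implicit Types (f : R -> \bar R).

Lemma integral_itv_cst (I : interval R) (k : R) :
  (\int[mu]_(x in [set` I]) k%:E = k%:E * mu [set` I])%E.
Proof. by rewrite integral_cst. Qed.

Lemma ge0_integral_affine (s c : R) f : s != 0 ->
  measurable_fun [set: R] f -> (forall x, (0 <= f x)%E) ->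
  (\int[mu]_x (`|s|%:E * f (s * x + c)%R) = \int[mu]_x f x)%E.
Proof.
move=> s0 mf f0.
apply: (@ge0_integral_substitution _ (fun x => s * x + c) (fun=> `|s|) setT) => //.
- by apply: measurable_funD => //; apply: measurable_funM.
move=> a b ab; rewrite setIT lebesgue_measure_itv/= lte_fin ab.
have [sp|sn|s00] := ltgtP s 0; last by rewrite s00 eqxx in s0.
- rewrite (_ : _ @^-1` _ = `[(b - c) / s, (a - c) / s[%classic).
    rewrite integral_itv_cst lebesgue_measure_itv/= lte_fin ltr_ndivrMr// divfK//.
    by rewrite ltrD2r ab -EFinM ltr0_norm// -!EFinB; congr EFin; field.
  apply/seteqP; split => x /=; rewrite !in_itv/= ler_ndivrMr// ltr_ndivlMr//.
    by move=> /andP[? ?]; apply/andP; split; lra.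
  by move=> /andP[? ?]; apply/andP; split; lra.
- rewrite (_ : _ @^-1` _ = `](a - c) / s, (b - c) / s]%classic).
    rewrite integral_itv_cst lebesgue_measure_itv/= lte_fin ltr_pdivrMr// divfK//.
    by rewrite ltrD2r ab -EFinM gtr0_norm// -!EFinB; congr EFin; field.
  apply/seteqP; split => x /=; rewrite !in_itv/= ltr_pdivrMr// ler_pdivlMr//.
    by move=> /andP[? ?]; apply/andP; split; lra.
  by move=> /andP[? ?]; apply/andP; split; lra.
Qed.

Lemma ge0_integral_reflection u f :
  measurable_fun [set: R] f -> (forall x, (0 <= f x)%E) ->
  (\int[mu]_x f (u - x)%R = \int[mu]_x f x)%E.
Proof.
move=> mf f0; rewrite -[RHS](@ge0_integral_affine (- 1) u)//.
by apply: eq_integral => x _; rewrite normrN normr1 mul1e mulN1r addrC.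
Qed.

Lemma integral_expRN z : 0 < z ->
  (\int[mu]_(x in `[0%R, +oo[) (expR (- z * x))%:E = (z^-1)%:E)%E.
Proof.
move=> z0; have := integral_exponential_pdf z0.
have -> : (\int[mu]_x (exponential_pdf z x)%:E =
   \int[mu]_(x in `[0%R, +oo[) (z%:E * (expR (- z * x))%:E))%E.
  rewrite [RHS]integral_mkcond; apply: eq_integral => x _.
  by rewrite /exponential_pdf !patchE; case: ifP.
rewrite ge0_integralZl_EFin//.
- move=> /(congr1 (fun t => (z^-1)%:E * t)%E).
  by rewrite muleA -EFinM mulVf ?gt_eqF// mul1e mule1.
- apply: measurable_funTS; apply/measurable_EFinP.
  by apply: measurableT_comp => //; exact: measurable_funM.
- exact: ltW.
Qed.

Lemma integral_expR z u : 0 < z ->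
  (\int[mu]_(x in `]-oo, u]) (expR (z * x))%:E = (expR (z * u) / z)%:E)%E.
Proof.
move=> z0; rewrite integral_mkcond -(@ge0_integral_reflection u).
- transitivity (\int[mu]_(x in `[0%R, +oo[) ((expR (z * u))%:E * (expR (- z * x))%:E))%E.
    rewrite [RHS]integral_mkcond; apply: eq_integral => x _; rewrite !patchE.
    have -> : (u - x \in `]-oo, u]%classic) = (x \in `[0, +oo[%classic).
      by apply/idP/idP; rewrite !inE /= !in_itv/= ?andbT => ?; lra.
    by case: ifP => // _; rewrite -EFinM -expRD; congr (expR _)%:E; ring.
  rewrite ge0_integralZl_EFin ?expR_ge0//.
  + by rewrite integral_expRN.
  + apply: measurable_funTS; apply/measurable_EFinP.
    by apply: measurableT_comp => //; exact: measurable_funM.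
- apply/(measurable_restrictT _ _).1 => //; apply: measurable_funTS; apply/measurable_EFinP.
  by apply: measurableT_comp => //; exact: measurable_funM.
- by move=> x; rewrite patchE; case: ifP => // _; rewrite lee_fin expR_ge0.
Qed.

Lemma ge0_integral_expR_substitution f :
  measurable_fun [set: R] f -> (forall x, (0 <= f x)%E) ->
  (\int[mu]_x ((expR x)%:E * f (expR x)) = \int[mu]_(x in `]0%R, +oo[) f x)%E.
Proof.
move=> mf f0.
apply: (@ge0_integral_substitution _ expR expR `]0, +oo[%classic) => //.
- by move=> x /=; rewrite in_itv/= expR_gt0.
have expE b : 0 < b -> (\int[mu]_(x in `]-oo, ln b]) (expR x)%:E = b%:E)%E.
  move=> b0; have := @integral_expR 1 (ln b) ltr01; rewrite mul1r lnK// divr1.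
  by under eq_integral do rewrite mul1r.
move=> a b ab; have [b0|b0] := leP b 0.
  rewrite (_ : _ @^-1` _ = set0) ?integral_set0.
    rewrite (_ : _ `&` _ = set0) ?measure0//; apply/seteqP; split => // x /=.
    by rewrite !in_itv/= andbT => -[] /andP[_ ?] ?; lra.
  apply/seteqP; split => // x /=; rewrite in_itv/= => /andP[_].
  by have := expR_gt0 x; lra.
have [a0|a0] := leP a 0.
  rewrite (_ : _ @^-1` _ = `]-oo, ln b]%classic) ?expE//; last first.
    apply/seteqP; split => x /=; rewrite !in_itv/=.
      by move=> /andP[_]; rewrite -{1}(lnK b0) ler_expR.
    move=> xb; have -> : expR x <= b by rewrite -[leRHS](lnK b0) ler_expR.
    by rewrite andbT; have := expR_gt0 x; lra.
  rewrite (_ : _ `&` _ = `]0, b]%classic).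
    by rewrite lebesgue_measure_itv/= lte_fin b0 oppr0 adde0.
  apply/seteqP; split => x /=; rewrite !in_itv/= ?andbT.
    by move=> [/andP[_ ->] ->].
  by move=> /andP[? ?]; split => //; apply/andP; split => //; lra.
rewrite (_ : _ `&` _ = `]a, b]%classic); last first.
  apply/seteqP; split => x /=; rewrite !in_itv/= ?andbT; first by case.
  by move=> /andP[? ?]; split => //; [apply/andP|]; lra.
rewrite lebesgue_measure_itv/= lte_fin ab.
rewrite (_ : _ @^-1` _ = `]ln a, ln b]%classic); last first.
  have E1 x : (a < expR x) = (ln a < x) by rewrite -[RHS]ltr_expR lnK.
  have E2 x : (expR x <= b) = (x <= ln b) by rewrite -[RHS]ler_expR lnK.
  by apply/seteqP; split => x /=; rewrite !in_itv/= E1 E2.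
have lab : ln a < ln b by rewrite ltr_ln.
(* The integral over []ln a, ln b]] is obtained as the difference of two half-line integrals. *)
have := expE _ b0.
rewrite (_ : `]-oo, ln b]%classic = `]-oo, ln a] `|` `]ln a, ln b]); last first.
  by rewrite -itv_bndbnd_setU// bnd_simp ltW.
rewrite ge0_integral_setU//=.
- rewrite expE//; case: (\int[mu]_(x in `]ln a, ln b]) _)%E => // r.
  by rewrite -EFinD => -[<-]; rewrite -EFinB; congr EFin; ring.
- by apply: measurable_funTS; apply/measurable_EFinP.
- apply/disj_setPS => x [] /=; rewrite !in_itv/= => xa /andP[+ _].
  by rewrite ltNge xa.
Qed.

End lebesgue_substitutions.

Lemma L2_dominated_cvg {d} {T : measurableType d} {R : realType}
  (mu : {measure set T -> \bar R}) (f : nat -> T -> R) (g h : T -> R) :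
  (forall n, measurable_fun [set: T] (f n)) -> measurable_fun [set: T] g ->
  L2 mu h -> (forall n x, `|f n x - g x| <= h x) ->
  (\forall x \ae mu, f n x @[n --> \oo] --> g x) ->
  n2 (L2_inner mu) (f n - g) @[n --> \oo] --> 0.
Proof.
move=> mf mg L2h fgh fg.
have mfg n : measurable_fun [set: T] (f n - g) by exact: measurable_funB.
have L2fg n : L2 mu (f n - g).
  apply: (L2_le_integral (mfg n) L2h); apply: ge0_le_integral => //.
  - by move=> x _; exact: sqr_EFin_ge0.
  - exact: measurable_EFin_sqr.
  - by apply: measurable_EFin_sqr; case: L2h.
  move=> x _; rewrite lee_fin -[leLHS]real_normK ?num_real//.
  by rewrite ler_sqr ?nnegrE ?(le_trans _ (fgh n x)).
have mF n : measurable_fun setT (fun x => ((f n - g) x ^+ 2)%:E).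
  exact: measurable_EFin_sqr.
have m0 : measurable_fun [set: T] (cst 0%E : T -> \bar R) by exact: measurable_cst.
have Ih := sq_integrable L2h.
have cF : \forall x \ae mu, [set: T] x ->
    ((f n - g) x ^+ 2)%:E @[n --> \oo] --> (cst 0%E : T -> \bar R) x.
  apply: filterS fg => x fgx _; apply: cvg_EFin; first by near=> n.
  have fg0 : (fun n => f n x - g x) @ \oo --> 0.
    by rewrite -[X in _ --> X](subrr (g x)); apply: cvgB => //; exact: cvg_cst.
  by rewrite -[X in _ --> X](mul0r 0); apply: cvgM; exact: fg0.
have bF : \forall x \ae mu, forall n, [set: T] x ->
    (`|((f n - g) x ^+ 2)%:E| <= (h x ^+ 2)%:E)%E.
  apply: nearW => x n _; rewrite lee_fin ger0_norm ?sqr_ge0//.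
  rewrite -[leLHS]real_normK ?num_real//.
  by rewrite ler_sqr ?nnegrE ?(le_trans _ (fgh n x)).
have [_ _] := dominated_convergence measurableT mF m0 cF Ih bF.
rewrite integral0; under eq_fun do rewrite L2_sqE//.
by move=> /fine_cvg.
Unshelve. all: by end_near. Qed.

(** * Exponential kernels on a half line *)

Section exponential_kernels.
Context {R : realType}.
Local Notation mu := (@lebesgue_measure R).
Local Notation h := (L2_inner mu).

(** Normalised to the value 1 at [u]: for a common [u], the inner products are then the Cauchy
    kernel 1 / (z + w). *)
Definition kexp (z u r : R) : R := expR (z * (r - u)) * \1_(`]-oo, u]) r.

Lemma measurable_kexp z u : measurable_fun [set: R] (kexp z u).
Proof.
apply: measurable_funM; last exact: measurable_indic.
by apply: measurableT_comp => //; apply: measurable_funM => //; exact: measurable_funB.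
Qed.

Lemma integral_kexp z w u r : 0 < z -> 0 < w -> r <= u ->
  (\int[mu]_x (kexp z u x * kexp w r x)%:E =
   (expR (- z * (u - r)) / (z + w))%:E)%E.
Proof.
move=> z0 w0 ru.
transitivity (\int[mu]_(x in `]-oo, r]) ((expR (- (z * u + w * r)))%:E * (expR ((z + w) * x))%:E))%E.
  rewrite [RHS]integral_mkcond; apply: eq_integral => x _.
  rewrite epatch_indic /= -!EFinM /kexp !indicE !mem_setE !in_itv/=.
  case: (leP x r) => [xr|rx]; last by rewrite !mulr0.
  rewrite (le_trans xr ru) !mulr1 -!expRD; congr (expR _)%:E; ring.
rewrite ge0_integralZl_EFin ?expR_ge0//.
  rewrite integral_expR ?addr_gt0// -EFinM mulrA -expRD; congr (expR _ / _)%:E; ring.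
apply: measurable_funTS; apply/measurable_EFinP.
by apply: measurableT_comp => //; exact: measurable_funM.
Qed.

Lemma L2_kexp z u : 0 < z -> L2 mu (kexp z u).
Proof.
move=> z0; split; first exact: measurable_kexp.
by under eq_integral do rewrite expr2; rewrite integral_kexp// ltry.
Qed.

Lemma dot_kexp z w u r : 0 < z -> 0 < w -> r <= u ->
  dot h (kexp z u) (kexp w r) = expR (- z * (u - r)) / (z + w).
Proof. by move=> *; rewrite /= /ip integral_kexp. Qed.

Lemma kexpM z w u x : kexp z u x * kexp w u x = kexp (z + w) u x.
Proof.
rewrite /kexp indicE; case: (_ \in _); rewrite ?mulr0// !mulr1 -expRD.
by congr expR; ring.
Qed.

Definition exps u : set (R -> R) := [set kexp z u | z in [set z | 0 < z]].

Lemma exps_L2 u : exps u `<=` dom h.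
Proof. by move=> _ [z z0 <-]; exact: L2_kexp. Qed.

Lemma span_expsM w u f : 0 < w -> span (exps u) f -> span (exps u) (kexp w u \* f).
Proof.
move=> w0; elim=> [|c _ g [z z0 <-] _ IH].
  rewrite (_ : _ \* _ = 0); first exact: span0.
  by apply/funext => x /=; rewrite mulr0.
rewrite (_ : _ \* _ = c *: kexp (z + w) u + (kexp w u \* g)).
  by apply: spanS => //; exists (z + w) => //=; rewrite addr_gt0.
apply/funext => x.
suff : kexp w u x * (c * kexp z u x + g x) =
       c * kexp (z + w) u x + kexp w u x * g x by [].
by rewrite -kexpM; ring.
Qed.

(** As a polynomial in [kexp w u x] this has no constant term, which matters because constants are
    not square integrable on the line. *)
Lemma span_bernstein w u m : 0 < w ->
  span (exps u) (fun x => (1 - (1 - kexp w u x) ^+ m)).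
Proof.
move=> w0; elim: m => [|m IH].
  rewrite (_ : (fun=> _) = 0); first exact: span0.
  by apply/funext => x; rewrite expr0 subrr.
pose g x := 1 - (1 - kexp w u x) ^+ m.
rewrite (_ : (fun=> _) = g + kexp w u - (kexp w u \* g)).
  apply: spanB; last exact: span_expsM.
  by apply: spanD => //; apply: sub_span; exists w.
apply/funext => x.
suff : 1 - (1 - kexp w u x) ^+ m.+1 = g x + kexp w u x - kexp w u x * g x by [].
by rewrite /g exprS; ring.
Qed.

Lemma kexp_ge0 z u x : 0 <= kexp z u x.
Proof. by rewrite mulr_ge0 ?expR_ge0. Qed.

Lemma kexpX z u x n : kexp z u x ^+ n.+1 = kexp (z *+ n.+1) u x.
Proof.
elim: n => [|n IH]; first by rewrite expr1 mulr1n.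
by rewrite exprS IH kexpM -mulrS.
Qed.

Lemma bernoulli_lower (t : R) m : 0 <= t <= 1 -> 1 - t *+ m <= (1 - t) ^+ m.
Proof.
move=> /andP[t0 t1]; elim: m => [|m IH]; first by rewrite mulr0n subr0 expr0.
rewrite exprS mulrS; apply: le_trans (_ : (1 - t) * (1 - t *+ m) <= _).
  by have : 0 <= t *+ m; [rewrite mulrn_wge0|nra].
by rewrite ler_wpM2l// subr_ge0.
Qed.

Lemma bernoulli_upper (t : R) m : 0 <= t <= 1 -> (1 - t) ^+ m * (1 + t *+ m) <= 1.
Proof.
move=> /andP[t0 t1].
have H : 1 + t *+ m <= (1 + t) ^+ m.
  elim: m => [|m IH]; first by rewrite mulr0n addr0 expr0.
  rewrite exprS mulrS; apply: le_trans (_ : (1 + t) * (1 + t *+ m) <= _).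
    by have : 0 <= t *+ m; [rewrite mulrn_wge0|nra].
  by rewrite ler_wpM2l// addr_ge0.
apply: le_trans (_ : (1 - t) ^+ m * (1 + t) ^+ m <= _).
  by rewrite ler_wpM2l// exprn_ge0// subr_ge0.
rewrite -exprMn exprn_ile1//; nra.
Qed.

End exponential_kernels.

Section indicators.
Context {d : measure_display} {T : measurableType d} {R : realType}.
Variable mu : {measure set T -> \bar R}.

Lemma integral_indicM A B : measurable A -> measurable B ->
  (\int[mu]_x (\1_A x * \1_B x : R)%:E = mu (A `&` B))%E.
Proof.
move=> mA mB; rewrite -[A `&` B]setIT -integral_indic//; last exact: measurableI.
by apply: eq_integral => x _; rewrite indicI.
Qed.

Lemma L2_indic A : measurable A -> (mu A < +oo)%E -> L2 mu (\1_A).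
Proof.
move=> mA Afin; split; first exact: measurable_indic.
by under eq_integral do rewrite expr2; rewrite integral_indicM// setIid.
Qed.

Lemma dot_indic A B : measurable A -> measurable B ->
  dot (L2_inner mu) \1_A \1_B = fine (mu (A `&` B)).
Proof. by move=> mA mB; rewrite /= /ip integral_indicM. Qed.

End indicators.

(** * Density of the exponentials and of the kernels of rate 1/2 *)

Section density.
Context {R : realType}.
Local Notation mu := (@lebesgue_measure R).
Local Notation h := (L2_inner mu).

Lemma lebesgue_itv_oc (a b : R) : a <= b -> mu `]a, b]%classic = (b - a)%:E.
Proof.
by move=> ab; have := lebesgue_measure_itv `]a, b]; rewrite /= lte_fin;
  case: ltgtP ab => // -> _ ->; rewrite subrr.
Qed.

Lemma ae_neq (a : R) : \forall x \ae mu, x != a.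
Proof.
exists [set a]; split; [exact: measurable_set1|exact: lebesgue_measure_set1|].
by move=> x /= /negP; rewrite negbK => /eqP.
Qed.

Lemma cvg_exprS (q : R) : 0 <= q < 1 -> q ^+ n.+1 @[n --> \oo] --> 0.
Proof.
move=> /andP[q0 q1]; rewrite (_ : (fun n => _) = (fun n => q ^+ (n + 1))).
  by rewrite cvg_shiftn; apply: cvg_expr; rewrite ger0_norm.
by apply/funext => n; rewrite addn1.
Qed.

(* With [y = kexp z u x], [y > 1/2] exactly when [a < x <= u], and
   [1 - (1 - y^n)^(2^n)] tends to the indicator of [y > 1/2]. *)
Lemma cl_exps_itv (a u : R) : a < u -> cl h (exps u) (\1_`]a, u] : R -> R).
Proof.
move=> au; pose z := ln 2 / (u - a).
have ua0 : 0 < u - a by rewrite subr_gt0.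
have z0 : 0 < z by rewrite divr_gt0// ln_gt0// ltr1n.
pose Y x := kexp z u x.
have Y0 x : 0 <= Y x by exact: kexp_ge0.
have Yu x : u < x -> Y x = 0.
  by move=> ux; rewrite /Y /kexp indicE mem_setE in_itv/= leNgt ux mulr0.
have YE x : x <= u -> Y x = expR (z * (x - u)).
  by move=> xu; rewrite /Y /kexp indicE mem_setE in_itv/= xu mulr1.
have Y1 x : Y x <= 1.
  have [xu|/Yu ->//] := leP x u.
  by rewrite YE// -expR0 ler_expR; nra.
have half : expR (z * (a - u)) = 2^-1.
  rewrite (_ : z * (a - u) = - ln 2); last by rewrite /z; field; rewrite gt_eqF.
  by rewrite expRN lnK// posrE.
have Ygt x : a < x -> x <= u -> 1 < 2 * Y x.
  move=> ax xu; rewrite YE//; have : expR (z * (a - u)) < expR (z * (x - u)).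
    by rewrite ltr_expR; nra.
  rewrite half; lra.
have Ylt x : x < a -> 2 * Y x < 1.
  move=> xa; rewrite YE; last by lra.
  have : expR (z * (x - u)) < expR (z * (a - u)) by rewrite ltr_expR; nra.
  by rewrite half; lra.
have Yle x : x <= a -> 2 * Y x <= 1.
  by rewrite le_eqVlt => /orP[/eqP ->|/Ylt/ltW//]; rewrite YE ?half; lra.
pose f n x : R := 1 - (1 - kexp (z *+ n.+1) u x) ^+ (2 ^ n.+1).
pose t n x := Y x ^+ n.+1.
have fE n x : f n x = 1 - (1 - t n x) ^+ (2 ^ n.+1) by rewrite /f -kexpX.
have t01 n x : 0 <= t n x <= 1 by rewrite exprn_ge0//= exprn_ile1.
(* The powers of [2 * Y x] decide the limit: by [bernoulli_lower] they bound [f n x], and by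
   [bernoulli_upper] their inverses bound [1 - f n x]. *)
have tE n x : t n x *+ (2 ^ n.+1) = (2 * Y x) ^+ n.+1.
  by rewrite exprMn -natrX mulr_natl.
have p01 n x : 0 <= (1 - t n x) ^+ (2 ^ n.+1) <= 1.
  have /andP[t0 t1] := t01 n x.
  by rewrite exprn_ge0 ?subr_ge0//= exprn_ile1 ?subr_ge0// gerBl.
have f01 n x : 0 <= f n x <= 1 by have := p01 n x; rewrite fE; lra.
have fle n x : f n x <= (2 * Y x) ^+ n.+1.
  by have := bernoulli_lower (2 ^ n.+1) (t01 n x); rewrite tE fE; lra.
have f0 n x : u < x -> f n x = 0.
  by move=> ux; rewrite fE /t Yu// expr0n/= subr0 expr1n subrr.
have indE x : \1_`]a, u] x = ((a < x) && (x <= u))%:R :> R.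
  by rewrite indicE mem_setE in_itv.
have sf n : span (exps u) (f n).
  by apply: span_bernstein; rewrite pmulrn_lgt0.
have ucl : L2 mu (\1_`]a, u]).
  apply: L2_indic => //.
  by have := ltry (u - a); rewrite -(lebesgue_itv_oc (ltW au)).
apply: (lim_cl (@exps_L2 R u) sf) => //.
apply: (@L2_dominated_cvg _ _ R mu f (\1_`]a, u] : R -> R) (2 *: Y : R -> R)).
- move=> n; have [] // := dom_span (@exps_L2 R u) (sf n).
- exact: measurable_indic.
- by apply: (domZ (s := h)); exact: L2_kexp.
(* [2 * Y] dominates the difference: it exceeds 1 on []a, u]], it bounds [f n] up to [a] because it
   is at most 1 there, and both functions vanish beyond [u]. *)
- move=> n x; rewrite indE -[leRHS]/(2 * Y x).
  have [xu|ux] := leP x u; last by rewrite f0// andbF subrr normr0 mulr_ge0.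
  have [ax|xa] := ltP a x.
    have := Ygt x ax xu; have := f01 n x; rewrite ler_norml/=; lra.
  rewrite subr0 ger0_norm; last by case/andP: (f01 n x).
  apply: le_trans (fle n x) _.
  rewrite exprS ger_pMr; last first.
    by rewrite mulr_gt0// YE// expR_gt0.
  by rewrite exprn_ile1 ?Yle// mulr_ge0.
apply: (@filterS _ _ (ae_filter_ringOfSetsType mu) _ _ _ (ae_neq a)) => x xa; rewrite indE.
have [xu|ux] := leP x u; last first.
  by rewrite andbF; under eq_fun do rewrite f0//; exact: cvg_cst.
have [ax|ax|axE] := ltgtP a x; last by rewrite axE eqxx in xa.
- rewrite /=; apply: (@squeeze_cvgr _ _ _ _ (fun n => 1 - ((2 * Y x)^-1) ^+ n.+1) (cst 1)).
  + near=> n; have /andP[_ ->] := f01 n x; rewrite andbT fE.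
    have := bernoulli_upper (2 ^ n.+1) (t01 n x); rewrite tE exprVn.
    have Yp : 0 < (2 * Y x) ^+ n.+1 by rewrite exprn_gt0//; have := Ygt x ax xu; lra.
    have := p01 n x; set A := (1 - _) ^+ _; set B := (2 * _) ^+ _ in Yp *.
    move=> /andP[A0 A1] AB; suff : A <= B^-1 by lra.
    by rewrite -div1r ler_pdivlMr//; nra.
  + rewrite -[X in _ --> X]subr0; apply: cvgB; first exact: cvg_cst.
    apply: cvg_exprS; have Yx := Ygt x ax xu.
    by rewrite invr_ge0 invf_lt1 ?Yx ?andbT; [rewrite mulr_ge0|lra].
  + exact: cvg_cst.
- rewrite /=; apply: (@squeeze_cvgr _ _ _ _ (cst 0) (fun n => (2 * Y x) ^+ n.+1)).
  + by near=> n; rewrite fle; case/andP: (f01 n x) => ->.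
  + exact: cvg_cst.
  + by apply: cvg_exprS; rewrite mulr_ge0// Ylt.
Unshelve. all: by end_near. Qed.

Lemma cl_exps_step (a b u : R) : a <= b -> b <= u ->
  cl h (exps u) (\1_`]a, b] : R -> R).
Proof.
have iu c : c <= u -> cl h (exps u) (\1_`]c, u] : R -> R).
  rewrite le_eqVlt => /orP[/eqP ->|]; last exact: cl_exps_itv.
  rewrite set_itvoc0 indic0; apply: span_cl; [exact: exps_L2|exact: span0].
move=> ab bu; rewrite (_ : \1_ _ = \1_`]a, u] - \1_`]b, u]).
  by apply: clB; [exact: exps_L2|apply: iu; exact: le_trans bu|exact: iu].
apply/funext => x; rewrite [RHS]/GRing.add /= /GRing.opp /= !indicE !mem_setE !in_itv/=.
case: (leP x b) => xb; rewrite ?andbT ?andbF /=.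
  by rewrite (le_trans xb bu) andbT /= subr0.
by rewrite (le_lt_trans ab xb)/= subrr.
Qed.

Definition half_exps u : set (R -> R) := [set kexp 2^-1 b | b in `]-oo, u]].

Lemma half_exps_L2 u : half_exps u `<=` dom h.
Proof. by move=> _ [b _ <-]; apply: L2_kexp; rewrite invr_gt0. Qed.

Lemma expRN_bounds (x : R) : 0 <= x ->
  x / (1 + x) <= 1 - expR (- x) <= x.
Proof.
move=> x0; have x1 : 0 < 1 + x by lra.
apply/andP; split; last by have := expR_ge1Dx (- x); lra.
have : expR (- x) <= (1 + x)^-1.
  by rewrite expRN lef_pV2 ?posrE ?expR_gt0//; exact: expR_ge1Dx.
have -> : x / (1 + x) = 1 - (1 + x)^-1 by field; rewrite gt_eqF.
lra.
Qed.

(** This is exp ((x - (u - k D)) / 2) on the interval ]u - (k + 1) D, u - k D] and 0 elsewhere: the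
    second kernel cancels the first one below the interval. *)
Let piece u D k : R -> R :=
  kexp 2^-1 (u - D * k%:R) - expR (- D / 2) *: kexp 2^-1 (u - D * k.+1%:R).

Let L2half b : dom h (kexp 2^-1 b).
Proof. by apply: L2_kexp; rewrite invr_gt0. Qed.

Let L2piece u D k : dom h (piece u D k).
Proof. by apply: domB => //; apply: domZ. Qed.

Let half2 : 2^-1 + 2^-1 = 1 :> R. Proof. by field. Qed.

Let dot_half b c : c <= b ->
  dot h (kexp 2^-1 b) (kexp 2^-1 c) = expR (- (b - c) / 2).
Proof.
move=> cb; rewrite dot_kexp ?invr_gt0// half2 divr1; congr expR; ring.
Qed.

Let dot_piece z u D k : 0 < z -> 0 <= D ->
  dot h (kexp z u) (piece u D k) = expR (- z * D * k%:R) *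
    (1 - expR (- z * D) * expR (- D / 2)) / (z + 2^-1).
Proof.
move=> z0 D0; have L2z := @L2_kexp R z u z0.
have Dk j : 0 <= D * j%:R by rewrite mulr_ge0.
rewrite dotBr//; last exact: domZ.
rewrite dotZr// !dot_kexp ?invr_gt0//; try by rewrite gerBl.
have -> : - z * (u - (u - D * k.+1%:R)) = - z * D * k%:R + - z * D.
  by rewrite -natr1; ring.
have -> : - z * (u - (u - D * k%:R)) = - z * D * k%:R by ring.
rewrite expRD; ring.
Qed.

Let n2_piece u D k : 0 <= D -> n2 h (piece u D k) = 1 - expR (- D).
Proof.
move=> D0; have DS : D * k.+1%:R = D * k%:R + D by rewrite -natr1; ring.
rewrite n2B// ?n2Z//; last exact: domZ.
rewrite dotZr// /n2 !dot_half//; last by rewrite DS; lra.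
rewrite !subrr !oppr0 !mul0r expR0 DS.
have -> : - (u - D * k%:R - (u - (D * k%:R + D))) / 2 = - D / 2 by ring.
have -> : expR (- D) = expR (- D / 2) ^+ 2 by rewrite expr2 -expRD; congr expR; field.
ring.
Qed.

Let piece_orth u D j k : 0 <= D -> (j < k)%N -> dot h (piece u D j) (piece u D k) = 0.
Proof.
move=> D0 jk.
have le i l : (i <= l)%N -> u - D * l%:R <= u - D * i%:R.
  by move=> il; rewrite lerD2l lerN2 ler_wpM2l// ler_nat.
have E i : D * i.+1%:R = D * i%:R + D by rewrite -natr1; ring.
have H l : (j < l)%N -> dot h (piece u D j) (kexp 2^-1 (u - D * l%:R)) = 0.
  move=> jl; rewrite dotBl// ?dotZl//; last exact: domZ.
  rewrite !dot_half ?le ?(ltnW jl)// -expRD; apply/eqP; rewrite subr_eq0; apply/eqP.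
  by congr expR; rewrite E; ring.
have -> : piece u D k = kexp 2^-1 (u - D * k%:R) -
    expR (- D / 2) *: kexp 2^-1 (u - D * k.+1%:R) by [].
rewrite dotBr//; last exact: domZ.
by rewrite dotZr// H// H ?mulr0 ?subr0// ltnW.
Qed.

(* [grid z u D K] replaces [kexp z u] by a multiple of [exp (x / 2)] on each of the
   intervals ]u - (k + 1) D, u - k D], k < K, with the right value at [u - k D]. *)
Let grid z u D K : R -> R :=
  \sum_(k < K) expR (- z * D * k%:R) *: piece u D k.

Let L2grid z u D K : dom h (grid z u D K).
Proof.
rewrite /grid; elim/big_ind: _ => [||k _]; [exact: dom0|exact: domD|exact: domZ].
Qed.

Let gridS z u D K :
  grid z u D K.+1 = grid z u D K + expR (- z * D * K%:R) *: piece u D K.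
Proof. by rewrite /grid big_ord_recr. Qed.

Let dot_grid z u D j K : 0 <= D -> (K <= j)%N -> dot h (grid z u D K) (piece u D j) = 0.
Proof.
move=> D0; elim: K => [|K IH] Kj; first by rewrite /grid big_ord0 dot0l.
rewrite gridS dotDl//; last exact: domZ.
by rewrite IH ?(ltnW Kj)// dotZl// piece_orth// mulr0 addr0.
Qed.

(** Each piece is orthogonal to the earlier ones, so adding it lowers the squared distance by the
    square of its coefficient times a quantity that does not depend on [k]. *)
Let n2_grid z u D K : 0 < z -> 0 <= D ->
  n2 h (kexp z u - grid z u D K) = (z + z)^-1 -
    (\sum_(k < K) expR (- z * D * k%:R) ^+ 2) *
    (2 * (1 - expR (- z * D) * expR (- D / 2)) / (z + 2^-1) - (1 - expR (- D))).
Proof.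
move=> z0 D0; have L2z := @L2_kexp R z u z0.
elim: K => [|K IH].
  rewrite /grid !big_ord0 mul0r !subr0 /n2 dot_kexp// subrr mulr0 expR0; field.
  by rewrite gt_eqF// addr_gt0.
have -> : \sum_(k < K.+1) expR (- z * D * k%:R) ^+ 2 =
  \sum_(k < K) expR (- z * D * k%:R) ^+ 2 + expR (- z * D * K%:R) ^+ 2.
  by rewrite big_ord_recr.
rewrite mulrDl gridS.
have -> : kexp z u - (grid z u D K + expR (- z * D * K%:R) *: piece u D K) =
  (kexp z u - grid z u D K) - expR (- z * D * K%:R) *: piece u D K.
  by rewrite opprD addrA.
rewrite n2B//; [|exact: domB|exact: domZ].
rewrite IH dotZr//; last exact: domB.
rewrite dotBl// dot_grid// subr0 dot_piece// n2Z// n2_piece//; ring.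
Qed.

(** The squared distance from [kexp z u] to the grid function is explicit. It splits into a
    truncation error, which vanishes as the number of cells grows, and a discretisation error of the
    order of the mesh [D]. *)
Lemma cl_half_exps z u : 0 < z -> cl h (half_exps u) (kexp z u).
Proof.
move=> z0; split=> [|e e0]; first exact: L2_kexp.
(* [C] bounds the discretisation error per unit of mesh when the mesh is at most 1; [D] is chosen to
   satisfy [D <= 1] and [C * D <= e / 2]. *)
pose C := (z + 2^-1) * (1 + 2 * z) / z.
have C0 : 0 < C by rewrite divr_gt0// mulr_gt0//; lra.
pose D := e / (e + 2 * C).
have eC : 0 < e + 2 * C by lra.
have D0 : 0 < D by rewrite divr_gt0.
have D1 : D <= 1 by rewrite ler_pdivrMr//; lra.
have CD : C * D <= e / 2.
  rewrite /D mulrA ler_pdivrMr//; nra.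
pose q := expR (- z * D).
have q01 : 0 < q < 1 by rewrite expR_gt0/= -expR0 ltr_expR; nra.
have qk k : expR (- z * D * k%:R) ^+ 2 = (q ^+ 2) ^+ k.
  by rewrite expRM_natr -/q -!exprM mulnC.
have Q01 : 0 < q ^+ 2 < 1 by rewrite expr2; nra.
pose b := 1 - q ^+ 2.
have b0 : 0 < b by rewrite /b; lra.
(* The limit, as the number of cells grows, of what [n2_grid] subtracts; the squares of the
   coefficients form a geometric series of ratio [q ^+ 2]. *)
pose X := (2 * (1 - q * expR (- D / 2)) / (z + 2^-1) - (1 - expR (- D))) / b.
have nE K : n2 h (kexp z u - grid z u D K) = ((z + z)^-1 - X) + (q ^+ 2) ^+ K * X.
  rewrite n2_grid//; last exact: ltW.
  under eq_bigr do rewrite qk.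
  have -> : \sum_(i < K) (q ^+ 2) ^+ i = (1 - (q ^+ 2) ^+ K) / b.
    apply: (mulIf (lt0r_neq0 b0)); rewrite divfK ?lt0r_neq0//.
    by rewrite -opprB subrX1 /b; ring.
  rewrite /X.
  by rewrite -/q; field; rewrite !gt_eqF//; lra.
(* The discretisation error. The first order bounds of [expRN_bounds] on the three exponentials
   cancel the leading terms and leave an error of order [D]. *)
have Xe : (z + z)^-1 - X <= e / 2.
  apply: le_trans CD.
  have /andP[a1 _] := @expRN_bounds ((z + 2^-1) * D) ltac:(rewrite mulr_ge0//; lra).
  have /andP[b1 b2] := @expRN_bounds (2 * z * D) ltac:(rewrite mulr_ge0//; lra).
  have /andP[_ p1] := @expRN_bounds D ltac:(lra).
  have aE : expR (- ((z + 2^-1) * D)) = q * expR (- D / 2).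
    by rewrite /q -expRD; congr expR; ring.
  have bE : expR (- (2 * z * D)) = q ^+ 2 by rewrite expr2 -expRD; congr expR; ring.
  rewrite aE in a1; rewrite bE in b1 b2.
  pose a := 1 - q * expR (- D / 2); pose P := 1 - expR (- D).
  rewrite -/a in a1; rewrite -/b in b1 b2; rewrite -/P in p1.
  pose s := (z + 2^-1) * D; pose r := 2 * z * D; rewrite -/s in a1; rewrite -/r in b1 b2.
  have s0 : 0 < s by rewrite mulr_gt0//; lra.
  have r0 : 0 < r by rewrite /r -mulrA; apply: mulr_gt0 => //; exact: mulr_gt0.
  have -> : (z + z)^-1 - X = (b / (2 * z) - 2 * a / (z + 2^-1) + P) / b.
    by rewrite /X -/a -/P; field; rewrite !gt_eqF//; lra.
  rewrite ler_pdivrMr//.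
  have h1 : b / (2 * z) <= D.
    by rewrite ler_pdivrMr ?mulr_gt0//; apply: le_trans b2 _; rewrite /r; lra.
  have h2 : D / (1 + s) <= a / (z + 2^-1).
    rewrite ler_pdivlMr; last by lra.
    by have -> : D / (1 + s) * (z + 2^-1) = s / (1 + s) by rewrite /s; ring.
  have h3 : D * (1 - s) <= D / (1 + s).
    by rewrite ler_pdivlMr; [nra|lra].
  have h4 : 2 * s * D <= C * D * b.
    apply: le_trans (_ : C * D * (r / (1 + r)) <= _); last first.
      by rewrite ler_wpM2l// mulr_ge0// ltW.
    rewrite [leRHS]mulrA ler_pdivlMr; last by lra.
    have -> : C * D * r = 2 * s * D * (1 + 2 * z).
      by rewrite /C /r /s; field; rewrite gt_eqF.
    apply: ler_wpM2l; first by apply: mulr_ge0; [lra|exact: ltW].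
    by rewrite lerD2l /r; nra.
  have -> : 2 * a / (z + 2^-1) = 2 * (a / (z + 2^-1)) by rewrite mulrA.
  apply: le_trans h4; lra.
have QX : (q ^+ 2) ^+ K * X @[K --> \oo] --> 0.
  rewrite -(mul0r X); apply: cvgMl; apply: cvg_expr.
  by rewrite ger0_norm//; lra.
have [|K _ HK] := (cvgr_lt _ QX) (e / 2); first by rewrite divr_gt0.
exists (grid z u D K); last by rewrite nE; have := HK K (leqnn K); rewrite /=; lra.
rewrite /grid; apply: span_sum => k _; apply: spanZ; apply: spanB.
  by apply: sub_span; exists (u - D * k%:R) => //=; rewrite in_itv/= gerBl mulr_ge0// ltW.
apply: spanZ; apply: sub_span.
by exists (u - D * k.+1%:R) => //=; rewrite in_itv/= gerBl mulr_ge0// ltW.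
Qed.

End density.

(** * Blaschke products and the kernels built from them *)

Section blaschke.
Context {R : realType}.
Local Notation mu := (@lebesgue_measure R).
Local Notation h := (L2_inner mu).
Variable p : nat -> R.
Hypotheses (p0 : forall j, 0 < p j) (p_inj : injective p).

(** With this sign the factor at a fixed [z] is close to 1 both when [p j] is small and when it is
    large, so the product itself, and not only its absolute value, can converge. *)
Definition bsign j : R := if p j <= 1 then 1 else -1.

Definition bfactor j (z : R) : R := bsign j * (z - p j) / (z + p j).

Definition bprod n (z : R) : R := \prod_(j < n) bfactor j z.

Lemma bsign_sqr j : bsign j * bsign j = 1.
Proof. by rewrite /bsign; case: ifP => _; ring. Qed.

Lemma bsign_neq0 j : bsign j != 0.
Proof. by rewrite /bsign; case: ifP => _; rewrite ?oppr_eq0 oner_neq0. Qed.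

Lemma bprodS n z : bprod n.+1 z = bprod n z * bfactor n z.
Proof. by rewrite /bprod big_ord_recr. Qed.

Lemma bprod_root n j : (j < n)%N -> bprod n (p j) = 0.
Proof.
move=> jn; rewrite /bprod (bigD1 (Ordinal jn))//= /bfactor subrr mulr0 !mul0r//.
Qed.

(* The coefficients of [1 / (w + p_j)] in the partial fraction expansion of
   [bprod n w / (w + z)]. *)
Fixpoint bcoef (z : R) n : nat -> R :=
  if n is n'.+1 then fun j =>
    if j == n' then
      - bsign n' * (2 * p n' / (z - p n') / bprod n' z +
         \sum_(i < n') 2 * p n' / (p i - p n') * bcoef z n' i)
    else bsign n' * (p j + p n') / (p j - p n') * bcoef z n' j
  else fun=> 0.

Definition avoids n z := forall j, (j < n)%N -> z != p j.

Lemma bfactor_neq0 j z : 0 < z -> z != p j -> bfactor j z != 0.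
Proof.
move=> z0 zp; rewrite /bfactor !mulf_neq0 ?bsign_neq0 ?subr_eq0//.
by rewrite invr_eq0 gt_eqF// addr_gt0.
Qed.

Lemma bprod_neq0 n z : 0 < z -> avoids n z -> bprod n z != 0.
Proof.
move=> z0 av; apply/prodf_neq0 => j _; apply: bfactor_neq0 => //; exact: av.
Qed.

Lemma bfactor_fraction n a w : 0 < a -> 0 < w -> a != p n ->
  bfactor n w / (w + a) = bsign n *
    ((a + p n) / (a - p n) / (w + a) - 2 * p n / (a - p n) / (w + p n)).
Proof.
move=> a0 w0 ap; rewrite /bfactor; field.
by rewrite subr_eq0 ap !gt_eqF ?addr_gt0.
Qed.

(** The residue at w = - z is [bprod n (- z)], the inverse of [bprod n z], since each factor
    satisfies b(- z) b(z) = 1. In the induction, [bfactor_fraction] splits every old term and the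
    contributions at - p_n are collected in the new coefficient. *)
Lemma bprod_fraction n z w : 0 < z -> 0 < w -> avoids n z ->
  bprod n w / (w + z) = (bprod n z)^-1 / (w + z) +
    \sum_(j < n) bcoef z n j / (w + p j).
Proof.
move=> z0 w0; elim: n => [|n IH] av.
  by rewrite /bprod !big_ord0 invr1 addr0.
have avn : avoids n z by move=> j jn; apply: av; exact: ltnW.
have zn : z != p n by exact: av.
rewrite bprodS mulrAC IH// mulrDl mulr_suml big_ord_recr /= eqxx.
have sz := subr_eq0 z (p n); rewrite (negbTE zn) in sz.
have wz : w + z != 0 by rewrite gt_eqF// addr_gt0.
have wp j : w + p j != 0 by rewrite gt_eqF// addr_gt0.
have zp : z + p n != 0 by rewrite gt_eqF// addr_gt0.
have -> : (bprod n z)^-1 / (w + z) * bfactor n w =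
    (bprod n.+1 z)^-1 / (w + z) -
    bsign n * (2 * p n / (z - p n) / bprod n z) / (w + p n).
  rewrite -mulrA [_^-1 * bfactor n w]mulrC bfactor_fraction// bprodS /bfactor.
  have sV : (bsign n)^-1 = bsign n.
    by rewrite -[LHS]mulr1 -(bsign_sqr n) mulrA mulVf ?bsign_neq0// mul1r.
  rewrite !invfM sV; have bn := bprod_neq0 z0 avn.
  by field; rewrite bn wp zp wz sz.
rewrite -!addrA; congr (_ + _).
have -> : \sum_(i < n) bcoef z n i / (w + p i) * bfactor n w =
   \sum_(i < n) (bcoef z n.+1 i / (w + p i)) -
   bsign n * (\sum_(i < n) 2 * p n / (p i - p n) * bcoef z n i) / (w + p n).
  rewrite mulr_sumr mulr_suml -sumrB; apply: eq_bigr => i _ /=.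
  rewrite (ltn_eqF (ltn_ord i)).
  have pin : p i != p n.
    by apply/negP => /eqP/p_inj H; have := ltn_ord i; rewrite H ltnn.
  rewrite -mulrA [_^-1 * bfactor n w]mulrC bfactor_fraction//.
  by field; rewrite !wp subr_eq0 pin.
rewrite /= addrCA; congr (_ + _).
ring.
Qed.

(** Each fraction 1 / (w + a) of [bprod_fraction] is replaced by the kernel [kexp a u], whose inner
    product with [kexp w u] it is. For [z] away from the first [n] roots, the result is orthogonal
    to the first [n] kernels of rates [p j], and [bprod n z] times it is the part of [kexp z u]
    orthogonal to them. *)
Definition bkernel n z u : R -> R :=
  (bprod n z)^-1 *: kexp z u + \sum_(j < n) bcoef z n j *: kexp (p j) u.

Definition pexps u : set (R -> R) := [set kexp (p j) u | j in [set: nat]].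

Lemma pexps_L2 u : pexps u `<=` dom h.
Proof. by move=> _ [j _ <-]; exact: L2_kexp. Qed.

Lemma span_bsum n z u :
  span (pexps u) (\sum_(j < n) bcoef z n j *: kexp (p j) u).
Proof. by apply: span_sum => j _; apply: spanZ; apply: sub_span; exists j. Qed.

Lemma L2_bkernel n z u : 0 < z -> dom h (bkernel n z u).
Proof.
move=> z0; apply: domD; first by apply: domZ; exact: L2_kexp.
by apply: dom_span (span_bsum n z u); exact: pexps_L2.
Qed.

Lemma dot_sum (V : lmodType R) (g : semi_inner V) n (c : 'I_n -> R) (f : 'I_n -> V) y :
  (forall i, dom g (f i)) -> dom g y ->
  dot g (\sum_(i < n) c i *: f i) y = \sum_(i < n) c i * dot g (f i) y.
Proof.
move=> Df Dy; suff [_ ->] : dom g (\sum_(i < n) c i *: f i) /\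
  dot g (\sum_(i < n) c i *: f i) y = \sum_(i < n) c i * dot g (f i) y by [].
elim/big_rec2: _ => [|i a b _ [Db <-]]; first by split; [exact: dom0|exact: dot0l].
split; first by apply: domD => //; exact: domZ.
by rewrite dotDl ?dotZl//; exact: domZ.
Qed.

Lemma dot_bkernel_kexp n z w u r : 0 < z -> 0 < w -> avoids n z -> r <= u ->
  dot h (bkernel n z r) (kexp w u) = expR (- w * (u - r)) * (bprod n w / (w + z)).
Proof.
move=> z0 w0 av ru; rewrite dotDl; last 3 first.
- by apply: domZ; exact: L2_kexp.
- by apply: dom_span (span_bsum n z r); exact: pexps_L2.
- exact: L2_kexp.
rewrite dotZl; [|exact: L2_kexp|exact: L2_kexp].
rewrite dot_sum; [|by move=> i; exact: L2_kexp|exact: L2_kexp].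
rewrite (dotC h (kexp z r)) dot_kexp// bprod_fraction// [RHS]mulrDr [in RHS]mulr_sumr; congr (_ + _).
  ring.
apply: eq_bigr => i _; rewrite (dotC h (kexp _ r)) dot_kexp//; ring.
Qed.

(** In the kernel with fewer factors only the term in [kexp z u] contributes, because [bprod m]
    vanishes at each [p i] with [i < n <= m]. *)
Lemma dot_bkernel n m z z' u r : 0 < z -> 0 < z' -> avoids n z -> avoids m z' ->
  (n <= m)%N -> r <= u ->
  dot h (bkernel m z' r) (bkernel n z u) =
    expR (- z * (u - r)) * (bprod m z / bprod n z) / (z + z').
Proof.
move=> z0 z'0 av av' nm ru.
have D' := L2_bkernel m r z'0.
rewrite dotDr//; last 2 first.
- by apply: domZ; exact: L2_kexp.
- by apply: dom_span (span_bsum n z u); exact: pexps_L2.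
rewrite dotZr//; last exact: L2_kexp.
rewrite dot_bkernel_kexp//.
rewrite dotC dot_sum//; last by move=> i; exact: L2_kexp.
rewrite big1 ?addr0; first by ring.
move=> i _; rewrite dotC dot_bkernel_kexp// bprod_root ?mul0r ?mulr0//.
exact: leq_trans (ltn_ord i) nm.
Qed.

Lemma bfactor_le1 j z : 0 < z -> `|bfactor j z| <= 1.
Proof.
move=> z0; have pj := p0 j; rewrite /bfactor !normrM.
have -> : `|bsign j| = 1 by rewrite /bsign; case: ifP; rewrite ?normrN normr1.
rewrite mul1r normfV (gtr0_norm (addr_gt0 z0 pj)) ler_pdivrMr ?addr_gt0// mul1r.
by rewrite ler_norml; lra.
Qed.

End blaschke.

(** * Divergent series: the exponentials are total *)

Section muntz.
Context {R : realType}.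
Local Notation mu := (@lebesgue_measure R).
Local Notation h := (L2_inner mu).
Variable p : nat -> R.
Hypotheses (p0 : forall j, 0 < p j) (p_inj : injective p).

Let a j := p j / (p j ^+ 2 + 1).

Let pp1 j : 0 < p j ^+ 2 + 1. Proof. by have := sqr_ge0 (p j); lra. Qed.

Let a_gt0 j : 0 < a j. Proof. by rewrite divr_gt0. Qed.

Lemma norm_bprod_le1 n z : 0 < z -> `|bprod p n z| <= 1.
Proof.
move=> z0; elim: n => [|n IH]; first by rewrite /bprod big_ord0 normr1.
by rewrite bprodS normrM mulr_ile1// bfactor_le1.
Qed.

(** The first term is the component orthogonal to the first [n] kernels [kexp (p j) u], and the
    second lies in their span. *)
Lemma kexp_bkernel n z u : 0 < z -> avoids p n z ->
  kexp z u = bprod p n z *: bkernel p n z u -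
    bprod p n z *: \sum_(j < n) bcoef p z n j *: kexp (p j) u.
Proof.
move=> z0 av; rewrite -scalerBr /bkernel addrK scalerA mulfV ?scale1r//.
exact: bprod_neq0.
Qed.

Lemma n2_bkernel n z u : 0 < z -> avoids p n z -> n2 h (bkernel p n z u) = (z + z)^-1.
Proof.
move=> z0 av; rewrite /n2 dot_bkernel// subrr mulr0 expR0 mul1r divff ?mul1r//.
exact: bprod_neq0.
Qed.

(** 1 - |z - p| / (z + p) equals 2 min (z, p) / (z + p), which is at least c a_j for c = min (z, 1 /
    z); [c1] and [c2] treat the two values of the minimum. Then 1 - x <= exp (- x). *)
Lemma bfactor_decay z j : 0 < z ->
  `|bfactor p j z| <= expR (- (Num.min z z^-1 * a j)).
Proof.
move=> z0; have pj := p0 j; apply: le_trans (expR_ge1Dx _).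
have zi0 : 0 < z^-1 by rewrite invr_gt0.
rewrite /bfactor !normrM normfV (gtr0_norm (addr_gt0 z0 pj)).
have -> : `|bsign p j| = 1 by rewrite /bsign; case: ifP; rewrite ?normrN normr1.
rewrite mul1r ler_pdivrMr ?addr_gt0//.
set c := Num.min _ _.
have c0 : 0 < c by rewrite lt_min z0 invr_gt0.
have cz : c <= z by rewrite ge_min lexx.
have czi : c <= z^-1 by rewrite ge_min lexx orbT.
have az : a j <= p j.
  by rewrite ler_pdivrMr// ler_peMr ?(ltW pj)// lerDr sqr_ge0.
have ap : a j * p j <= 1.
  by rewrite /a mulrAC ler_pdivrMr// mul1r -expr2 lerDl.
have aj := a_gt0 j.
have caz : c * z <= 1 by rewrite -ler_pdivlMr// div1r.
have c1 : c * a j * (z + p j) <= 2 * p j.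
  have : c * a j * z <= p j.
    by rewrite mulrAC; apply: le_trans az; rewrite ler_piMl// ltW.
  have [pz|zp] := leP (p j) z.
    have : c * a j * p j <= c * a j * z by rewrite ler_wpM2l// mulr_ge0// ltW.
    lra.
  have : c * a j * p j <= p j.
    by rewrite -mulrA; apply: le_trans (_ : c * 1 <= _); [rewrite ler_wpM2l// ltW|lra].
  lra.
have c2 : c * a j * (z + p j) <= 2 * z.
  have : c * a j * p j <= z.
    by rewrite -mulrA; apply: le_trans (_ : c * 1 <= _); [rewrite ler_wpM2l// ltW|lra].
  have [pz|zp] := leP (p j) z.
    have : c * a j * z <= p j by rewrite mulrAC; apply: le_trans az; rewrite ler_piMl// ltW.
    lra.
  have : c * a j * z <= c * a j * p j by apply: ler_wpM2l; [apply: mulr_ge0; exact: ltW|exact: ltW].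
  lra.
by rewrite ler_norml mulrDl mulNr mul1r; lra.
Qed.

Lemma bprod_decay z n : 0 < z ->
  `|bprod p n z| <= expR (- (Num.min z z^-1 * \sum_(j < n) a j)).
Proof.
move=> z0; elim: n => [|n IH].
  by rewrite /bprod !big_ord0 mulr0 oppr0 expR0 normr1.
rewrite bprodS normrM big_ord_recr/= mulrDr opprD expRD.
by apply: ler_pM => //; exact: bfactor_decay.
Qed.

(** The squared distance from [kexp z u] to the span of the first [n] kernels is
    [bprod p n z ^+ 2 / (2 * z)], and the product tends to 0 by [bprod_decay]. *)
Lemma divergent_cl_pexps : ~ (\sum_(0 <= j <oo) (a j)%:E < +oo)%E ->
  forall z u, 0 < z -> cl h (pexps p u) (kexp z u).
Proof.
move=> div z u z0; have [[j zj]|nz] := pselect (exists j, z = p j).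
  by apply: sub_cl; [exact: pexps_L2|exists j; rewrite ?zj].
have av n : avoids p n z by move=> j _; apply/eqP => zj; apply: nz; exists j.
split; first exact: L2_kexp.
move=> e e0.
have c0 : 0 < Num.min z z^-1 by rewrite lt_min z0 invr_gt0.
have unb (M : R) : exists n, M < \sum_(j < n) a j.
  apply: contrapT => H; apply: div; apply: (@le_lt_trans _ _ M%:E); last exact: ltry.
  apply: lime_le.
    by apply: is_cvg_nneseries => n _ _; rewrite lee_fin ltW.
  apply: nearW => n; rewrite sumEFin lee_fin leNgt; apply/negP => Mn; apply: H.
  by exists n; rewrite big_mkord in Mn.
(* A product of absolute value below [d <= 1] has its square below [d], hence below
   [e * (z + z)]. *)
pose d := Num.min 1 (e * (z + z)).
have d0 : 0 < d by rewrite lt_min ltr01/= mulr_gt0// addr_gt0.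
have [n Mn] := unb (- ln d / Num.min z z^-1).
have bn : `|bprod p n z| < d.
  apply: le_lt_trans (bprod_decay n z0) _.
  rewrite -[ltRHS](@lnK R) ?posrE// ltr_expR.
  by move: Mn; rewrite ltr_pdivrMr// mulrC; lra.
exists (kexp z u - bprod p n z *: bkernel p n z u).
  rewrite {1}(kexp_bkernel u z0 (av n)) addrAC subrr add0r.
  by apply: spanN; apply: spanZ; exact: span_bsum.
have L2b : dom h (bkernel p n z u) by exact: L2_bkernel.
rewrite subKr n2Z// n2_bkernel// -real_normK ?num_real//.
rewrite ltr_pdivrMr ?addr_gt0//.
apply: (@lt_le_trans _ _ d); last by rewrite ge_min lexx orbT.
have d1 : d <= 1 by rewrite ge_min lexx.
by have := normr_ge0 (bprod p n z); rewrite expr2; nra.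
Qed.

End muntz.

(** * Convergent series: the limit kernel and what it generates *)

Section translation.
Context {R : realType}.
Local Notation mu := (@lebesgue_measure R).
Local Notation h := (L2_inner mu).

Definition translate (u : R) (f : R -> R) : R -> R := fun v => f (v - u).

Lemma measurable_translate u f :
  measurable_fun [set: R] f -> measurable_fun [set: R] (translate u f).
Proof. by move=> mf; apply: measurableT_comp mf _; exact: measurable_funB. Qed.

Lemma integral_translate u f : measurable_fun [set: R] f ->
  (\int[mu]_x (translate u f x ^+ 2)%:E = \int[mu]_x (f x ^+ 2)%:E)%E.
Proof.
move=> mf; rewrite -[RHS](@ge0_integral_affine _ 1 (- u)) ?oner_neq0//.
- by apply: eq_integral => x _; rewrite normr1 mul1e mul1r.
- exact: measurable_EFin_sqr.
- by move=> x; rewrite lee_fin sqr_ge0.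
Qed.

Lemma L2_translate u f : L2 mu f -> L2 mu (translate u f).
Proof.
by move=> [mf fy]; split; [exact: measurable_translate|rewrite integral_translate].
Qed.

Lemma n2_translate u f : measurable_fun [set: R] f -> n2 h (translate u f) = n2 h f.
Proof.
by move=> mf; rewrite /n2 /= /ip; congr fine; exact: (integral_translate u mf).
Qed.

End translation.

Section convergent.
Context {R : realType}.
Local Notation mu := (@lebesgue_measure R).
Local Notation h := (L2_inner mu).
Variable p : nat -> R.
Hypotheses (p0 : forall j, 0 < p j) (p_inj : injective p).

Let a j := p j / (p j ^+ 2 + 1).

Hypothesis afin : (\sum_(0 <= j <oo) (a j)%:E < +oo)%E.

Let pp1 j : 0 < p j ^+ 2 + 1. Proof. by have := sqr_ge0 (p j); lra. Qed.

Let a_ge0 j : 0 <= a j. Proof. by rewrite divr_ge0 ?ltW. Qed.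

Let T n := fine (\sum_(n <= j <oo) (a j)%:E)%E.

Let TE n : (\sum_(n <= j <oo) (a j)%:E = (T n)%:E)%E.
Proof.
rewrite fineK// ge0_fin_numE; last by apply: nneseries_ge0 => j _ _; rewrite lee_fin.
apply: le_lt_trans afin; rewrite (@nneseries_split _ (fun j => (a j)%:E) 0 n).
  by rewrite add0n leeDr// sume_ge0// => j _; rewrite lee_fin.
by move=> j _; rewrite lee_fin.
Qed.

Let T_cvg : T n @[n --> \oo] --> 0.
Proof.
have aE0 j : xpredT j -> (0 <= (a j)%:E)%E by rewrite lee_fin.
have := nneseries_tail_cvg afin aE0.
by under eq_fun do rewrite TE; move=> /fine_cvg.
Qed.

Let T_ge n m : \sum_(n <= j < m) a j <= T n.
Proof.
rewrite -lee_fin -TE -sumEFin; apply: nneseries_lim_ge => j _ _.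
by rewrite lee_fin.
Qed.

Let T_ge0 n : 0 <= T n.
Proof. by apply: le_trans (T_ge n n); rewrite big_geq. Qed.

(** Thanks to the sign, the deviation from 1 is 2 p / (z + p) for p <= 1 and 2 z / (z + p) for p >
    1; for [z] in [[A, B]] both are bounded by a multiple of [a j]. *)
Let bfactor_near1 z (A B : R) j : 0 < A -> A <= z -> z <= B ->
  `|bfactor p j z - 1| <= 4 * (B + A^-1) * a j.
Proof.
move=> A0 Az zB; have z0 : 0 < z by exact: lt_le_trans Az.
have B0 : 0 < B by exact: lt_le_trans zB.
have Ai : 0 < A^-1 by rewrite invr_gt0.
have pj := p0 j; have zp : 0 < z + p j by rewrite addr_gt0.
rewrite /bfactor /bsign; case: ifPn => [pl|]; last rewrite -ltNge => pg.
  have -> : 1 * (z - p j) / (z + p j) - 1 = - (2 * p j / (z + p j)).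
    by field; rewrite gt_eqF.
  rewrite normrN ger0_norm; last by rewrite divr_ge0 ?mulr_ge0 ?ltW.
  apply: (@le_trans _ _ (2 * p j / A)).
    by rewrite ler_wpM2l ?mulr_ge0 ?(ltW pj)// lef_pV2 ?posrE//; lra.
  have -> : 4 * (B + A^-1) * a j = 4 * (a j * B) + 4 * (a j * A^-1) by ring.
  have : p j <= 2 * a j.
    rewrite /a mulrA ler_pdivlMr//; nra.
  move=> pa; have : p j / A <= 2 * a j / A by rewrite ler_wpM2r// ltW.
  have : 0 <= a j * B by rewrite mulr_ge0// ltW.
  lra.
have -> : -1 * (z - p j) / (z + p j) - 1 = - (2 * z / (z + p j)).
  by field; rewrite gt_eqF.
rewrite normrN ger0_norm; last by rewrite divr_ge0 ?mulr_ge0 ?ltW.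
apply: (@le_trans _ _ (2 * B / p j)).
  apply: ler_pM; first by rewrite mulr_ge0 ?ltW.
  - by rewrite invr_ge0 ltW.
  - by rewrite ler_pM2l.
  - by rewrite lef_pV2 ?posrE//; lra.
have pa : (p j)^-1 <= 2 * a j.
  rewrite /a mulrA ler_pdivlMr// mulrC ler_pdivrMr//; nra.
have : B * (p j)^-1 <= B * (2 * a j) by rewrite ler_wpM2l// ltW.
have : 0 <= A^-1 * a j by rewrite mulr_ge0// ltW.
lra.
Qed.

Let ratio_near1 z (A B : R) n m : 0 < A -> A <= z -> z <= B -> avoids p n z ->
  (n <= m)%N -> `|bprod p m z / bprod p n z - 1| <= 4 * (B + A^-1) * T n.
Proof.
move=> A0 Az zB av nm; have z0 : 0 < z by exact: lt_le_trans Az.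
have Ai : 0 < A^-1 by rewrite invr_gt0.
have bn := bprod_neq0 p0 z0 av.
apply: (@le_trans _ _ (4 * (B + A^-1) * \sum_(n <= j < m) a j)); last first.
  by rewrite ler_wpM2l//; lra.
(* The bound by 1 on the ratio is carried through the induction, so that the deviation of each new
   factor is not amplified. *)
suff [] : `|bprod p m z / bprod p n z - 1| <= 4 * (B + A^-1) * \sum_(n <= j < m) a j
  /\ `|bprod p m z / bprod p n z| <= 1 by [].
elim: m nm => [|m IH]; first by rewrite leqn0 => /eqP n0; rewrite n0 in bn *;
  rewrite divff// subrr normr0 big_geq// mulr0 normr1.
rewrite leq_eqVlt => /orP[/eqP <-|].
  by rewrite divff// subrr normr0 big_geq// mulr0 normr1.
rewrite ltnS => nm; have [IH1 IH2] := IH nm.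
rewrite bprodS mulrAC; set r := bprod p m z / bprod p n z in IH1 IH2 *.
split; last by rewrite normrM mulr_ile1// bfactor_le1.
rewrite big_nat_recr//= mulrDr.
have -> : r * bfactor p m z - 1 = (r - 1) + r * (bfactor p m z - 1) by ring.
apply: le_trans (ler_normD _ _) _; apply: lerD => //.
rewrite normrM; apply: le_trans (_ : 1 * `|bfactor p m z - 1| <= _).
  by rewrite ler_wpM2r.
by rewrite mul1r; exact: bfactor_near1.
Qed.

(** The rate 1/2 may itself be one of the [p j], a root of the products. It is approached from above
    by rates that avoid the first [n] roots. *)
Let zseq_ex (n : nat) : exists z : R, [/\ 2^-1 < z, z <= 2^-1 + n.+1%:R^-1 & avoids p n z].
Proof.
have H : exists2 d : R, 0 < d & forall z, 2^-1 < z -> z <= 2^-1 + d -> avoids p n z.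
  elim: n => [|n [d d0 Hd]]; first by exists 1.
  have [pn|pn] := leP (p n) 2^-1.
    exists d => // z z1 z2 j; rewrite ltnS leq_eqVlt => /orP[/eqP ->|]; last exact: Hd.
    by rewrite gt_eqF//; exact: le_lt_trans z1.
  exists (Num.min d ((p n - 2^-1) / 2)).
    by rewrite lt_min d0/= divr_gt0// subr_gt0.
  move=> z z1 z2 j; rewrite ltnS leq_eqVlt => /orP[/eqP ->|].
    have : Num.min d ((p n - 2^-1) / 2) <= (p n - 2^-1) / 2 by rewrite ge_min lexx orbT.
    by move=> ?; rewrite lt_eqF//; lra.
  apply: Hd => //; apply: le_trans z2 _; rewrite lerD2l ge_min lexx//.
have [d d0 Hd] := H; exists (2^-1 + Num.min d n.+1%:R^-1).
have m0 : 0 < Num.min d n.+1%:R^-1 by rewrite lt_min d0 invr_gt0 ltr0n.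
split; first by rewrite ltrDl.
  by rewrite lerD2l ge_min lexx orbT.
by apply: Hd; [rewrite ltrDl|rewrite lerD2l ge_min lexx].
Qed.

Let zs n : R := projT1 (cid (zseq_ex n)).

Let zs_gt n : 2^-1 < zs n. Proof. by rewrite /zs; case: cid => z []. Qed.
Let zs_le n : zs n <= 2^-1 + n.+1%:R^-1. Proof. by rewrite /zs; case: cid => z []. Qed.
Let zs_av n : avoids p n (zs n). Proof. by rewrite /zs; case: cid => z []. Qed.
Let zs_gt0 n : 0 < zs n. Proof. by apply: lt_trans (zs_gt n); rewrite invr_gt0. Qed.
Let zs_le2 n : zs n <= 2.
Proof.
have : n.+1%:R^-1 <= 1 :> R by rewrite invf_le1 ?ler1n ?ltr0n.
by have := zs_le n; move: (n.+1%:R^-1) => x; lra.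
Qed.

Let zs_cvg : zs n @[n --> \oo] --> (2^-1 : R).
Proof.
apply: (@squeeze_cvgr _ _ _ _ (cst (2^-1 : R)) (fun n => 2^-1 + n.+1%:R^-1 : R)).
- by near=> n; rewrite zs_le (ltW (zs_gt n)).
- exact: cvg_cst.
- rewrite -[X in _ --> X]addr0; apply: cvgD; [exact: cvg_cst|exact: invS_cvg0].
Unshelve. all: by end_near. Qed.

Let bk n u := bkernel p n (zs n) u.

Let L2_bk n u : dom h (bk n u). Proof. exact: L2_bkernel. Qed.

(** [dot_bkernel] gives the cross term, and two errors remain: the difference of the rates, and the
    deviation from 1 of the ratio of products. With rates between 1/2 and 2, [ratio_near1] has the
    constant 16, which is doubled here. *)
Let n2_bkB n m : (n <= m)%N ->
  n2 h (bk m 0 - bk n 0) <= 3 * `|zs n - zs m| + 32 * T n.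
Proof.
move=> nm; rewrite n2B// /bk dot_bkernel// !n2_bkernel// subrr mulr0 expR0 mul1r.
have := ratio_near1 (_ : 0 < 2^-1) (ltW (zs_gt n)) (zs_le2 n) (@zs_av n) nm.
set r := bprod p m _ / _; rewrite invr_gt0 invrK => /(_ (ltr0Sn R 1)) Hr.
have := zs_gt n; have := zs_gt m; have := zs_le2 n; have := zs_le2 m.
set z := zs n; set w := zs m => w2 z2 w1 z1.
have zw0 : 0 < z + w by lra.
have z0 : 0 < z by lra.
have w0 : 0 < w by lra.
have -> : (w + w)^-1 - 2 * (r / (z + w)) + (z + z)^-1 =
    (z - w) ^+ 2 / (2 * z * w * (z + w)) + 2 * (1 - r) / (z + w).
  by field; rewrite !gt_eqF//; lra.
apply: lerD.
  rewrite ler_pdivrMr ?mulr_gt0// -real_normK ?num_real// expr2.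
  have zwB : `|z - w| <= 3 / 2 by rewrite ler_norml; lra.
  have zw4 : 1 / 4 <= z * w by nra.
  have zw1' : 1 / 4 * 1 <= z * w * (z + w) by apply: ler_pM; lra.
  have -> : 2 * z * w * (z + w) = 2 * (z * w * (z + w)) by ring.
  have := normr_ge0 (z - w); move: `|z - w| zwB => t; nra.
rewrite ler_pdivrMr//; have := ler_norm (1 - r); rewrite distrC.
have := T_ge0 n; have := normr_ge0 (r - 1); move: Hr.
nra.
Qed.

Let bk_cauchy e : 0 < e -> exists N, forall m n, (N <= m)%N -> (N <= n)%N ->
  n2 h (bk m 0 - bk n 0) < e.
Proof.
move=> e0.
have [|N1 _ H1] := (cvgrPdist_lt _ _).1 zs_cvg (e / 24); first by rewrite divr_gt0.
have [|N2 _ H2] := (cvgr_lt _ T_cvg) (e / 128); first by rewrite divr_gt0.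
exists (maxn N1 N2).
suff H n m : (maxn N1 N2 <= n)%N -> (n <= m)%N -> n2 h (bk m 0 - bk n 0) < e.
  move=> m n Hm Hn; have [mn|/ltnW nm] := leqP m n; last exact: H.
  by rewrite n2_distC//; exact: H.
move=> Nn nm; apply: le_lt_trans (n2_bkB nm) _.
have := H1 n (leq_trans (leq_maxl _ _) Nn).
have := H1 m (leq_trans (leq_maxl _ _) (leq_trans Nn nm)).
have := H2 n (leq_trans (leq_maxr _ _) Nn).
rewrite /= => h1 h2 h3.
have := ler_distD 2^-1 (zs n) (zs m); rewrite (distrC (zs n) 2^-1); lra.
Qed.

Let blim_ex : exists2 g, dom h g & n2 h (bk n 0 - g) @[n --> \oo] --> 0.
Proof. exact: (cauchy_lim (@L2_complete _ _ _ mu) (fun n => L2_bk n 0) bk_cauchy). Qed.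

Let g0 : R -> R := sval (cid2 blim_ex).
Let L2g0 : L2 mu g0. Proof. by rewrite /g0; case: cid2. Qed.
Let bk_g0 : n2 h (bk n 0 - g0) @[n --> \oo] --> 0.
Proof. by rewrite /g0; case: cid2. Qed.

(** [g0] is determined only almost everywhere, so it is cut off explicitly: the kernel vanishes for
    negative [x], and [eta_at u] is exactly supported before [u]. *)
Definition muntz_eta (x : R) : R := if 0 <= x then g0 (- x) else 0.

Definition eta_at u : R -> R := fun v => muntz_eta (u - v).

Let eta_atE u : eta_at u = translate u (fun v => g0 v * \1_(`]-oo, 0%R]) v).
Proof.
apply/funext => v; rewrite /eta_at /translate /muntz_eta indicE mem_setE in_itv/=.
by rewrite subr_ge0 subr_le0 opprB; case: ifP; rewrite ?mulr1 ?mulr0.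
Qed.

Let mg1 : measurable_fun [set: R] (fun v => g0 v * \1_(`]-oo, 0%R]) v).
Proof. by apply: measurable_funM; [case: L2g0|exact: measurable_indic]. Qed.

Let g1E x : (g0 x * \1_(`]-oo, 0%R]) x) ^+ 2 <= g0 x ^+ 2.
Proof.
by rewrite indicE; case: (_ \in _); rewrite ?mulr1// mulr0 expr0n/= sqr_ge0.
Qed.

Let L2g1 : L2 mu (fun v => g0 v * \1_(`]-oo, 0%R]) v).
Proof.
refine (@L2_le_integral _ _ R mu _ g0 mg1 L2g0 _); apply: ge0_le_integral => //.
- by move=> x _; exact: sqr_EFin_ge0.
- exact: measurable_EFin_sqr.
- by apply: measurable_EFin_sqr; case: L2g0.
by move=> x _; rewrite lee_fin.
Qed.

Lemma L2_eta_at u : L2 mu (eta_at u).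
Proof. by rewrite eta_atE; exact: L2_translate. Qed.

Let bk0 n v : 0 < v -> bk n 0 v = 0.
Proof.
move=> v0; have k0 z : kexp z 0 v = 0.
  by rewrite /kexp indicE mem_setE in_itv/= leNgt v0 mulr0.
transitivity ((bprod p n (zs n))^-1 * kexp (zs n) 0 v +
  (\sum_(j < n) bcoef p (zs n) n j *: kexp (p j) 0 : R -> R) v); first by [].
rewrite k0 mulr0 add0r fct_sumE big1// => i _.
by transitivity (bcoef p (zs n) n i * kexp (p i) 0 v); rewrite // k0 mulr0.
Qed.

Let bk_translate n u : bk n u = translate u (bk n 0).
Proof.
have kt z : kexp z u = translate u (kexp z 0).
  apply/funext => v; rewrite /translate /kexp subr0 !indicE !mem_setE !in_itv/=.
  by rewrite subr_le0.
rewrite /bk /bkernel kt.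
have -> : \sum_(j < n) bcoef p (zs n) n j *: kexp (p j) u =
  translate u (\sum_(j < n) bcoef p (zs n) n j *: kexp (p j) 0).
  elim/big_rec2: _ => [|i y1 y2 _ ->]; first by [].
  by rewrite kt.
by [].
Qed.

(** Translation reduces to [u = 0], and cutting off [g0] on the positive side can only lower the
    distance, since the approximating kernels vanish there. *)
Lemma cvg_eta_at u : n2 h (bk n u - eta_at u) @[n --> \oo] --> 0.
Proof.
apply: (@squeeze_cvgr _ _ _ _ (cst 0) (fun n => n2 h (bk n 0 - g0))) => //; last exact: cvg_cst.
apply: nearW => n; rewrite n2_ge0/= bk_translate eta_atE.
have mb : measurable_fun setT (bk n 0) by case: (L2_bk n 0).
have mb1 : measurable_fun [set: R] (bk n 0 - (fun v => g0 v * \1_(`]-oo, 0%R]) v)).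
  exact: measurable_funB.
apply: le_trans (_ : n2 h (bk n 0 - (fun v => g0 v * \1_(`]-oo, 0%R]) v)) <= _).
  by rewrite le_eqVlt; apply/orP; left; apply/eqP; exact: (n2_translate u mb1).
have L2a := domB (h := h) (L2_bk n 0) L2g1; have L2b := domB (h := h) (L2_bk n 0) L2g0.
rewrite -lee_fin -!L2_sqE//; apply: ge0_le_integral => //.
- by move=> x _; exact: sqr_EFin_ge0.
- by apply: measurable_EFin_sqr; case: L2a.
- by apply: measurable_EFin_sqr; case: L2b.
move=> x _; rewrite lee_fin.
suff : (bk n 0 x - g0 x * \1_(`]-oo, 0%R]) x) ^+ 2 <= (bk n 0 x - g0 x) ^+ 2 by [].
rewrite indicE mem_setE in_itv/=; have [x0|x0] := leP x 0; first by rewrite mulr1.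
by rewrite mulr0 subr0 bk0// expr0n/= sqr_ge0.
Qed.

Lemma cl_exps_eta_at u : cl h (exps u) (eta_at u).
Proof.
apply: (lim_cl (@exps_L2 R u) _ (L2_eta_at u) (cvg_eta_at u)) => n.
apply: spanD; first by apply: spanZ; apply: sub_span; exists (zs n) => //=.
by apply: span_sum => j _; apply: spanZ; apply: sub_span; exists (p j) => //=.
Qed.

(** For equal [n] and equal rates the products cancel in [dot_bkernel], leaving exp (- z_n (u - r))
    / (2 z_n) exactly; then z_n tends to 1/2. *)
Lemma dot_eta_at u r : r <= u -> dot h (eta_at u) (eta_at r) = expR (- (u - r) / 2).
Proof.
move=> ru; rewrite dotC.
have c1 := cvg_dot (fun n => L2_bk n r) (fun n => L2_bk n u) (L2_eta_at r) (L2_eta_at u)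
  (cvg_eta_at r) (cvg_eta_at u).
apply: (cvg_unique _ c1) => //.
have -> : (fun n => dot h (bk n r) (bk n u)) =
    (fun n => expR (- zs n * (u - r)) / (zs n + zs n)).
  apply/funext => n; rewrite dot_bkernel// divff ?mulr1//.
  exact: (bprod_neq0 p0).
have -> : expR (- (u - r) / 2) = expR (- 2^-1 * (u - r)) / (2^-1 + 2^-1).
  have -> : 2^-1 + 2^-1 = 1 :> R by field.
  by rewrite divr1; congr expR; ring.
apply: cvgM.
  apply: (cvg_comp (fun n => - zs n * (u - r)) expR); last exact: continuous_expR.
  by apply: cvgMl; apply: cvgN; exact: zs_cvg.
apply: cvgV; last by apply: cvgD; exact: zs_cvg.
by rewrite gt_eqF// addr_gt0// invr_gt0.
Qed.

(** The inner products of the approximating kernels are 0 as soon as [n > j], because [p j] is then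
    a root of the product. *)
Lemma dot_eta_at_pexp u r j : r <= u -> dot h (eta_at r) (kexp (p j) u) = 0.
Proof.
move=> ru; have L2p := L2_kexp u (p0 j).
have c1 := cvg_dotl (fun n => L2_bk n r) (L2_eta_at r) L2p (cvg_eta_at r).
apply: (cvg_unique _ c1) => //.
apply: cvg_near_cst; near=> n; rewrite dot_bkernel_kexp// bprod_root ?mul0r ?mulr0//.
by near: n; exists j.+1.
Unshelve. all: by end_near. Qed.

Definition etas u : set (R -> R) := [set eta_at r | r in `]-oo, u]].

Lemma etas_L2 u : etas u `<=` dom h.
Proof. by move=> _ [r _ <-]; exact: L2_eta_at. Qed.

(** Kernels of rate 1/2 and functions [eta_at r] have the same Gram matrix, so this relation is
    isometric. *)
Let pairs u : set ((R -> R) * (R -> R)) :=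
  [set (kexp 2^-1 r, eta_at r) | r in `]-oo, u]].

Let half0 : 0 < 2^-1 :> R. Proof. by rewrite invr_gt0. Qed.

Let pairs_L2 u : pairs u `<=` dom (prod_inner h h).
Proof. by move=> _ [r _ <-]; split; [exact: L2_kexp|exact: L2_eta_at]. Qed.

Let pairs_isometric u : isometric h h (pairs u).
Proof.
have H r s : r <= s -> dot h (kexp 2^-1 s) (kexp 2^-1 r) = dot h (eta_at s) (eta_at r).
  move=> rs; rewrite dot_eta_at// dot_kexp//.
  have -> : 2^-1 + 2^-1 = 1 :> R by field.
  by rewrite divr1; congr expR; ring.
move=> _ _ [r _ <-] [s _ <-] /=; have [rs|/ltW sr] := leP r s; last exact: H.
by have := H r s rs; rewrite (dotC h (kexp _ _)) (dotC h (eta_at _)).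
Qed.

(** The value approached is the inner product of [kexp z u] with [kexp 2^-1 r]. For large [n], the
    normalised kernel is seen by the [eta_at r] as [kexp z u] is seen by the kernels of rate 1/2. *)
Let dot_bkernel_eta z n u r : 0 < z -> (forall m, avoids p m z) -> r <= u ->
  `|dot h (bkernel p n z u) (eta_at r) - expR (- z * (u - r)) / (z + 2^-1)| <=
  4 * (z + z^-1) * T n / z.
Proof.
move=> z0 av ru; have L2b := L2_bkernel p0 n u z0.
pose E := expR (- z * (u - r)).
have E1 : E <= 1 by rewrite /E -expR0 ler_expR mulNr oppr_le0 mulr_ge0 ?subr_ge0// ltW.
have E0 : 0 <= E by exact: expR_ge0.
have c1 := cvg_dotl (fun m => L2_bk m r) (L2_eta_at r) L2b (cvg_eta_at r).
rewrite dotC.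
have c2 : E / (z + zs m) @[m --> \oo] --> E / (z + 2^-1).
  apply: cvgMr; apply: cvgV; last by apply: cvgD; [exact: cvg_cst|exact: zs_cvg].
  by rewrite gt_eqF// addr_gt0.
have c3 : `|dot h (bk m r) (bkernel p n z u) - E / (z + zs m)| @[m --> \oo] -->
    `|dot h (eta_at r) (bkernel p n z u) - E / (z + 2^-1)|.
  by apply: cvg_norm; apply: cvgB.
rewrite -(cvg_lim (@Rhausdorff _) c3); apply: limr_le; first exact: cvgP c3.
near=> m; have nm : (n <= m)%N by near: m; exists n.
have -> : dot h (bk m r) (bkernel p n z u) =
  E * (bprod p m z / bprod p n z) / (z + zs m) by exact: dot_bkernel.
have -> : E * (bprod p m z / bprod p n z) / (z + zs m) - E / (z + zs m) =
  E * (bprod p m z / bprod p n z - 1) / (z + zs m) by ring.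
have zsm := zs_gt0 m.
rewrite !normrM (ger0_norm E0) normfV (gtr0_norm (addr_gt0 z0 zsm)).
have := @ratio_near1 z z z n m z0 (lexx z) (lexx z) (av n) nm.
set x := `|_ - 1| => xT; have x0 : 0 <= x by exact: normr_ge0.
apply: ler_pM.
- by rewrite mulr_ge0.
- by rewrite invr_ge0 addr_ge0 ?ltW.
- by apply: le_trans xT; rewrite ler_piMl.
- by rewrite lef_pV2 ?posrE ?addr_gt0// lerDl ltW.
Unshelve. all: by end_near. Qed.

(** A combination of kernels of rate 1/2 close to [kexp z u] is sent by the isometry to a
    combination of the [eta_at r], close to [bkernel p n z u] for [n] large. Then [kexp_bkernel]
    leads back to [kexp z u], at the cost of a combination of the [kexp (p j) u]. *)
Lemma cl_etas_pexps z u : 0 < z -> cl h (etas u `|` pexps p u) (kexp z u).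
Proof.
move=> z0.
have SD : etas u `|` pexps p u `<=` dom h.
  by move=> f [/etas_L2//|]; exact: pexps_L2.
have [[j zj]|nz] := pselect (exists j, z = p j).
  by apply: sub_cl => //; right; exists j; rewrite ?zj.
have av n : avoids p n z by move=> j _; apply/eqP => zj; apply: nz; exists j.
have L2z := L2_kexp u z0.
split => // e e0.
have [_ /(_ (e / 2))[|y0 y0s y0e]] := cl_half_exps u z0; first by rewrite divr_gt0.
(* [q] is the image of [y0] under the isometry from kernels of rate 1/2 to functions [eta_at r]. *)
have [q yq] : exists q, span (pairs u) (y0, q).
  apply: span_fst; apply: span_mono y0s => _ [r ru <-].
  by exists (kexp 2^-1 r, eta_at r) => //; exists r.
have [Dy0 Dq] := dom_span (@pairs_L2 u) yq.
have qs : span (etas u) q.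
  have := image_span (@snd (R -> R) (R -> R)) yq.
  by apply: span_mono => _ [_ [r ru <-] <-]; exists r.
have n2q : n2 h y0 = n2 h q.
  exact: (span_isometric (@pairs_L2 u) (@pairs_isometric u) yq yq).
have L2b n : dom h (bkernel p n z u) by exact: L2_bkernel.
have cq : dot h (bkernel p n z u) q @[n --> \oo] --> dot h (kexp z u) y0.
  suff : (fun n => dot h (bkernel p n z u) (y0, q).2) @ \oo --> dot h (kexp z u) (y0, q).1 by [].
  elim: yq => [|c _ yq' [r ru <-] yqs IH].
    under eq_fun => n do rewrite dotC dot0l//.
    by rewrite dotC dot0l//; exact: cvg_cst.
  have [D1 D2] := dom_span (@pairs_L2 u) yqs.
  have L2r : dom h (eta_at r) by exact: L2_eta_at.
  have L2k : dom h (kexp 2^-1 r) by exact: L2_kexp.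
  have -> : (fun n => dot h (bkernel p n z u) (c *: (kexp 2^-1 r, eta_at r) + yq').2) =
      (fun n => c * dot h (bkernel p n z u) (eta_at r) + dot h (bkernel p n z u) yq'.2).
    by apply/funext => n; rewrite dotDr ?dotZr//; exact: domZ.
  have -> : dot h (kexp z u) (c *: (kexp 2^-1 r, eta_at r) + yq').1 =
      c * dot h (kexp z u) (kexp 2^-1 r) + dot h (kexp z u) yq'.1.
    by rewrite dotDr ?dotZr//; exact: domZ.
  apply: cvgD => //; apply: cvgMr.
  have ru' : r <= u by move: ru; rewrite /= in_itv.
  rewrite dot_kexp//; apply/cvgrPdist_le => e' e'0.
  have cT : 4 * (z + z^-1) * T n / z @[n --> \oo] --> 0.
    rewrite -(mul0r z^-1); apply: cvgMl; rewrite -(mulr0 (4 * (z + z^-1))).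
    by apply: cvgMr; exact: T_cvg.
  near=> n; rewrite distrC; apply: le_trans (dot_bkernel_eta n z0 av ru') _.
  by near: n; apply: cvgr_le cT _ _.
(* The norms agree on the two sides, those of [q] and [y0] as well as those of the two kernels, and
   the inner products converge by [cq]; hence the distances converge. *)
have cn : n2 h (bkernel p n z u - q) @[n --> \oo] --> n2 h (kexp z u - y0).
  have -> : (fun n => n2 h (bkernel p n z u - q)) =
      (fun n => (z + z)^-1 - 2 * dot h (bkernel p n z u) q + n2 h q).
    by apply/funext => n; rewrite n2B// n2_bkernel.
  rewrite n2B// n2q; apply: cvgD; last exact: cvg_cst.
  have -> : n2 h (kexp z u) = (z + z)^-1.
    by rewrite /n2 dot_kexp// subrr mulr0 expR0 mul1r.
  by apply: cvgB; [exact: cvg_cst|apply: cvgMr].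
have [|N _ HN] := (cvgr_lt _ cn) e; first by lra.
exists (bprod p N z *: (q - \sum_(j < N) bcoef p z N j *: kexp (p j) u)).
  apply: spanZ; apply: spanB; [apply: span_mono qs|apply: span_mono (span_bsum p N z u)] => f ?.
    by left.
  by right.
have -> : kexp z u - bprod p N z *: (q - \sum_(j < N) bcoef p z N j *: kexp (p j) u) =
   bprod p N z *: (bkernel p N z u - q).
  by rewrite {1}(kexp_bkernel p0 u z0 (av N)) !scalerBr opprB addrA subrK.
(* Multiplying by the product does not increase the error, as its absolute value is at most 1. *)
rewrite n2Z; last exact: domB.
apply: le_lt_trans (HN N (leqnn N)); rewrite ler_piMl ?n2_ge0//.
by rewrite -real_normK ?num_real// exprn_ile1 ?norm_bprod_le1.
Unshelve. all: by end_near. Qed.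

End convergent.

(** * Random variables as square integrable functions *)

Section ereal_sequences.
Context {R : realType}.

Lemma ecvg0P (u : nat -> \bar R) : (forall n, (0 <= u n)%E) ->
  u n @[n --> \oo] --> 0%E ->
  forall e : R, 0 < e -> exists N, forall n, (N <= n)%N -> (u n < e%:E)%E.
Proof.
move=> u0 cu e e0.
have /fine_cvgP[[N1 _ H1] fu] := cu.
have [N2 _ H2] := cvgr_lt _ fu e e0.
exists (maxn N1 N2) => n; rewrite geq_max => /andP[n1 n2].
by have := H2 n n2; rewrite /= -lte_fin fineK//; exact: (H1 n n1).
Qed.

Lemma ecvg0_harmonic (u : nat -> \bar R) : (forall n, (0 <= u n)%E) ->
  (forall n, (u n < (n.+1%:R^-1)%:E)%E) -> u n @[n --> \oo] --> 0%E.
Proof.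
move=> u0 H; apply: (@squeeze_cvge _ _ _ _ (cst 0%E) _ (fun n => ((n.+1%:R^-1 : R)%:E))).
- by near=> n; rewrite u0/= ltW.
- exact: cvg_cst.
- by apply: cvg_EFin; [near=> n|exact: invS_cvg0].
Unshelve. all: by end_near. Qed.

End ereal_sequences.

Section random_variables.
Context {d : measure_display} {Omega : measurableType d} {R : realType}.
Variable P : probability Omega R.
Local Notation hP := (L2_inner P).
Implicit Types (X Y Z : {RV P >-> R}) (A : set {RV P >-> R}).

Lemma expectation_sqr X : 'E_P[(X ^+ 2)%R]%E = (\int[P]_w (X w ^+ 2)%:E)%E.
Proof. by rewrite unlock. Qed.

Lemma expectation_mul X Y : 'E_P[(X * Y)%R]%E = (\int[P]_w (X w * Y w)%:E)%E.
Proof. by rewrite unlock. Qed.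

Lemma RV_measurable X : measurable_fun [set: Omega] X.
Proof. exact: measurable_funPT. Qed.

Lemma expectation_sqr_ge0 X : (0 <= 'E_P[(X ^+ 2)%R])%E.
Proof. by rewrite expectation_sqr; apply: integral_ge0 => w _; exact: sqr_EFin_ge0. Qed.

Lemma L2_RV X : ('E_P[(X ^+ 2)%R] < +oo)%E -> L2 P X.
Proof. by rewrite expectation_sqr => H; split=> //; exact: RV_measurable. Qed.

Lemma expectation_n2 X : L2 P X -> 'E_P[(X ^+ 2)%R]%E = (n2 hP X)%:E.
Proof. by move=> L2X; rewrite expectation_sqr L2_sqE. Qed.

Lemma expectation_dot X Y : L2 P X -> L2 P Y -> 'E_P[(X * Y)%R]%E = (dot hP X Y)%:E.
Proof. by move=> L2X L2Y; rewrite expectation_mul ipE. Qed.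

Lemma Lfun2P (X : Omega -> R) : X \in Lfun P 2%:E <-> L2 P X.
Proof.
split=> [H|[mX Xy]].
  have /integrableP[_] := Lfun2_integrable_sqr H.
  under eq_integral do rewrite gee0_abs ?sqr_EFin_ge0//.
  by move=> Hy; split => //; move: H; rewrite inE => /andP[]; rewrite inE.
rewrite inE; apply/andP; split; rewrite inE//= /finite_norm.
rewrite (@lty_poweRy _ _ 2) ?pnatr_eq0// poweR_Lnorm ?pnatr_eq0//.
apply: le_lt_trans Xy; rewrite le_eqVlt; apply/orP; left; apply/eqP.
apply: eq_integral => w _ /=; congr EFin.
by rewrite powR_mulrn ?normr_ge0// real_normK ?num_real.
Qed.

Lemma mfun_exists (f : Omega -> R) : measurable_fun [set: Omega] f ->
  exists X : {RV P >-> R}, (X : Omega -> R) = f.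
Proof.
move=> mf; pose fm := isMeasurableFun.Build _ _ _ _ f mf.
pose X : {mfun Omega >-> R} := HB.pack f fm.
by exists X.
Qed.

(** Forgets measurability, so that spans and closed spans of random variables become those of the
    semi-inner product on functions. *)
Definition fns A : set (Omega -> R) := [set (X : Omega -> R) | X in A].

Lemma linear_span_fns A Z : linear_span A Z -> span (fns A) Z.
Proof.
move=> [n [c [Y [AY ->]]]].
elim: n c Y AY => [|n IH] c Y AY; first by rewrite big_ord0; exact: span0.
rewrite big_ord_recl.
have -> : (c ord0 *: Y ord0 + \sum_(i < n) c (lift ord0 i) *: Y (lift ord0 i) :
    {RV P >-> R}) = c ord0 *: (Y ord0 : Omega -> R) +
  (\sum_(i < n) c (lift ord0 i) *: Y (lift ord0 i) : {RV P >-> R}) :> (Omega -> R) by [].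
by apply: spanS; [exists (Y ord0)|exact: (IH (fun i => c (lift ord0 i)))].
Qed.

Lemma span_fns_linear A f : span (fns A) f ->
  exists2 Z, linear_span A Z & (Z : Omega -> R) = f.
Proof.
elim=> [|c _ f' [Y AY <-] _ [Z [n [c' [Y' [AY' ZE]]]] <-]].
  by exists 0 => //; exists 0%N, (fun=> 0), (fun=> 0); split; [case|rewrite big_ord0].
exists (c *: Y + Z) => //.
exists n.+1, (fun i => if unlift ord0 i is Some j then c' j else c),
  (fun i => if unlift ord0 i is Some j then Y' j else Y); split.
  by move=> i; case: unliftP => [j _|_].
rewrite big_ord_recl unlift_none ZE; congr (_ + _).
by apply: eq_bigr => i _; rewrite liftK.
Qed.

Lemma closed_spanP A Y : (forall X, A X -> L2 P X) ->
  closed_span A Y <-> cl hP (fns A) Y.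
Proof.
move=> A2; have AD : fns A `<=` dom hP by move=> _ [X /A2 ? <-].
split=> [[/Lfun2P L2Y H]|[L2Y H]].
  split => // e /H[Z /linear_span_fns sZ YZ]; exists (Z : Omega -> R) => //.
  have DZ : dom hP (Z : Omega -> R) := dom_span AD sZ.
  have D : L2 P ((Y - Z : {RV P >-> R}) : Omega -> R) := domB (h := hP) L2Y DZ.
  by rewrite -lte_fin; move: YZ; rewrite expectation_n2.
split; first exact/Lfun2P.
move=> e /H[_ /span_fns_linear[Z sZ <-] YZ]; exists Z => //.
have DZ : dom hP (Z : Omega -> R) := dom_span AD (linear_span_fns sZ).
have D : L2 P ((Y - Z : {RV P >-> R}) : Omega -> R) := domB (h := hP) L2Y DZ.
by rewrite expectation_n2 ?lte_fin.
Qed.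

End random_variables.

(** * The Wiener integral as a closed isometric relation *)

Section wiener.
Context {d : measure_display} {Omega : measurableType d} {R : realType}.
Variable P : probability Omega R.
Local Notation mu := (@lebesgue_measure R).
Local Notation hR := (L2_inner mu).
Local Notation hP := (L2_inner P).
Local Notation hh := (prod_inner hR hP).
Variables (D : set R) (W : R -> {RV P >-> R}).
Hypothesis W2 : forall u v, D u -> D v -> 'E_P[((W u - W v) ^+ 2)%R]%E = `|u - v|%:E.

(** The generating part of the Wiener isometry: the indicator of []a, b]] is paired with the
    increment from [a] to [b]. *)
Definition increments : set ((R -> R) * (Omega -> R)) :=
  [set (\1_(`]z.1, z.2]), ((W z.2 - W z.1 : {RV P >-> R}) : Omega -> R))
    | z in [set z | [/\ D z.1, D z.2 & z.1 <= z.2]]].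

Lemma L2_increment u v : D u -> D v -> L2 P (W u - W v).
Proof. by move=> Du Dv; apply: L2_RV; rewrite W2// ltry. Qed.

Lemma n2_increment u v : D u -> D v -> n2 hP (W u - W v) = `|u - v|.
Proof.
move=> Du Dv; apply/EFin_inj; rewrite -W2//.
by have /= := expectation_n2 (L2_increment Du Dv).
Qed.

Lemma L2_indic_oc (a b : R) : a <= b -> L2 mu \1_`]a, b].
Proof.
by move=> ab; apply: L2_indic => //; have := ltry (b - a); rewrite -(lebesgue_itv_oc ab).
Qed.

Lemma increments_L2 : increments `<=` dom hh.
Proof.
move=> _ [[a b] [Da Db ab] <-]; split; first exact: L2_indic_oc.
exact: L2_increment.
Qed.

(** Both inner products are the length of the overlap of the two intervals. For the increments it
    follows by polarisation from their variances. *)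
Lemma increments_isometric : isometric hR hP increments.
Proof.
move=> _ _ [[a b] [/= Da Db ab] <-] [[c e] [/= Dc De ce] <-].
suff : dot hR \1_`]a, b] \1_`]c, e] = dot hP ((W b - W a : {RV P >-> R}) : Omega -> R)
  ((W e - W c : {RV P >-> R}) : Omega -> R) by [].
have -> : dot hR \1_`]a, b] \1_`]c, e] = Num.max 0 (Num.min b e - Num.max a c).
  rewrite dot_indic//.
  have -> : `]a, b]%classic `&` `]c, e]%classic = `]Num.max a c, Num.min b e]%classic.
    apply/seteqP; split => x /=; rewrite !in_itv/= gt_max le_min.
      by move=> [/andP[-> ->] /andP[-> ->]].
    by move=> /andP[/andP[-> ->] /andP[-> ->]].
  have [h|h] := leP (Num.max a c) (Num.min b e).
    transitivity (fine (Num.min b e - Num.max a c)%:E).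
      by congr fine; exact: lebesgue_itv_oc.
    by apply/esym/max_idPr; rewrite subr_ge0.
  rewrite set_itv_ge -?leNgt ?bnd_simp ?(ltW h)// measure0.
  by apply/esym/max_idPl; rewrite subr_le0 ltW.
pose x u : Omega -> R := (W u - W a : {RV P >-> R}).
have Dx u : D u -> dom hP (x u) by move=> Du; exact: L2_increment.
have nx u v : D u -> D v -> dot hP (x u) (x v) = (`|u - a| + `|v - a| - `|u - v|) / 2.
  move=> Du Dv; have := n2B (Dx u Du) (Dx v Dv).
  have -> : x u - x v = (W u - W v : {RV P >-> R}) :> (Omega -> R).
    by apply/funext => w; rewrite /x; transitivity ((W u w - W a w) - (W v w - W a w));
      [|transitivity (W u w - W v w); [ring|]].
  rewrite !n2_increment//; lra.
have -> : ((W e - W c : {RV P >-> R}) : Omega -> R) = x e - x c.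
  by apply/funext => w; rewrite /x; transitivity ((W e w - W a w) - (W c w - W a w));
      [transitivity (W e w - W c w); [|ring]|].
rewrite dotBr; [|exact: Dx|exact: Dx|exact: Dx]; rewrite !nx//.
rewrite /Num.max /Num.min; case: ifPn; case: ifPn; case: ifPn; rewrite ?ltNge ?negbK;
  case: (ger0P (b - a)); case: (ger0P (c - a)); case: (ger0P (e - a)); case: (ger0P (b - e)); case: (ger0P (b - c)); lra.
Qed.

Local Notation K := (cl hh increments).

Lemma step_span s : step_in D s ->
  span increments (step_fun s, (step_integral W s : Omega -> R)).
Proof.
elim: s => [|[c [a b]] s IH] Ds.
  rewrite (_ : (_, _) = 0); first exact: span0.
  rewrite /step_integral big_nil; congr (_, _).
  by apply/funext => x; rewrite /step_fun big_nil.
have /= [Da Db ab] := Ds (c, (a, b)) (mem_head _ _).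
rewrite (_ : (_, _) = c *: (\1_`]a, b], ((W b - W a : {RV P >-> R}) : Omega -> R)) +
   (step_fun s, (step_integral W s : Omega -> R))).
  apply: spanS; first by exists (a, b).
  by apply: IH => z zs; apply: Ds; rewrite inE zs orbT.
rewrite /step_integral big_cons /=; congr (_, _).
by apply/funext => x; rewrite /step_fun big_cons.
Qed.

Lemma span_step F X : span increments (F, X) ->
  exists2 s, step_in D s & step_fun s = F /\ (step_integral W s : Omega -> R) = X.
Proof.
move E : (F, X) => p sp; elim: sp F X E => [|c _ q [[a b] [/= Da Db ab] <-] _ IH] F X.
  move=> [-> ->]; exists [::] => //; split.
    by apply/funext => x; rewrite /step_fun big_nil.
  by rewrite /step_integral big_nil.
case: q IH => G Y /(_ G Y erefl)[s Ds [<- <-]] [-> ->].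
exists ((c, (a, b)) :: s); first by move=> z; rewrite inE => /orP[/eqP ->//|/Ds].
split; first by apply/funext => x; rewrite /step_fun big_cons.
by rewrite /step_integral big_cons.
Qed.

Hypotheses (mD : measurable D) (intD : forall a b, D a -> D b -> `]a, b] `<=` D).

Definition zero_ext (f : R -> R) : R -> R := f \_ D.

Lemma step_fun_out s x : step_in D s -> ~ D x -> step_fun s x = 0.
Proof.
move=> Ds Dx; rewrite /step_fun big_seq big1// => -[c [a b]] /Ds /= [Da Db _].
by rewrite indicE memNset ?mulr0// => /(intD Da Db).
Qed.

Lemma integral_step_dist f s : step_in D s ->
  (\int[mu]_(x in D) ((f x - step_fun s x) ^+ 2)%:E =
   \int[mu]_x ((zero_ext f - step_fun s) x ^+ 2)%:E)%E.
Proof.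
move=> Ds; rewrite integral_mkcond; apply: eq_integral => x _.
have -> : (zero_ext f - step_fun s) x = zero_ext f x - step_fun s x by [].
rewrite /zero_ext !patchE; case: ifPn => //.
by rewrite notin_setE => Dx; rewrite step_fun_out// subr0 expr0n.
Qed.

Lemma square_integrableP f : square_integrable D f <-> L2 mu (zero_ext f).
Proof.
have E : (\int[mu]_(x in D) (f x ^+ 2)%:E = \int[mu]_x (zero_ext f x ^+ 2)%:E)%E.
  rewrite integral_mkcond; apply: eq_integral => x _; rewrite /zero_ext !patchE.
  by case: ifPn => // _; rewrite expr0n.
rewrite /square_integrable E; split=> -[mf fy]; split => //.
  exact: (measurable_restrictT f mD).1.
exact: (measurable_restrictT f mD).2.
Qed.

(** A single sequence of step functions has to converge on both sides, which is convergence in the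
    product space of elements of the span of [increments]. *)
Lemma wiener_integralP f (X : {RV P >-> R}) :
  wiener_integral W D f X <-> K (zero_ext f, X : Omega -> R).
Proof.
split.
  move=> [/square_integrableP L2f [s [Ds fs Xs]]].
  have Ef e : 0 < e -> exists N, forall n, (N <= n)%N ->
      n2 hR (zero_ext f - step_fun (s n)) < e.
    move=> e0; have [|N HN] := ecvg0P _ fs e0.
      by move=> n; apply: integral_ge0 => x _; rewrite lee_fin sqr_ge0.
    exists N => n /HN; rewrite integral_step_dist// L2_sqE ?lte_fin//.
    apply: (domB (h := hR) L2f).
    by have [] := dom_span increments_L2 (step_span (Ds n)).
  have EX e : 0 < e -> exists N, forall n, (N <= n)%N ->
      L2 P (X - step_integral W (s n) : {RV P >-> R}) /\
      n2 hP (X - step_integral W (s n) : {RV P >-> R}) < e.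
    move=> e0; have [|N HN] := ecvg0P _ Xs e0.
      by move=> n; exact: expectation_sqr_ge0.
    exists N => n /HN H.
    have L2n : L2 P (X - step_integral W (s n) : {RV P >-> R}).
      by apply: L2_RV; apply: lt_trans H _; rewrite ltry.
    by split => //; rewrite -lte_fin -expectation_n2.
  have L2s n : L2 P (step_integral W (s n)).
    by have [] := dom_span increments_L2 (step_span (Ds n)).
  (* [X] is square integrable because it is at finite distance from a step integral. *)
  have L2X : L2 P X.
    have [N /(_ N (leqnn N))[L2N _]] := EX 1 ltr01.
    have -> : (X : Omega -> R) = ((X - step_integral W (s N) : {RV P >-> R}) : Omega -> R)
        + (step_integral W (s N) : Omega -> R).
      by apply/funext => w; transitivity ((X w - step_integral W (s N) w) +
        step_integral W (s N) w); [rewrite subrK|].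
    exact: (domD (s := hP) L2N (L2s N)).
  split => // e e0.
  have [|N1 H1] := Ef (e / 2); first by rewrite divr_gt0.
  have [|N2 H2] := EX (e / 2); first by rewrite divr_gt0.
  pose N := maxn N1 N2.
  exists (step_fun (s N), step_integral W (s N) : Omega -> R); first exact: step_span.
  rewrite n2_prodE; have := H1 N (leq_maxl _ _).
  have [_] := H2 N (leq_maxr _ _).
  move=> HA HB.
  by apply: lt_le_trans (ltrD HB HA) _; lra.
move=> [[L2f L2X] H]; split; first exact/square_integrableP.
have /choice[s Hs] : forall n : nat, exists s, [/\ step_in D s,
    n2 hR (zero_ext f - step_fun s) < n.+1%:R^-1 &
    n2 hP ((X : Omega -> R) - (step_integral W s : Omega -> R)) < n.+1%:R^-1].
  move=> n; have [|[F Y] /span_step[s Ds [<- <-]]] := H n.+1%:R^-1.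
    by rewrite invr_gt0 ltr0n.
  move=> FX; have {}FX : n2 hR (zero_ext f - step_fun s) +
      n2 hP ((X : Omega -> R) - (step_integral W s : Omega -> R)) < n.+1%:R^-1 := FX.
  exists s; split => //.
    by apply: le_lt_trans FX; rewrite lerDl n2_ge0.
  by apply: le_lt_trans FX; rewrite lerDr n2_ge0.
exists s; split.
- by move=> n; case: (Hs n).
- apply: ecvg0_harmonic => n.
    by apply: integral_ge0 => x _; rewrite lee_fin sqr_ge0.
  have [Ds fs _] := Hs n; rewrite integral_step_dist// L2_sqE ?lte_fin//.
  apply: (domB (h := hR) L2f).
  by have [] := dom_span increments_L2 (step_span Ds).
- apply: ecvg0_harmonic => n; first exact: expectation_sqr_ge0.
  have [Ds _ Xs] := Hs n.
  have L2s : L2 P (step_integral W (s n)).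
    by have [] := dom_span increments_L2 (step_span Ds).
  have D' : L2 P ((X - step_integral W (s n) : {RV P >-> R}) : Omega -> R) :=
    domB (h := hP) L2X L2s.
  by rewrite expectation_n2 ?lte_fin.
Qed.

End wiener.

(** The analogue of [span_image] for a map whose linearity is given by equations; it serves for the
    Lamperti map on pairs. *)
Lemma span_map {R : realType} {U V : lmodType R} (f : U -> V) (A : set U) :
  f 0 = 0 -> (forall c x y, f (c *: x + y) = c *: f x + f y) ->
  forall y, span (f @` A) y -> exists2 x, span A x & y = f x.
Proof.
move=> f0 fl y; elim=> [|c _ z [x Ax <-] _ [t At ->]].
  by exists 0; [exact: span0|].
by exists (c *: x + t); [exact: spanS|].
Qed.

(** * Orthogonal sums of closed spans *)

Section orthogonal_sum.
Context {d : measure_display} {Omega : measurableType d} {R : realType}.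
Variable P : probability Omega R.
Local Notation hP := (L2_inner P).

Lemma RV_ae_n2 (X Y : {RV P >-> R}) : X = Y %[ae P] <->
  n2 hP ((X : Omega -> R) - (Y : Omega -> R)) = 0 /\ L2 P ((X : Omega -> R) - (Y : Omega -> R)).
Proof.
split=> [XY|[XY L2XY]].
  split; first by apply: ae_n2_eq0 => //; exact: RV_measurable.
  have m0 : measurable_fun [set: Omega] (cst 0 : Omega -> R) by exact: measurable_cst.
  apply: (@ae_L2 _ _ _ P (cst 0)); first exact: L2_0.
    by apply: measurable_funB; exact: RV_measurable.
  by apply: filterS XY => w /= H _; rewrite /GRing.add /= /GRing.opp /= H// subrr.
have := n2_eq0_ae L2XY XY; apply: filterS => w /= /(_ I).
by move=> /eqP; rewrite [_ - _]/GRing.add /= /GRing.opp /= subr_eq0 => /eqP.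
Qed.

(** By [cl_setU_orthogonal], orthogonality has to be checked on generators only, and [H] has to be
    the closed span of all generators together. *)
Lemma orthogonal_sum_cl (H A1 A2 : set {RV P >-> R}) :
  (forall X, A1 X -> L2 P X) -> (forall X, A2 X -> L2 P X) ->
  (forall X Y, A1 X -> A2 Y -> dot hP X Y = 0) ->
  (forall Z, H Z <-> cl hP (fns A1 `|` fns A2) Z) ->
  orthogonal_sum H (closed_span A1) (closed_span A2).
Proof.
move=> D1 D2 o12 HE.
have F1 : fns A1 `<=` dom hP by move=> _ [X /D1 ? <-].
have F2 : fns A2 `<=` dom hP by move=> _ [X /D2 ? <-].
have F12 : fns A1 `|` fns A2 `<=` dom hP by move=> ? [/F1|/F2].
have o12' x y : fns A1 x -> fns A2 y -> dot hP x y = 0.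
  by move=> [X AX <-] [Y AY <-]; exact: o12.
split.
  move=> X Y /(closed_spanP _ D1) cX /(closed_spanP _ D2) cY.
  rewrite expectation_dot; [|exact: cl_dom cX|exact: cl_dom cY].
  by rewrite (cl_orthogonal F1 F2 o12' cX cY).
apply/seteqP; split => Z.
  move=> /HE cZ; have [x [y [cx cy xyZ]]] := cl_setU_orthogonal (@L2_complete _ _ _ P) F1 F2 o12' cZ.
  have [mx _] := cl_dom cx; have [my _] := cl_dom cy.
  (* The components come as measurable functions and are turned into random variables. *)
  have [X XE] := mfun_exists P mx; have [Y YE] := mfun_exists P my.
  exists X, Y; split.
  - by apply/closed_spanP => //; rewrite XE.
  - by apply/closed_spanP => //; rewrite YE.
  apply: (proj2 (RV_ae_n2 Z (X + Y))); rewrite -XE -YE in xyZ cx cy; split => //.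
  apply: (domB (h := hP) (cl_dom cZ)).
  exact: (domD (s := hP) (cl_dom cx) (cl_dom cy)).
move=> [X [Y [/(closed_spanP _ D1) cX /(closed_spanP _ D2) cY ZXY]]]; apply/HE.
have cXY : cl hP (fns A1 `|` fns A2) ((X : Omega -> R) + (Y : Omega -> R)).
  by apply: clD => //; [apply: cl_mono cX => ?|apply: cl_mono cY => ?]; [left|right].
have YXZ : (X + Y : {RV P >-> R}) = Z %[ae P] by apply: filterS ZXY => w /= H1 /H1.
have [z0 L2z] := proj1 (RV_ae_n2 (X + Y) Z) YXZ.
apply: (cl_eq0 F12 _ z0 cXY).
have -> : (Z : Omega -> R) = ((X + Y : {RV P >-> R}) : Omega -> R) -
   (((X + Y : {RV P >-> R}) : Omega -> R) - (Z : Omega -> R)) by rewrite subKr.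
exact: (domB (h := hP) (cl_dom cXY) L2z).
Qed.

End orthogonal_sum.

(** * Wiener integrals over a half line *)

Section wiener_line.
Context {d : measure_display} {Omega : measurableType d} {R : realType}.
Variable P : probability Omega R.
Local Notation mu := (@lebesgue_measure R).
Local Notation hR := (L2_inner mu).
Local Notation hP := (L2_inner P).
Local Notation hh := (prod_inner hR hP).
Variables (W B : R -> {RV P >-> R}).
Hypothesis W2 : forall u v, 'E_P[((W u - W v) ^+ 2)%R]%E = `|u - v|%:E.
Hypothesis B_gt0 : forall t, 0 < t ->
      wiener_integral W `]-oo, ln t] (fun r => expR (r / 2)) (B t).

Let W2' (D : set R) u v : D u -> D v -> 'E_P[((W u - W v) ^+ 2)%R]%E = `|u - v|%:E.
Proof. by []. Qed.

(** The closed graph of the Wiener isometry over []-oo, u]]: integrands paired with their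
    integrals. *)
Definition Wpairs u := cl hh (increments `]-oo, u] W).

Lemma incr_L2 (D : set R) : increments D W `<=` dom hh.
Proof. exact: increments_L2. Qed.

Lemma incr_isometric (D : set R) : isometric hR hP (increments D W).
Proof. exact: increments_isometric. Qed.

Lemma Wpairs_isometric u : isometric hR hP (Wpairs u).
Proof. exact: (cl_isometric (@incr_L2 _) (@incr_isometric _)). Qed.

Lemma Wpairs_dom u : Wpairs u `<=` dom hh.
Proof. by move=> q /cl_dom. Qed.

Lemma Wpairs_mono u v : u <= v -> Wpairs u `<=` Wpairs v.
Proof.
move=> uv; apply: cl_mono => _ [[a b] /= [+ + ab] <-]; rewrite !in_itv/= => au bu.
by exists (a, b) => //=; split => //; rewrite in_itv/= (le_trans _ uv).
Qed.

Lemma line_interval u (a b : R) : `]-oo, u]%classic a -> `]-oo, u]%classic b ->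
  `]a, b] `<=` `]-oo, u].
Proof.
rewrite /= !in_itv/= => _ bu x /=; rewrite !in_itv/= => /andP[_ xb].
exact: le_trans bu.
Qed.

Lemma Wpairs_integral u f (X : {RV P >-> R}) :
  wiener_integral W `]-oo, u] f X <-> Wpairs u (zero_ext `]-oo, u] f, X : Omega -> R).
Proof. by apply: wiener_integralP => //; exact: line_interval. Qed.

(** The approximating step functions vanish beyond [u], so [F] vanishes there almost everywhere and
    may be cut off. *)
Lemma Wpairs_zero_ext u F X : Wpairs u (F, X) -> Wpairs u (zero_ext `]-oo, u] F, X).
Proof.
move=> FX; have [[L2F L2X] H] := FX; have [mF _] := L2F.
have mz : measurable_fun [set: R] (zero_ext `]-oo, u] F).
  apply: (measurable_restrictT F _).1 => //; exact: measurable_funTS.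
have lez g x : (forall x, u < x -> g x = 0) ->
    (F x - zero_ext `]-oo, u] F x) ^+ 2 <= (F x - g x) ^+ 2.
  move=> g0; rewrite /zero_ext patchE; case: ifPn; first by rewrite subrr expr0n sqr_ge0.
  by rewrite mem_setE in_itv/= -ltNge => /g0 ->.
have L2z : L2 mu (zero_ext `]-oo, u] F).
  refine (@L2_le_integral _ _ R mu _ F mz L2F _); apply: ge0_le_integral => //.
  - by move=> x _; exact: sqr_EFin_ge0.
  - exact: measurable_EFin_sqr.
  - exact: measurable_EFin_sqr.
  move=> x _; rewrite lee_fin /zero_ext patchE; case: ifPn => // _.
  by rewrite expr0n sqr_ge0.
have L2d : L2 mu (F - zero_ext `]-oo, u] F) := domB (h := hR) L2F L2z.
apply: (cl_eq0 (@incr_L2 _) _ _ FX); first by [].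
have -> : n2 hh ((F, X) - (zero_ext `]-oo, u] F, X)) =
   n2 hR (F - zero_ext `]-oo, u] F) + n2 hP (X - X) by [].
rewrite subrr n2_0 addr0; apply/eqP; rewrite eq_le n2_ge0 andbT.
apply: le_epsilon0 => e /H[[g Y] /span_step[s Ds [sg sY]]].
have gout x : u < x -> g x = 0.
  move=> ux; rewrite -sg; apply: (@step_fun_out _ `]-oo, u]%classic) => //; first exact: line_interval.
  by rewrite /= in_itv/= leNgt ux.
have L2s : L2 mu g by rewrite -sg; have [] := dom_span (@incr_L2 _) (step_span W Ds).
have L2Fg : L2 mu (F - g) := domB (h := hR) L2F L2s.
rewrite n2_prodE => FXg; apply: ltW; apply: le_lt_trans FXg.
apply: (@le_trans _ _ (n2 hR (F - g))); last by rewrite lerDl n2_ge0.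
rewrite -lee_fin -!L2_sqE//; apply: ge0_le_integral => //.
- by move=> x _; exact: sqr_EFin_ge0.
- by apply: measurable_EFin_sqr; case: L2d.
- by apply: measurable_EFin_sqr; case: L2Fg.
by move=> x _; rewrite lee_fin; exact: lez.
Qed.

Lemma wiener_spaceP u (Y : {RV P >-> R}) :
  wiener_space W u Y <-> exists F, Wpairs u (F, Y : Omega -> R).
Proof.
split=> [[f /Wpairs_integral ?]|[F /Wpairs_zero_ext FY]].
  by exists (zero_ext `]-oo, u] f).
by exists F; apply/Wpairs_integral.
Qed.

Lemma Wpairs_cl_exps u q : Wpairs u q -> cl hR (exps u) q.1.
Proof.
move=> /cl_fst; apply: cl_sub; first exact: exps_L2.
move=> _ [_ [[a b] /= [_ + ab] <-] <-] /=; rewrite in_itv/= => bu.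
exact: cl_exps_step.
Qed.

Lemma Wpairs_lift_fst u (S : set ((R -> R) * (Omega -> R))) F :
  S `<=` Wpairs u -> cl hR (fst @` S) F -> exists X, Wpairs u (F, X).
Proof.
move=> SK cF; apply: (lift_fst (@incr_L2 _) (@incr_isometric _) (@L2_complete _ _ _ P)).
apply: cl_sub cF; first exact: (fst_dom (@incr_L2 _)).
by move=> _ [q /SK Kq <-]; exact: (cl_fst (Kq : cl hh _ q)).
Qed.

Lemma Wpairs_lift_snd u (S : set ((R -> R) * (Omega -> R))) X :
  S `<=` Wpairs u -> cl hP (snd @` S) X -> exists F, Wpairs u (F, X).
Proof.
move=> SK cX; apply: (lift_snd (@incr_L2 _) (@incr_isometric _) (@L2_complete _ _ _ mu)).
apply: cl_sub cX; first exact: (snd_dom (@incr_L2 _)).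
by move=> _ [q /SK Kq <-]; exact: (cl_snd (Kq : cl hh _ q)).
Qed.

(** The exponentials are total among the integrands, and on the closed graph an approximation of
    first components is one of pairs ([cl_dense_fst]). *)
Lemma Wpairs_generated u (S : set ((R -> R) * (Omega -> R))) :
  S `<=` Wpairs u -> (forall z, 0 < z -> cl hR (fst @` S) (kexp z u)) ->
  Wpairs u `<=` cl hh S.
Proof.
move=> SK SE q Kq; apply: (cl_dense_fst (@incr_L2 _) (@incr_isometric _) SK Kq).
have SD : S `<=` dom hh by move=> s /SK/Wpairs_dom.
apply: cl_sub (Wpairs_cl_exps Kq); first exact: (fst_dom SD).
by move=> _ [z z0 <-]; exact: SE.
Qed.

(** The passage from functions to random variables: once the integrands of [S] generate the
    exponentials, the integrals of [S] generate the space of [W]. *)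
Lemma Wpairs_sndP u (S : set ((R -> R) * (Omega -> R))) X :
  S `<=` Wpairs u -> (forall z, 0 < z -> cl hR (fst @` S) (kexp z u)) ->
  (exists F, Wpairs u (F, X)) <-> cl hP (snd @` S) X.
Proof.
move=> SK SE; split; last exact: Wpairs_lift_snd.
have SD : S `<=` dom hh by move=> s /SK/Wpairs_dom.
by move=> [F /(Wpairs_generated SK SE)/cl_snd].
Qed.

Definition half_fun (b r : R) : R := expR (r / 2) * \1_(`]-oo, b]) r.

Lemma half_funE b : half_fun b = expR (b / 2) *: kexp 2^-1 b.
Proof.
apply/funext => r; rewrite /half_fun.
transitivity (expR (b / 2) * kexp 2^-1 b r); last by [].
by rewrite /kexp mulrA -expRD; congr (expR _ * _); ring.
Qed.

Lemma zero_ext_indic (D : set R) (f : R -> R) : zero_ext D f = f \* \1_D.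
Proof. exact: patch_indic. Qed.

Lemma Wpairs_B t : 0 < t -> Wpairs (ln t) (half_fun (ln t), B t : Omega -> R).
Proof. by move=> /B_gt0/Wpairs_integral; rewrite zero_ext_indic. Qed.

Definition Bpairs t : set ((R -> R) * (Omega -> R)) :=
  [set (half_fun (ln s), B s : Omega -> R) | s in `]0, t]].

Lemma Bpairs_Wpairs t : Bpairs t `<=` Wpairs (ln t).
Proof.
move=> q [s]; rewrite /= in_itv/= => /andP[s0 st] <-.
apply: (Wpairs_mono _ (Wpairs_B s0)); rewrite ler_ln// posrE//.
exact: lt_le_trans st.
Qed.

(** The integrand of [B s] is a multiple of the kernel of rate 1/2 ending at [ln s], so this is
    [cl_half_exps]: the [B s], [s <= t], generate the space of [W] at time [ln t]. *)
Lemma Bpairs_exps t z : 0 < t -> 0 < z -> cl hR (fst @` Bpairs t) (kexp z (ln t)).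
Proof.
move=> t0 z0.
have SD : fst @` Bpairs t `<=` dom hR.
  by apply: (fst_dom (h2 := hP)) => s /Bpairs_Wpairs Ks; exact: (Wpairs_dom Ks).
apply: cl_sub (cl_half_exps (ln t) z0) => // _ [b + <-].
rewrite /= in_itv/= => bt.
have -> : kexp 2^-1 b = expR (- (b / 2)) *: half_fun b.
  by rewrite half_funE scalerA -expRD addNr expR0 scale1r.
apply: clZ => //; apply: sub_cl => //.
exists (half_fun b, B (expR b) : Omega -> R) => //.
exists (expR b); last by rewrite expRK.
by rewrite /= in_itv/= expR_gt0/= -[leRHS]lnK ?posrE// ler_expR.
Qed.

(** The pairs of the [B s] belong to the closed graph and their integrands approximate [kexp z u];
    completeness then provides its integral. *)
Lemma Wpairs_kexp z u : 0 < z -> exists X, Wpairs u (kexp z u, X).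
Proof.
move=> z0; apply: (@Wpairs_lift_fst u (Bpairs (expR u))).
  by have := @Bpairs_Wpairs (expR u); rewrite expRK.
by have := @Bpairs_exps (expR u) z (expR_gt0 u) z0; rewrite expRK.
Qed.

Lemma Wpairs_eta u (F : R -> R) : cl hR (exps u) F -> exists X, Wpairs u (F, X).
Proof.
move=> cF; apply: (@Wpairs_lift_fst u (Wpairs u)) => //.
have fD : fst @` Wpairs u `<=` dom hR by apply: fst_dom; exact: Wpairs_dom.
apply: cl_sub cF => // _ [z z0 <-]; apply: sub_cl => //.
by have [X KX] := Wpairs_kexp u z0; exists (kexp z u, X).
Qed.

Lemma zero_ext_exp (q u : R) : zero_ext `]-oo, u] (fun r => expR (q * r)) =
  expR (q * u) *: kexp q u.
Proof.
rewrite zero_ext_indic; apply/funext => r.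
transitivity (expR (q * u) * kexp q u r); last by [].
rewrite /kexp mulrA -expRD /=; congr (expR _ * _); ring.
Qed.

End wiener_line.

(** * The exponential time change between B and W *)

Section lamperti.
Context {d : measure_display} {Omega : measurableType d} {R : realType}.
Variable P : probability Omega R.
Local Notation mu := (@lebesgue_measure R).
Local Notation hR := (L2_inner mu).
Local Notation hP := (L2_inner P).
Local Notation hh := (prod_inner hR hP).
Variables (W B : R -> {RV P >-> R}).
Hypothesis W2 : forall u v, 'E_P[((W u - W v) ^+ 2)%R]%E = `|u - v|%:E.
Hypothesis B2 : forall u v, 0 <= u -> 0 <= v ->
  'E_P[((B u - B v) ^+ 2)%R]%E = `|u - v|%:E.
Hypothesis B0 : B 0 = cst 0 %[ae P].
Hypothesis B_gt0 : forall t, 0 < t ->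
      wiener_integral W `]-oo, ln t] (fun r => expR (r / 2)) (B t).

(** The Lamperti map, an isometry from functions on the positive half line to functions on the
    line. *)
Definition lamperti (f : R -> R) (r : R) : R := expR (r / 2) * f (expR r).

Lemma measurable_lamperti (f : R -> R) :
  measurable_fun [set: R] f -> measurable_fun [set: R] (lamperti f).
Proof.
move=> mf; apply: measurable_funM.
  by apply: measurableT_comp => //; exact: measurable_funM.
exact: measurableT_comp.
Qed.

Lemma integral_lamperti (f : R -> R) : measurable_fun [set: R] f ->
  (forall x, x <= 0 -> f x = 0) ->
  (\int[mu]_x (lamperti f x ^+ 2)%:E = \int[mu]_x (f x ^+ 2)%:E)%E.
Proof.
move=> mf f0.
transitivity (\int[mu]_x ((expR x)%:E * (f (expR x) ^+ 2)%:E))%E.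
  apply: eq_integral => x _; rewrite -EFinM /lamperti exprMn; congr (_ * _)%:E.
  by rewrite expr2 -expRD; congr expR; field.
rewrite (@ge0_integral_expR_substitution _ (fun y => (f y ^+ 2)%:E)).
- rewrite integral_mkcond; apply: eq_integral => x _; rewrite patchE mem_setE in_itv/= andbT.
  by have [//|x0] := ltP 0 x; rewrite f0// expr0n.
- exact: measurable_EFin_sqr.
- by move=> x; rewrite lee_fin sqr_ge0.
Qed.

Let B2' t u v : `[0, t]%classic u -> `[0, t]%classic v ->
  'E_P[((B u - B v) ^+ 2)%R]%E = `|u - v|%:E.
Proof. by rewrite /= !in_itv/= => /andP[? _] /andP[? _]; exact: B2. Qed.

Definition Bincr t := cl hh (increments `[0, t] B).

Let incB_L2 t : increments `[0, t] B `<=` dom hh.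
Proof. by apply: increments_L2; exact: B2'. Qed.

Let incB_isometric t : isometric hR hP (increments `[0, t] B).
Proof. by apply: increments_isometric; exact: B2'. Qed.

Lemma Bincr_integral t f (X : {RV P >-> R}) :
  wiener_integral B `[0, t] f X <-> Bincr t (zero_ext `[0, t] f, X : Omega -> R).
Proof.
apply: wiener_integralP => //; first exact: B2'.
move=> a b; rewrite /= !in_itv/= => /andP[a0 _] /andP[_ bt] x /=.
rewrite !in_itv/= => /andP[ax xb]; apply/andP; split.
  by apply: le_trans a0 (ltW ax).
exact: le_trans bt.
Qed.

Let L2_B s : 0 <= s -> L2 P (B s).
Proof.
move=> s0; have L2s : L2 P (B s - B 0 : {RV P >-> R}) by apply: L2_RV; rewrite B2// ltry.
apply: (ae_L2 L2s); first exact: RV_measurable.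
by apply: filterS B0 => w /= H /H E; rewrite /GRing.add /= /GRing.opp /= E subr0.
Qed.

Let B_B0 s : 0 <= s -> n2 hP ((B s - B 0 : {RV P >-> R}) - (B s : Omega -> R)) = 0.
Proof.
move=> s0; apply: ae_n2_eq0; [exact: RV_measurable|exact: RV_measurable|].
by apply: filterS B0 => w /= H /H E; rewrite /GRing.add /= /GRing.opp /= E subr0.
Qed.

(** Since [B 0] vanishes almost surely, [B s] may take the place of its increment from 0. *)
Let Bincr_step t s : 0 <= s -> s <= t -> Bincr t (\1_`]0, s], B s : Omega -> R).
Proof.
move=> s0 st; have t0 : 0 <= t by exact: le_trans st.
have H : Bincr t (\1_`]0, s], (B s - B 0 : {RV P >-> R}) : Omega -> R).
  apply: sub_cl; first exact: incB_L2.
  by exists (0, s) => //=; rewrite !in_itv/= s0 st lexx t0.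
apply: (cl_eq0 (@incB_L2 t) _ _ H).
  by split; [exact: L2_indic_oc|exact: L2_B].
rewrite n2_prodE (_ : (_ - _).1 = 0); last by rewrite /= subrr.
by rewrite n2_0 add0r; exact: B_B0.
Qed.

(** The Lamperti map sends the indicator of []0, s]] to the integrand of [B s] with respect to [W].
    Hence combinations of [Bpairs] that approximate [(lamperti f, X)] come from combinations of
    increments of [B] that approximate [(f, X)] equally well. *)
Lemma Bincr_of_Wpairs t (f : R -> R) X : 0 < t -> measurable_fun [set: R] f ->
  (forall x, x <= 0 -> f x = 0) -> Wpairs W (ln t) (lamperti f, X) ->
  Bincr t (f, X).
Proof.
move=> t0 mf f0 K.
have [[L2l L2X] _] := K.
have L2f : L2 mu f.
  by split=> //; rewrite -integral_lamperti//; case: L2l.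
pose S := [set (\1_`]0, s], B s : Omega -> R) | s in `]0, t]] : set ((R -> R) * (Omega -> R)).
have SB : S `<=` Bincr t.
  by move=> q [s]; rewrite /= in_itv/= => /andP[s0 st] <-; apply: Bincr_step => //; exact: ltW.
pose Psi (q : (R -> R) * (Omega -> R)) := (lamperti q.1, q.2).
have PsiS : Bpairs B t = Psi @` S.
  apply/seteqP; split => [_ [s st <-]|_ [_ [s st <-] <-]].
    exists (\1_`]0, s], B s : Omega -> R); first by exists s.
    move: st; rewrite /= in_itv/= => /andP[s0 _].
    rewrite /Psi /=; congr (_, _); apply/funext => r; rewrite /lamperti /half_fun.
    rewrite !indicE !mem_setE !in_itv/= expR_gt0/=.
    by rewrite -[in LHS](lnK s0) ler_expR.
  exists s => //; move: st; rewrite /= in_itv/= => /andP[s0 _].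
  rewrite /Psi /=; congr (_, _); apply/funext => r; rewrite /lamperti /half_fun.
  rewrite !indicE !mem_setE !in_itv/= expR_gt0/=.
  by rewrite -[in RHS](lnK s0) ler_expR.
have KS : cl hh (Bpairs B t) (lamperti f, X).
  apply: (Wpairs_generated W2) K; first exact: Bpairs_Wpairs.
  by move=> z z0; exact: Bpairs_exps.
have SD : S `<=` dom hh by move=> q /SB/cl_dom.
apply: (cl_closed (@incB_L2 t)); first by split.
move=> e e0; have [_ /(_ e e0)[q + qe]] := KS.
rewrite PsiS => /(span_map _ _)[||[g Y] sgY qE].
- by rewrite /Psi; congr (_, _); apply/funext => r; rewrite /lamperti/= mulr0.
- move=> c x y; rewrite /Psi /=; congr (_, _); apply/funext => r.
  transitivity (expR (r / 2) * (c * x.1 (expR r) + y.1 (expR r))); first by [].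
  transitivity (c * (expR (r / 2) * x.1 (expR r)) + expR (r / 2) * y.1 (expR r)).
    ring.
  by [].
have [L2g L2Y] := dom_span SD sgY.
have g0 x : x <= 0 -> g x = 0.
  move=> x0; suff : (g, Y).1 x = 0 by [].
  elim: sgY => [|c _ y [s _ <-] _ IH] //.
  transitivity (c * \1_`]0, s] x + y.1 x); first by [].
  by rewrite IH addr0 indicE mem_setE in_itv/= ltNge x0 mulr0.
exists (g, Y); first exact: (span_cl_sub (@incB_L2 t) SB sgY).
apply: le_lt_trans qe; rewrite qE.
have mg : measurable_fun [set: R] g by case: L2g.
have mfg : measurable_fun [set: R] (f - g) by exact: measurable_funB.
have fg0 x : x <= 0 -> (f - g) x = 0.
  by move=> x0; transitivity (f x - g x); rewrite // f0// g0// subrr.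
suff E : n2 hR (f - g) = n2 hR (lamperti f - lamperti g).
  by rewrite le_eqVlt; apply/orP; left; apply/eqP; congr (_ + _).
have -> : lamperti f - lamperti g = lamperti (f - g).
  apply/funext => r; transitivity (expR (r / 2) * f (expR r) - expR (r / 2) * g (expR r)); first by [].
  by rewrite -mulrBr.
rewrite /n2 /= /ip; congr fine; apply/esym; exact: (integral_lamperti mfg fg0).
Qed.

Lemma Bincr_integral_of_W (t : R) (f : R -> R) (X : {RV P >-> R}) : 0 < t ->
  measurable_fun `[0, t] f ->
  wiener_integral W `]-oo, ln t] (fun r => expR (r / 2) * f (expR r)) X ->
  wiener_integral B `[0, t] f X.
Proof.
move=> t0 mf /(Wpairs_integral W2) K; apply/Bincr_integral.
(* The point 0 is removed because the Lamperti map sees positive arguments only; this changes [f] on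
   a null set. *)
pose f1 := f \_ `]0, t].
have mf1 : measurable_fun [set: R] f1.
  apply: (measurable_restrictT f _).1 => //; apply: measurable_funS mf => //.
  by apply: subset_itvr; rewrite bnd_simp.
have f10 x : x <= 0 -> f1 x = 0.
  by move=> x0; rewrite /f1 patchE mem_setE in_itv/= ltNge x0.
have lE : lamperti f1 = zero_ext `]-oo, ln t] (fun r => expR (r / 2) * f (expR r)).
  apply/funext => r; rewrite /lamperti /zero_ext /f1 !patchE !mem_setE !in_itv/= expR_gt0/=.
  have -> : (expR r <= t) = (r <= ln t) by rewrite -[RHS]ler_expR lnK.
  by case: ifP => // _; rewrite mulr0.
have KB : Bincr t (f1, X : Omega -> R).
  by apply: Bincr_of_Wpairs => //; rewrite lE.
have mz : measurable_fun [set: R] (zero_ext `[0, t] f).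
  exact: (measurable_restrictT f _).1.
have fae : f1 = zero_ext `[0, t] f %[ae mu].
  have := ae_neq (0 : R); apply: (@filterS _ _ (ae_filter_ringOfSetsType mu)) => x x0 _.
  rewrite /f1 /zero_ext !patchE !mem_setE !in_itv/=.
  by rewrite [0 <= x]le_eqVlt [0 == x]eq_sym (negbTE x0).
have [[L2f1 L2X] _] := KB.
apply: (cl_eq0 (@incB_L2 t) _ _ KB).
  by split => //; exact: (@ae_L2 _ _ R mu f1 _ L2f1 mz fae).
rewrite n2_prodE (_ : (_ - _).2 = 0); last by rewrite /= subrr.
rewrite n2_0 addr0; exact: (@ae_n2_eq0 _ _ R mu f1 _ mf1 mz fae).
Qed.

Lemma Bincr_integral_unique (t : R) f (X Y : {RV P >-> R}) :
  wiener_integral B `[0, t] f X -> wiener_integral B `[0, t] f Y ->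
  n2 hP ((X : Omega -> R) - (Y : Omega -> R)) = 0.
Proof.
move=> /Bincr_integral KX /Bincr_integral KY.
have := clB (@incB_L2 t) KX KY => /(cl_n2 (@incB_L2 t) (@incB_isometric t)).
by rewrite (_ : (_ - _).1 = 0) ?n2_0 => [<-//|]; rewrite /= subrr.
Qed.

(** Some integral [Y] with respect to [W] is also an integral with respect to [B], where integrals
    are unique almost surely; so [X] and [Y] agree. *)
Lemma W_integral_of_B (t : R) (f : R -> R) (X Y : {RV P >-> R}) : 0 < t ->
  measurable_fun `[0, t] f -> wiener_integral B `[0, t] f X ->
  wiener_integral W `]-oo, ln t] (fun r => expR (r / 2) * f (expR r)) Y ->
  wiener_integral W `]-oo, ln t] (fun r => expR (r / 2) * f (expR r)) X.
Proof.
move=> t0 mf BX WY; have BY := Bincr_integral_of_W t0 mf WY.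
have XY := Bincr_integral_unique BX BY.
move/(Wpairs_integral W2) : WY => KY; apply/(Wpairs_integral W2).
have [[L2F L2Y] _] := KY.
have /Bincr_integral[[_ L2X] _] := BX.
apply: (cl_eq0 (@incr_L2 _ _ _ P W W2 _) _ _ KY); first by split.
rewrite n2_prodE (_ : (_ - _).1 = 0); last by rewrite /= subrr.
by rewrite n2_0 add0r n2_distC.
Qed.

Lemma snd_Bpairs t : snd @` Bpairs B t = [set (B s : Omega -> R) | s in `]0, t]].
Proof.
apply/seteqP; split => [_ [_ [s st <-] <-]|_ [s st <-]]; first by exists s.
by exists (half_fun (ln s), B s : Omega -> R) => //; exists s.
Qed.

Let fnsB_L2 t : fns (B @` `[0, t]) `<=` dom hP.
Proof.
by move=> _ [_ [s + <-] <-]; rewrite /= in_itv/= => /andP[s0 _]; exact: L2_B.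
Qed.

(** The space of [B] up to time [t] is the space of integrals with respect to [W] up to [ln t]. The
    time 0, which has no logarithm, adds only the null variable [B 0]. *)
Lemma cl_fnsB t X : 0 < t -> cl hP (fns (B @` `[0, t])) X <-> exists F, Wpairs W (ln t) (F, X).
Proof.
move=> t0; have sE := @Wpairs_sndP _ _ _ P W W2 (ln t) (Bpairs B t) X
  (@Bpairs_Wpairs _ _ _ P W B W2 B_gt0 t) (fun z z0 => Bpairs_exps W2 B_gt0 t0 z0).
split => [cX|/sE]; last first.
  rewrite snd_Bpairs; apply: cl_mono => _ [s st <-].
  exists (B s) => //; exists s => //.
  by move: st; rewrite /= !in_itv/= => /andP[/ltW -> ->].
apply/sE; rewrite snd_Bpairs; apply: cl_sub cX.
  by move=> _ [s + <-]; rewrite /= in_itv/= => /andP[/ltW s0 _]; exact: L2_B.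
move=> _ [_ [s + <-] <-]; rewrite /= in_itv/= => /andP[s0 st].
have SD : [set (B s : Omega -> R) | s in `]0, t]] `<=` dom hP.
  by move=> _ [s' + <-]; rewrite /= in_itv/= => /andP[/ltW s'0 _]; exact: L2_B.
move: s0; rewrite le_eqVlt => /orP[/eqP <-|s0]; last first.
  by apply: sub_cl => //; exists s => //; rewrite /= in_itv/= s0.
apply: (@cl_eq0 _ _ hP _ 0 _ SD); first exact: (L2_B (lexx 0)).
  apply: ae_n2_eq0; [exact: measurable_cst|exact: RV_measurable|].
  by apply: filterS B0 => w /= H /H ->.
by apply: span_cl => //; exact: span0.
Qed.

Lemma Bincr_Wpairs t f X : 0 < t -> Bincr t (f, X) -> exists F, Wpairs W (ln t) (F, X).
Proof.
move=> t0 /cl_snd/= cX; apply/(cl_fnsB _ t0); apply: cl_sub cX; first exact: fnsB_L2.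
move=> _ [_ [[a b] /= [+ + _] <-] <-] /=; rewrite !in_itv/= => /andP[a0 at_] /andP[b0 bt].
apply: (clB (x := (B b : Omega -> R)) (y := (B a : Omega -> R))) => //.
  by apply: sub_cl => //; exists (B b) => //; exists b; rewrite //= in_itv/= b0.
by apply: sub_cl => //; exists (B a) => //; exists a; rewrite //= in_itv/= a0.
Qed.

End lamperti.

(** * Laws determined by expectations of cosines *)

Section bounded_expectation.
Context {d : measure_display} {Omega : measurableType d} {R : realType}.
Variable P : probability Omega R.
Implicit Types f g : Omega -> R.

Definition mean f : R := fine (\int[P]_w (f w)%:E).

Definition bmfun f := measurable_fun [set: Omega] f /\ exists M : R, forall w, `|f w| <= M.

Lemma integrable_cstP (M : R) : P.-integrable [set: Omega] (fun=> M%:E).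
Proof.
apply/integrableP; split; first exact: measurable_cst.
by rewrite integral_cst//= probability_setT mule1 ltry.
Qed.

Lemma bmfun_integrable f : bmfun f -> P.-integrable [set: Omega] (fun w => (f w)%:E).
Proof.
move=> [mf [M fM]]; apply: (le_integrable measurableT _ _ (integrable_cstP M)).
  exact/measurable_EFinP.
by move=> w _; rewrite lee_fin (le_trans (fM w))// ler_norm.
Qed.

Lemma mean_EFin f : bmfun f -> (\int[P]_w (f w)%:E)%E = (mean f)%:E.
Proof. by move=> bf; rewrite fineK//; apply: integrable_fin_num => //; exact: bmfun_integrable. Qed.

Lemma bmfunD f g : bmfun f -> bmfun g -> bmfun (fun w => f w + g w).
Proof.
move=> [mf [M fM]] [mg [N gN]]; split; first exact: measurable_funD.
by exists (M + N) => w; apply: le_trans (ler_normD _ _) _; exact: lerD.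
Qed.

Lemma bmfunM f g : bmfun f -> bmfun g -> bmfun (fun w => f w * g w).
Proof.
move=> [mf [M fM]] [mg [N gN]]; split; first exact: measurable_funM.
by exists (M * N) => w; rewrite normrM; apply: ler_pM.
Qed.

Lemma bmfun_cst (c : R) : bmfun (fun=> c).
Proof. by split; [exact: measurable_cst|exists `|c|]. Qed.

Lemma bmfun_indic (A : set Omega) : measurable A -> bmfun (fun w => \1_A w).
Proof.
move=> mA; split; first exact: measurable_indic.
by exists 1 => w; rewrite indicE; case: (_ \in _); rewrite ?normr1 ?normr0.
Qed.

Lemma meanD f g : bmfun f -> bmfun g -> mean (fun w => f w + g w) = mean f + mean g.
Proof.
move=> bf bg; rewrite /mean; under eq_integral do rewrite EFinD.
rewrite integralD//; try exact: bmfun_integrable.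
by rewrite !mean_EFin.
Qed.

Lemma meanZ (c : R) f : bmfun f -> mean (fun w => c * f w) = c * mean f.
Proof.
move=> bf; rewrite /mean; under eq_integral do rewrite EFinM.
rewrite integralZl//; last exact: bmfun_integrable.
by rewrite mean_EFin.
Qed.

Lemma mean_indic (A : set Omega) : measurable A -> mean (fun w => \1_A w) = fine (P A).
Proof. by move=> mA; rewrite /mean integral_indic// setIT. Qed.

Lemma mean_cvg (f : nat -> Omega -> R) g (M : R) :
  (forall n, measurable_fun [set: Omega] (f n)) ->
  (forall n w, `|f n w| <= M) -> (forall w, f n w @[n --> \oo] --> g w) ->
  mean (f n) @[n --> \oo] --> mean g.
Proof.
move=> mf fM fg.
have mg : measurable_fun [set: Omega] g.
  by apply: (measurable_fun_cvg mf) => w _; exact: fg.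
have bf n : bmfun (f n) by split => //; exists M.
have mfE n : measurable_fun setT (fun w => (f n w)%:E) by exact/measurable_EFinP.
have mgE : measurable_fun setT (fun w => (g w)%:E) by exact/measurable_EFinP.
have cE : \forall w \ae P, [set: Omega] w -> (f n w)%:E @[n --> \oo] --> (g w)%:E.
  by apply: nearW => w _; apply: cvg_EFin; [near=> n|exact: fg].
have bE : \forall w \ae P, forall n, [set: Omega] w -> (`|(f n w)%:E| <= M%:E)%E.
  by apply: nearW => w n _; rewrite lee_fin.
have [_ _] := dominated_convergence measurableT mfE mgE cE (integrable_cstP M) bE.
have bg : bmfun g.
  split => //; exists M => w.
  rewrite -(cvg_lim (@Rhausdorff _) (cvg_norm (fg w))).
  by apply: limr_le; [apply: cvgP (cvg_norm (fg w))|near=> n].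
rewrite mean_EFin//; under eq_fun => n do rewrite mean_EFin//.
by move=> /fine_cvg.
Unshelve. all: by end_near. Qed.

End bounded_expectation.

Section law.
Context {d : measure_display} {Omega : measurableType d} {R : realType}.
Variable P : probability Omega R.
Variables (X Y Z T : Omega -> R).
Hypotheses (mX : measurable_fun [set: Omega] X) (mY : measurable_fun [set: Omega] Y).
Hypotheses (bZ : bmfun Z) (bT : bmfun T).
Local Notation E := (mean P).

Hypothesis cosE : forall c phi,
  E (fun w => cos (c * X w + phi) * Z w) = E (fun w => cos (c * Y w + phi) * T w).

(** The test functions for which the identity holds. Stable under linear combinations and bounded
    pointwise limits, the class grows from cosines to polynomials in a cosine, to the sign of a
    sine, to rays. The weights [Z] and [T] allow one coordinate to be treated at a time. *)
Let good (g : R -> R) := bmfun g /\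
  E (fun w => g (X w) * Z w) = E (fun w => g (Y w) * T w).

Let bX (g : R -> R) : bmfun g -> bmfun (fun w => g (X w)).
Proof.
by move=> [mg [M gM]]; split; [exact: measurableT_comp mg mX|exists M].
Qed.

Let bY (g : R -> R) : bmfun g -> bmfun (fun w => g (Y w)).
Proof.
by move=> [mg [M gM]]; split; [exact: measurableT_comp mg mY|exists M].
Qed.

Let good_lin (c : R) g1 g2 : good g1 -> good g2 -> good (fun x => c * g1 x + g2 x).
Proof.
move=> [b1 E1] [b2 E2]; split.
  by apply: bmfunD => //; apply: bmfunM => //; exact: bmfun_cst.
have H (U V : Omega -> R) : bmfun V -> (forall g : R -> R, bmfun g -> bmfun (fun w => g (U w))) ->
    E (fun w => (c * g1 (U w) + g2 (U w)) * V w) =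
    c * E (fun w => g1 (U w) * V w) + E (fun w => g2 (U w) * V w).
  move=> bV bU; rewrite -meanZ; last by apply: bmfunM => //; exact: bU.
  rewrite -meanD; last 2 first.
  - by apply: bmfunM; [exact: bmfun_cst|apply: bmfunM => //; exact: bU].
  - by apply: bmfunM => //; exact: bU.
  by congr (E _); apply/funext => w; ring.
by rewrite (H X Z)// (H Y T)// E1 E2.
Qed.

Let good_ext g1 g2 : (forall x, g1 x = g2 x) -> good g1 -> good g2.
Proof. by move=> /funext ->. Qed.

Let good_cvg (g_ : nat -> R -> R) g M : (forall n, good (g_ n)) ->
  (forall n x, `|g_ n x| <= M) -> (forall x, g_ n x @[n --> \oo] --> g x) -> good g.
Proof.
move=> gg gM gc; have mg : measurable_fun [set: R] g.
  by apply: (@measurable_fun_cvg _ _ _ _ g_) => [n|x _]; [case: (gg n) => [[]]|exact: gc].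
have bg : bmfun g.
  split => //; exists M => x.
  rewrite -(cvg_lim (@Rhausdorff _) (cvg_norm (gc x))).
  by apply: limr_le; [apply: cvgP (cvg_norm (gc x))|apply: nearW => n].
split => //.
have H (U V : Omega -> R) : bmfun V -> (forall h : R -> R, bmfun h -> bmfun (fun w => h (U w))) ->
    E (fun w => g_ n (U w) * V w) @[n --> \oo] --> E (fun w => g (U w) * V w).
  move=> [mV [N VN]] bU; apply: (@mean_cvg _ _ _ _ _ _ (M * N)).
  - move=> n; apply: measurable_funM => //.
    by have [] := bU _ (gg n).1.
  - by move=> n w; rewrite normrM; apply: ler_pM.
  - by move=> w; apply: cvgMl; exact: gc.
have hX := H X Z bZ bX; have hY := H Y T bT bY.
apply: (cvg_unique _ hX) => //.
suff -> : (fun n => E (fun w => g_ n (X w) * Z w)) = (fun n => E (fun w => g_ n (Y w) * T w)).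
  exact: hY.
by apply/funext => n; case: (gg n).
Qed.

Let bcos c phi : bmfun (fun x : R => cos (c * x + phi)).
Proof.
split; last by exists 1 => x; rewrite ler_norml cos_geN1 cos_le1.
apply: measurableT_comp; last by apply: measurable_funD => //; exact: measurable_funM.
by apply: continuous_measurable_fun; exact: continuous_cos.
Qed.

Let good_cos c phi : good (fun x => cos (c * x + phi)).
Proof. by split; [exact: bcos|exact: cosE]. Qed.

Let cosM (a b : R) : cos a * cos b = 2^-1 * cos (b + a) + 2^-1 * cos (b - a).
Proof. by rewrite cosD cosB; field. Qed.

(** A product of cosines is a half sum of two cosines, whence the induction with [c] and [phi]
    free. *)
Let good_cosX m t th : forall c phi,
  good (fun x => cos (t * x + th) ^+ m * cos (c * x + phi)).
Proof.
elim: m => [|m IH] c phi.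
  by apply: good_ext (good_cos c phi) => x; rewrite expr0 mul1r.
have z : good (fun=> 0).
  by apply: good_ext (good_lin (-1) (good_cos 0 0) (good_cos 0 0)) => x; ring.
apply: good_ext (good_lin (2^-1) (IH (c + t) (phi + th))
  (good_lin (2^-1) (IH (c - t) (phi - th)) z)) => x.
have -> : (c + t) * x + (phi + th) = (c * x + phi) + (t * x + th) by ring.
have -> : (c - t) * x + (phi - th) = (c * x + phi) - (t * x + th) by ring.
rewrite exprSr -[RHS]mulrA cosM; ring.
Qed.

Let good_poly (q : {poly R}) t th : good (fun x => q.[cos (t * x + th)]).
Proof.
have z : good (fun=> 0).
  by apply: good_ext (good_lin (-1) (good_cos 0 0) (good_cos 0 0)) => x; ring.
suff H n : good (fun x => \sum_(i < n) q`_i * cos (t * x + th) ^+ i).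
  by apply: good_ext (H (size q)) => x; rewrite horner_coef.
elim: n => [|n IH]; first by apply: good_ext z => x; rewrite big_ord0.
apply: good_ext (good_lin q`_n (good_cosX n t th 0 0) IH) => x.
by rewrite big_ord_recr/= mul0r addr0 cos0 mulr1 addrC.
Qed.

(** On [-1, 1] these polynomials tend to the indicator of s > 0. With y = (1 - s) / 2, the outer
    exponent times y^(n n) is (2 y)^(n n) 2^n: it tends to 0 if 2 y < 1 and to infinity if 2 y >= 1,
    the factor 2^n settling the case s = 0. *)
Let q_ n : {poly R} := (1 - (2^-1 *: (1 - 'X)) ^+ (n * n)) ^+ (2 ^ (n * n + n)).

Let qE n s : (q_ n).[s] = (1 - ((1 - s) / 2) ^+ (n * n)) ^+ (2 ^ (n * n + n)).
Proof. by rewrite /q_ !(horner_exp, hornerE); congr ((1 - _ ^+ _) ^+ _); rewrite mulrC. Qed.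

Let half_cvg : (2^-1 : R) ^+ n @[n --> \oo] --> 0.
Proof. by apply: cvg_expr; rewrite ger0_norm ?invr_ge0// invf_lt1// ltr1n. Qed.

Let q_cvg s : -1 <= s <= 1 -> (q_ n).[s] @[n --> \oo] --> ((0 < s)%R%:R : R).
Proof.
move=> /andP[s1 s2]; under eq_fun do rewrite qE.
set y := (1 - s) / 2.
have y01 : 0 <= y <= 1 by rewrite /y; lra.
have t01 k : 0 <= y ^+ k <= 1.
  by case/andP: y01 => y0 y1; rewrite exprn_ge0//= exprn_ile1.
have tm n : y ^+ (n * n) *+ (2 ^ (n * n + n)) = (2 * y) ^+ (n * n) * 2 ^+ n.
  by rewrite -mulr_natl natrX exprD [in RHS]exprMn mulrAC.
have p0 n m : 0 <= (1 - y ^+ n) ^+ m by rewrite exprn_ge0// subr_ge0; case/andP: (t01 n).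
have [sp|sn] := ltP 0 s.
  have y2 : 2 * y < 1 by rewrite /y; lra.
  have y20 : 0 <= 2 * y by case/andP: y01 => ? _; lra.
  have qc : (2 * y) ^+ n @[n --> \oo] --> 0 by apply: cvg_expr; rewrite ger0_norm.
  apply: (@squeeze_cvgr _ _ _ _ (fun n => 1 - 2^-1 ^+ n) (cst 1)).
  - near=> n.
    have qn : (2 * y) ^+ n <= 4^-1.
      by near: n; apply: (cvgr_le _ qc); rewrite invr_gt0.
    apply/andP; split; last first.
      by rewrite exprn_ile1// ?subr_ge0 ?gerBl; case/andP: (t01 (n * n)%N).
    apply: le_trans (bernoulli_lower (2 ^ (n * n + n)) (t01 (n * n)%N)).
    rewrite lerD2l lerN2 tm exprM -exprMn; apply: lerXn2r; rewrite ?nnegrE ?invr_ge0//.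
      by rewrite mulr_ge0// exprn_ge0.
    by lra.
  - rewrite -[X in _ --> X]subr0; apply: cvgB; [exact: cvg_cst|exact: half_cvg].
  - exact: cvg_cst.
apply: (@squeeze_cvgr _ _ _ _ (cst 0) (fun n => 2^-1 ^+ n)).
- near=> n; rewrite p0/=.
  have := bernoulli_upper (2 ^ (n * n + n)) (t01 (n * n)%N); rewrite tm.
  have : 1 <= (2 * y) ^+ (n * n) by rewrite exprn_ege1// /y; lra.
  have p2 : (0 : R) < 2 ^+ n by rewrite exprn_gt0.
  have := p0 (n * n)%N (2 ^ (n * n + n))%N; set A := (1 - _) ^+ _; set C := (2 * y) ^+ _.
  move=> A0 C1 AC; rewrite exprVn -[leRHS]mul1r ler_pdivlMr//; nra.
- exact: cvg_cst.
- exact: half_cvg.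
Unshelve. all: by end_near. Qed.

Let good_sign t a : good (fun x => (0 < sin (t * (x - a)))%R%:R).
Proof.
have cE x : cos (t * x + (- (t * a) - pi / 2)) = sin (t * (x - a)).
  have -> : t * x + (- (t * a) - pi / 2) = t * (x - a) - pi / 2 by ring.
  by rewrite cosB cos_pihalf sin_pihalf mulr0 mulr1 add0r.
apply: (@good_cvg (fun n x => (q_ n).[cos (t * x + (- (t * a) - pi / 2))]) _ 1).
- by move=> n; exact: good_poly.
- move=> n x; rewrite qE cE.
  have := sin_geN1 (t * (x - a)); have := sin_le1 (t * (x - a)).
  set s := sin _ => s1 s2; have y01 : 0 <= (1 - s) / 2 <= 1 by lra.
  case/andP: y01 => y0 y1.
  have y2 : 0 <= ((1 - s) / 2) ^+ (n * n) <= 1 by rewrite exprn_ge0//= exprn_ile1.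
  case/andP: y2 => y2 y3.
  by rewrite normrX exprn_ile1// ger0_norm ?subr_ge0// gerBl.
- by move=> x; rewrite -cE; apply: q_cvg; rewrite cos_geN1 cos_le1.
Qed.

(** For fixed [x] and small positive [t], [t * (x - a)] lies between - pi and pi, where the sine has
    the sign of its argument. *)
Let good_ray a : good (fun x => (a < x)%R%:R).
Proof.
apply: (@good_cvg (fun n x => (0 < sin (n.+1%:R^-1 * (x - a)))%R%:R) _ 1).
- by move=> n; exact: good_sign.
- by move=> n x; case: (0 < _); rewrite ?normr1 ?normr0.
move=> x; apply: cvg_near_cst.
have c0 : n.+1%:R^-1 * `|x - a| @[n --> \oo] --> 0.
  by rewrite -(mul0r `|x - a|); apply: cvgMl; exact: invS_cvg0.
near=> n.
have small : n.+1%:R^-1 * `|x - a| < pi.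
  by near: n; apply: (cvgr_lt _ c0); exact: pi_gt0.
have n0 : (0 : R) < n.+1%:R^-1 by rewrite invr_gt0 ltr0n.
have [ax|xa] := ltP a x.
  have xa0 : 0 < x - a by rewrite subr_gt0.
  move: small; rewrite gtr0_norm// => small.
  by rewrite sin_gt0_pi// mulr_gt0.
have xa0 : 0 <= a - x by rewrite subr_ge0.
move: small; rewrite distrC ger0_norm// => small.
rewrite -opprB mulrN sinN oppr_gt0 ltNge sin_ge0_pi ?(ltW small) ?andbT//.
by rewrite mulr_ge0// ltW.
Unshelve. all: by end_near. Qed.

(** The good sets form a lambda system, and the rays, stable under intersection, generate the Borel
    sets. *)
Lemma law_indic A : measurable A ->
  E (fun w => \1_A (X w) * Z w) = E (fun w => \1_A (Y w) * T w).
Proof.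
pose H := [set A : set R | measurable A /\ good (fun x => \1_A x)].
suff HA : <<s @RGenOInfty.G R>> `<=` H.
  move=> mA; have : (@ocitv R).-sigma.-measurable A by exact: mA.
  by rewrite RGenOInfty.measurableE => /HA[_ []].
apply: lambda_system_subset => //.
- move=> _ _ [x ->] [y ->]; exists (Num.max x y).
  by apply/seteqP; split => z /=; rewrite !in_itv/= !andbT gt_max; [move=> [-> ->]|move=> /andP[]].
- split => //.
  + by split => //; apply: good_ext (good_cos 0 0) => x; rewrite mul0r add0r cos0 indicT.
  + move=> U V VU [mU gU] [mV gV]; split; first exact: measurableD.
    apply: good_ext (good_lin (-1) gV gU) => x.
    rewrite !indicE in_setD; case: (boolP (x \in V)) => [xV|xV].
      by rewrite (mem_set (VU _ (set_mem xV)))/= mulr1 addNr.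
    by rewrite /= andbT mulr0 add0r.
  + move=> F ndF FH; have mF : measurable (\bigcup_i F i).
      by apply: bigcup_measurable => i _; case: (FH i).
    split => //; apply: (@good_cvg (fun n x => \1_(F n) x) _ 1).
    * by move=> n; case: (FH n).
    * by move=> n x; rewrite indicE; case: (_ \in _); rewrite ?normr1 ?normr0.
    move=> x; apply: cvg_near_cst; have [[i _ Fix]|nF] := pselect ((\bigcup_i F i) x).
      near=> n; have Fin : F i `<=` F n by apply/subsetPset; apply: ndF; near: n; exists i.
      have UF : (\bigcup_i F i) x by exists i.
      by rewrite !indicE (mem_set UF) (mem_set (Fin _ Fix)).
    apply: nearW => n; rewrite !indicE !memNset// => Fx; apply: nF; exists n => //.
- move=> _ [x ->]; split => //; apply: good_ext (good_ray x) => y.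
  by rewrite indicE mem_setE in_itv/= andbT.
Unshelve. all: by end_near. Qed.

End law.

(** * Joint laws from cosines of linear combinations *)

Section joint_law.
Context {d : measure_display} {Omega : measurableType d} {R : realType}.
Variable P : probability Omega R.
Variables (n : nat) (X Y : nat -> Omega -> R).
Hypotheses (mX : forall i, measurable_fun [set: Omega] (X i))
           (mY : forall i, measurable_fun [set: Omega] (Y i)).
Hypothesis XY : forall (c : nat -> R) phi,
  mean P (fun w => cos (\sum_(0 <= i < n) c i * X i w + phi)) =
  mean P (fun w => cos (\sum_(0 <= i < n) c i * Y i w + phi)).
Variable A : nat -> set R.
Hypothesis mA : forall i, measurable (A i).

Let pr (U : nat -> Omega -> R) k w : R := \prod_(i < k) \1_(A i) (U i w).

Let li (U : nat -> Omega -> R) k (c : nat -> R) w : R := \sum_(k <= i < n) c i * U i w.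

Let bm_pr (U : nat -> Omega -> R) k : (forall i, measurable_fun [set: Omega] (U i)) -> bmfun (pr U k).
Proof.
move=> mU; elim: k => [|k IH].
  have -> : pr U 0 = fun=> 1 by apply/funext => w; rewrite /pr big_ord0.
  exact: bmfun_cst.
have -> : pr U k.+1 = fun w => pr U k w * \1_(A k) (U k w).
  by apply/funext => w; rewrite /pr big_ord_recr.
apply: bmfunM => //; split.
  by apply: measurableT_comp => //; exact: measurable_indic.
by exists 1 => w; rewrite indicE; case: (_ \in _); rewrite ?normr1 ?normr0.
Qed.

Let bm_cos (f : Omega -> R) : measurable_fun [set: Omega] f -> bmfun (fun w => cos (f w)).
Proof.
move=> mf; split; last by exists 1 => x; rewrite ler_norml cos_geN1 cos_le1.
apply: measurableT_comp => //.
by apply: continuous_measurable_fun; exact: continuous_cos.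
Qed.

Let m_li (U : nat -> Omega -> R) k c : (forall i, measurable_fun [set: Omega] (U i)) ->
  measurable_fun [set: Omega] (li U k c).
Proof.
by move=> mU; apply: measurable_sum => i; apply: measurable_funM.
Qed.

Let bm_cosli (U : nat -> Omega -> R) k c phi : (forall i, measurable_fun [set: Omega] (U i)) ->
  bmfun (fun w => cos (li U k c w + phi)).
Proof. by move=> mU; apply: bm_cos; apply: measurable_funD => //; exact: m_li. Qed.

Let li_split (U : nat -> Omega -> R) k (c : nat -> R) c0 w : (k < n)%N ->
  c0 * U k w + li U k.+1 c w = li U k (fun i => if i == k then c0 else c i) w.
Proof.
move=> kn; rewrite /li [RHS]big_ltn// eqxx; congr (_ + _).
by apply: eq_big_nat => i /andP[ki _]; rewrite gtn_eqF.
Qed.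

Let expand (U : nat -> Omega -> R) k c c0 phi phi0 : (k < n)%N -> (forall i, measurable_fun [set: Omega] (U i)) ->
  mean P (fun w => cos (c0 * U k w + phi0) * (pr U k w * cos (li U k.+1 c w + phi))) =
  2^-1 * mean P (fun w => pr U k w *
    cos (li U k (fun i => if i == k then c0 else c i) w + (phi0 + phi))) +
  2^-1 * mean P (fun w => pr U k w *
    cos (li U k (fun i => if i == k then - c0 else c i) w + (phi - phi0))).
Proof.
move=> kn mU; rewrite -!meanZ -?meanD.
- congr (mean P _); apply/funext => w; rewrite -!li_split//.
  have -> : c0 * U k w + li U k.+1 c w + (phi0 + phi) =
     (li U k.+1 c w + phi) + (c0 * U k w + phi0) by ring.
  have -> : - c0 * U k w + li U k.+1 c w + (phi - phi0) =
     (li U k.+1 c w + phi) - (c0 * U k w + phi0) by ring.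
  move: (li U k.+1 c w + phi) (c0 * U k w + phi0) => b a.
  by rewrite cosD cosB; field.
- by apply: bmfunM; [exact: bmfun_cst|apply: bmfunM; [exact: bm_pr|exact: bm_cosli]].
- by apply: bmfunM; [exact: bmfun_cst|apply: bmfunM; [exact: bm_pr|exact: bm_cosli]].
- by apply: bmfunM; [exact: bm_pr|exact: bm_cosli].
- by apply: bmfunM; [exact: bm_pr|exact: bm_cosli].
Qed.

(** The first [k] coordinates enter through indicators and the others through a cosine. To go to
    [k.+1], [law_indic] is applied to coordinate [k] with all the rest as weight; its hypothesis
    follows from the case [k] by expanding a product of two cosines ([expand]). *)
Let joint_cos k : (k <= n)%N -> forall c phi,
  mean P (fun w => pr X k w * cos (li X k c w + phi)) =
  mean P (fun w => pr Y k w * cos (li Y k c w + phi)).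
Proof.
elim: k => [_ c phi|k IH kn c phi].
  under [X in mean P X]eq_fun do rewrite /pr big_ord0 mul1r.
  under [X in _ = mean P X]eq_fun do rewrite /pr big_ord0 mul1r.
  exact: XY.
have IHk := IH (ltnW kn).
have prS (U : nat -> Omega -> R) w : pr U k.+1 w * cos (li U k.+1 c w + phi) =
    \1_(A k) (U k w) * (pr U k w * cos (li U k.+1 c w + phi)).
  by rewrite /pr big_ord_recr/= mulrAC [RHS]mulrC.
under [X in mean P X]eq_fun do rewrite prS.
under [X in _ = mean P X]eq_fun do rewrite prS.
apply: law_indic => //.
- by apply: bmfunM; [exact: bm_pr|exact: bm_cosli].
- by apply: bmfunM; [exact: bm_pr|exact: bm_cosli].
by move=> c0 phi0; rewrite !expand// !IHk.
Qed.

Lemma joint_law_prod :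
  mean P (fun w => \prod_(i < n) \1_(A i) (X i w)) =
  mean P (fun w => \prod_(i < n) \1_(A i) (Y i w)).
Proof.
have := joint_cos (leqnn n) (fun=> 0) 0.
by under [X in mean P X = _ -> _]eq_fun do rewrite /li big_geq// addr0 cos0 mulr1;
   under [X in _ = mean P X -> _]eq_fun do rewrite /li big_geq// addr0 cos0 mulr1.
Qed.

End joint_law.

Section joint_law_sets.
Context {d : measure_display} {Omega : measurableType d} {R : realType}.
Variable P : probability Omega R.

Lemma prod_indic n (A : 'I_n -> set R) (X : 'I_n -> Omega -> R) w :
  \prod_(i < n) \1_(A i) (X i w) =
  \1_(\bigcap_(i in [set: 'I_n]) (X i @^-1` A i)) w :> R.
Proof.
rewrite indicE; case: (boolP (w \in _)) => [|] H.
  move: H; rewrite inE => H; rewrite big1// => i _.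
  by rewrite indicE mem_set//; exact: H.
have [i Ai] : exists i, ~ A i (X i w).
  apply: contrapT => nA; move/negP : H; apply; rewrite inE => i _ /=.
  by apply: contrapT => nAi; apply: nA; exists i.
by rewrite (bigD1 i)//= indicE memNset// mul0r.
Qed.

Lemma joint_law n (X Y : 'I_n -> Omega -> R) :
  (forall i, measurable_fun [set: Omega] (X i)) ->
  (forall i, measurable_fun [set: Omega] (Y i)) ->
  (forall (c : 'I_n -> R) phi,
    mean P (fun w => cos (\sum_(i < n) c i * X i w + phi)) =
    mean P (fun w => cos (\sum_(i < n) c i * Y i w + phi))) ->
  forall A : 'I_n -> set R, (forall i, measurable (A i)) ->
  P (\bigcap_(i in [set: 'I_n]) (X i @^-1` A i)) =
  P (\bigcap_(i in [set: 'I_n]) (Y i @^-1` A i)).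
Proof.
case: n X Y => [|n] X Y mX mY XY A mA.
  by congr (P _); apply/seteqP; split => w _ [].
have mcap (U : 'I_n.+1 -> Omega -> R) : (forall i, measurable_fun [set: Omega] (U i)) ->
    measurable (\bigcap_(i in [set: 'I_n.+1]) (U i @^-1` A i)).
  move=> mU; apply: fin_bigcap_measurable => // i _.
  by rewrite -[_ @^-1` _]setTI; exact: mU.
have fineP (U : 'I_n.+1 -> Omega -> R) : (forall i, measurable_fun [set: Omega] (U i)) ->
    P (\bigcap_(i in [set: 'I_n.+1]) (U i @^-1` A i)) =
    (mean P (fun w => \prod_(i < n.+1) \1_(A i) (U i w)))%:E.
  move=> mU; under [X in mean P X]eq_fun do rewrite prod_indic.
  by rewrite (mean_indic P (mcap U mU)) fineK//; exact: fin_num_measure (mcap U mU).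
rewrite !fineP//; congr EFin.
pose X' i := X (inord i); pose Y' i := Y (inord i); pose A' i := A (inord i).
have E (U : 'I_n.+1 -> Omega -> R) w : \prod_(i < n.+1) \1_(A i) (U i w) =
    \prod_(i < n.+1) \1_(A' i) (U (inord i) w) :> R.
  by apply: eq_bigr => i _; rewrite /A' !inord_val.
under [X in mean P X = _]eq_fun do rewrite E.
under [X in _ = mean P X]eq_fun do rewrite E.
apply: (@joint_law_prod _ _ _ P n.+1 X' Y') => //.
- by move=> i; exact: mX.
- by move=> i; exact: mY.
- move=> c phi; have := XY (fun i => c (nat_of_ord i)) phi.
have S (U : 'I_n.+1 -> Omega -> R) w : \sum_(0 <= i < n.+1) c i * U (inord i) w =
    \sum_(i < n.+1) c i * U i w.
  by rewrite big_mkord; apply: eq_bigr => i _; rewrite inord_val.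
under [X in _ -> mean P X = _]eq_fun do rewrite S.
by under [X in _ -> _ = mean P X]eq_fun do rewrite S.
- by move=> i; exact: mA.
Qed.

End joint_law_sets.

(** * Normal distributions: scaling and tails *)

Section normal_laws.
Context {R : realType}.
Local Notation mu := (@lebesgue_measure R).

Lemma normal_pdf_affine (m s y : R) : s != 0 ->
  `|s| * normal_pdf m s (s * y + m) = normal_pdf 0 1 y.
Proof.
move=> s0; rewrite !normal_pdfE ?oner_neq0// mulrA; congr (_ * _).
  rewrite /normal_peak expr1n mul1r -mulrnAr sqrtrM ?sqr_ge0// sqrtr_sqr invfM mulrA.
  by rewrite mulfV ?mul1r// normr_eq0.
rewrite /normal_fun addrK subr0; congr expR; rewrite expr1n exprMn.
by field; rewrite s0.
Qed.

Lemma normal_prob_affine (m s : R) (A : set R) : s != 0 -> measurable A ->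
  normal_prob m s A = normal_prob 0 1 ((fun y => s * y + m) @^-1` A).
Proof.
move=> s0 mA; rewrite /normal_prob integral_mkcond [RHS]integral_mkcond.
rewrite -(@ge0_integral_affine _ s m)//.
- apply: eq_integral => y _; rewrite !patchE.
  have -> : (s * y + m \in A) = (y \in (fun y => s * y + m) @^-1` A) by apply/idP/idP; rewrite !inE.
  by case: ifP => _; rewrite ?mule0// -EFinM normal_pdf_affine.
- apply: (measurable_restrictT _ mA).1; apply: measurable_funTS; apply/measurable_EFinP.
  exact: measurable_normal_pdf.
- by move=> x; rewrite patchE; case: ifP => // _; rewrite lee_fin normal_pdf_ge0.
Qed.

Lemma normal_prob_sqr (m s t : R) (A : set R) : s ^+ 2 = t ^+ 2 -> s != 0 ->
  normal_prob m s A = normal_prob m t A.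
Proof.
move=> st s0; have t0 : t != 0 by rewrite -sqrf_eq0 -st sqrf_eq0.
rewrite /normal_prob; apply: eq_integral => x _; rewrite !normal_pdfE//.
by rewrite /normal_peak /normal_fun st.
Qed.

Lemma expRN_le (r : R) : 0 < r -> expR (- r) <= 4 / r ^+ 2.
Proof.
move=> r0; have := expR_ge1Dx (r / 2).
have -> : expR (- r) = (expR (r / 2) ^+ 2)^-1.
  by rewrite expRN; congr (_^-1); rewrite expr2 -expRD; congr expR; field.
move=> h; rewrite -[4 / _]invrK invf_div lef_pV2 ?posrE ?exprn_gt0 ?expR_gt0 ?divr_gt0 ?exprn_gt0//.
rewrite !expr2; nra.
Qed.

(* Compare with the density of standard deviation [2 s]. *)
Lemma normal_prob_tail (s y : R) : s != 0 -> 0 < y ->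
  (normal_prob 0 s [set x | (y <= `|x|)%R] <= (512 * s ^+ 4 / (9 * y ^+ 4))%:E)%E.
Proof.
move=> s0 y0; have s2 : 0 < s ^+ 2 by rewrite exprn_even_gt0.
have ss0 : 2 * s != 0 by rewrite mulf_neq0.
(* The ratio of the densities of deviations [s] and [2 * s] is 2 exp (- 3 x^2 / (8 s^2)), at most
   [C] where |x| >= y. *)
pose C := 2 * expR (- (3 * y ^+ 2 / (8 * s ^+ 2))).
have C0 : 0 <= C by rewrite mulr_ge0// expR_ge0.
have mA : measurable [set x : R | (y <= `|x|)%R].
  have -> : [set x : R | (y <= `|x|)%R] = (fun x : R => `|x|) @^-1` `[y, +oo[.
    by apply/seteqP; split => x /=; rewrite in_itv/= andbT.
  by rewrite -[_ @^-1` _]setTI; exact: normr_measurable.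
have mp m t : measurable_fun [set: R] (fun x => (normal_pdf m t x)%:E).
  by apply/measurable_EFinP; exact: measurable_normal_pdf.
have pdf_le x : y <= `|x| -> normal_pdf 0 s x <= C * normal_pdf 0 (2 * s) x.
  move=> yx; rewrite !normal_pdfE// /normal_fun !subr0.
  have -> : normal_peak s = 2 * normal_peak (2 * s).
    have E : (2 * s) ^+ 2 * pi *+ 2 = 2 ^+ 2 * (s ^+ 2 * pi *+ 2).
      by rewrite exprMn -mulrA mulrnAr.
    rewrite /normal_peak E sqrtrM ?sqr_ge0// sqrtr_sqr ger0_norm//.
    by rewrite invfM mulrA mulfV// mul1r.
  rewrite /C; set a := normal_peak _; set e1 := expR (- (x ^+ 2) / _).
  set e2 := expR (- _); set e3 := expR _.
  have -> : 2 * e2 * (a * e3) = 2 * a * (e2 * e3) by ring.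
  rewrite ler_wpM2l ?mulr_ge0 ?normal_peak_ge0// /e1 /e2 /e3.
  rewrite -expRD ler_expR.
  have yx2 : y ^+ 2 <= x ^+ 2.
    by rewrite -[leRHS]real_normK ?num_real// ler_sqr ?nnegrE// ltW.
  have -> : - x ^+ 2 / (s ^+ 2 *+ 2) = - (4 * x ^+ 2 / (8 * s ^+ 2)) by field.
  have -> : - x ^+ 2 / ((2 * s) ^+ 2 *+ 2) = - (x ^+ 2 / (8 * s ^+ 2)) by field.
  rewrite -opprD lerN2 -mulrDl; apply: ler_wpM2r; first by rewrite invr_ge0 mulr_ge0// ltW.
  lra.
apply: (@le_trans _ _ C%:E).
  rewrite /normal_prob.
  apply: (@le_trans _ _ (\int[mu]_(x in [set x | (y <= `|x|)%R]) (C%:E * (normal_pdf 0 (2 * s) x)%:E))%E).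
    apply: ge0_le_integral => //.
    - by move=> x _; rewrite lee_fin normal_pdf_ge0.
    - by apply: measurable_funTS; exact: mp.
    - by apply: measurable_funTS; apply: emeasurable_funM; [exact: measurable_cst|exact: mp].
  rewrite ge0_integralZl_EFin//; last 2 first.
  - by move=> x _; rewrite lee_fin normal_pdf_ge0.
  - by apply: measurable_funTS; exact: mp.
  rewrite -[leRHS]mule1; apply: lee_wpmul2l; first by rewrite lee_fin.
  exact: (@probability_le1 _ _ _ (normal_prob 0 (2 * s)) _ mA).
rewrite lee_fin /C; set r := 3 * y ^+ 2 / (8 * s ^+ 2).
have r0 : 0 < r by rewrite divr_gt0// mulr_gt0// exprn_gt0.
have := expRN_le r0; have -> : 512 * s ^+ 4 / (9 * y ^+ 4) = 2 * (4 / r ^+ 2).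
  by rewrite /r; field; rewrite s0 gt_eqF.
by move=> h; rewrite ler_wpM2l.
Qed.

End normal_laws.

(** * Gaussian variables and equality of laws *)

Section gaussian_law.
Context {d : measure_display} {Omega : measurableType d} {R : realType}.
Variable P : probability Omega R.
Local Notation hP := (L2_inner P).
Implicit Types X Y U V : {RV P >-> R}.

Definition same_law X Y := forall A : set R, measurable A -> P (X @^-1` A) = P (Y @^-1` A).

Lemma same_law_sym X Y : same_law X Y -> same_law Y X.
Proof. by move=> XY A mA; rewrite XY. Qed.

Lemma same_law_trans Y X V : same_law X Y -> same_law Y V -> same_law X V.
Proof. by move=> XY YV A mA; rewrite XY// YV. Qed.

Lemma same_law_ae X Y : X = Y %[ae P] -> same_law X Y.
Proof.
move=> XY A mA.
have mX (U : {RV P >-> R}) : measurable (U @^-1` A).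
  by rewrite -[_ @^-1` _]setTI; exact: (RV_measurable U).
have E (U : {RV P >-> R}) : P (U @^-1` A) = (\int[P]_w (\1_(U @^-1` A) w)%:E)%E.
  by rewrite integral_indic// setIT.
rewrite !E.
apply: ge0_ae_eq_integral => //.
- by apply/measurable_EFinP; apply: measurable_indic; exact: mX.
- by apply/measurable_EFinP; apply: measurable_indic; exact: mX.
- apply: filterS XY => w /= H _; rewrite !indicE.
  suff -> : (w \in X @^-1` A) = (w \in Y @^-1` A) by [].
  by apply/idP/idP; rewrite !inE /preimage /= H.
Qed.

Lemma same_law_ge0_integral X Y (f : R -> \bar R) : same_law X Y ->
  measurable_fun [set: R] f -> (forall x, (0 <= f x)%E) ->
  (\int[P]_w f (X w) = \int[P]_w f (Y w))%E.
Proof.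
move=> XY mf f0.
rewrite -[LHS](@ge0_integral_distribution _ _ _ _ _ P X f mf f0).
rewrite -[RHS](@ge0_integral_distribution _ _ _ _ _ P Y f mf f0).
by apply: eq_measure_integral => A mA _; exact: XY.
Qed.

Lemma same_law_sqr X Y : same_law X Y ->
  (\int[P]_w (X w ^+ 2)%:E = \int[P]_w (Y w ^+ 2)%:E)%E.
Proof.
move=> XY; apply: (same_law_ge0_integral (f := fun x => (x ^+ 2)%:E) XY).
  by apply/measurable_EFinP; exact: measurable_funX.
by move=> x; rewrite lee_fin sqr_ge0.
Qed.

Lemma same_law_mean X Y (f : R -> R) : same_law X Y -> bmfun f ->
  mean P (fun w => f (X w)) = mean P (fun w => f (Y w)).
Proof.
move=> XY [mf [M fM]].
have bf (U : {RV P >-> R}) : bmfun (fun w => f (U w)).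
  by split; [exact: measurableT_comp mf (RV_measurable U)|exists M].
have H (U : {RV P >-> R}) : mean P (fun w => f (U w)) = mean P (fun w => f (U w) + M) - M.
  rewrite meanD//; last exact: bmfun_cst.
  have -> : mean P (fun=> M) = M.
    by rewrite /mean integral_cst//= probability_setT mule1.
  by rewrite addrK.
rewrite (H X) (H Y); congr (fine _ - _).
apply: (same_law_ge0_integral (f := fun x => (f x + M)%:E) XY).
  by apply/measurable_EFinP; apply: measurable_funD => //; exact: measurable_cst.
by move=> x; rewrite lee_fin; have := fM x; rewrite ler_norml => /andP[? _]; lra.
Qed.

Lemma same_law_expectation X Y : same_law X Y -> P.-integrable [set: Omega] (EFin \o X) ->
  P.-integrable [set: Omega] (EFin \o Y) -> 'E_P[X]%E = 'E_P[Y]%E.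
Proof.
move=> XY iX iY; rewrite unlock.
have mE : measurable_fun [set: R] (EFin : R -> \bar R) by exact/measurable_EFinP.
rewrite -[LHS](@integral_distribution _ _ _ _ _ P X EFin mE iX).
rewrite -[RHS](@integral_distribution _ _ _ _ _ P Y EFin mE iY).
by apply: eq_measure_integral => A mA _; exact: XY.
Qed.

Lemma L2_integrable X : L2 P X -> P.-integrable [set: Omega] (EFin \o X).
Proof.
move=> L2X; have L21 : L2 P (cst 1).
  split; first exact: measurable_cst.
  under eq_integral do rewrite /cst expr1n.
  by rewrite integral_cst//= probability_setT mule1 ltry.
have := ip_integrable L2X L21.
by apply: eq_integrable => // w _; rewrite /= mulr1.
Qed.

Lemma affine_normal X (m s : R) : s != 0 ->
  (forall A, measurable A -> distribution P X A = normal_prob m s A) ->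
  forall A, measurable A ->
    P ((s^-1 *: (X - cst m : {RV P >-> R}) : {RV P >-> R}) @^-1` A) = normal_prob 0 1 A.
Proof.
move=> s0 XE A mA.
pose f x := s^-1 * (x - m).
have mf : measurable_fun [set: R] f.
  by apply: measurable_funM => //; exact: measurable_funB.
have mfA : measurable (f @^-1` A) by rewrite -[_ @^-1` _]setTI; exact: mf.
have -> : (s^-1 *: (X - cst m : {RV P >-> R}) : {RV P >-> R}) @^-1` A =
  X @^-1` (f @^-1` A) by [].
have := XE _ mfA; rewrite /distribution /pushforward => ->.
rewrite normal_prob_affine//; congr (normal_prob _ _ _).
by apply/seteqP; split => y /=; rewrite /f addrK mulKf.
Qed.

Lemma normal_prob_sym (A : set R) : measurable A ->
  normal_prob 0 1 (-%R @^-1` A) = normal_prob 0 1 A.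
Proof.
move=> mA; have N1 : -1 != 0 :> R by rewrite oppr_eq0 oner_neq0.
rewrite -[RHS](@normal_prob_sqr R 0 (-1) 1) ?sqrrN//.
rewrite [RHS](normal_prob_affine 0 N1 mA); congr (normal_prob _ _ _).
by apply/seteqP; split => y /=; rewrite mulN1r addr0.
Qed.

Lemma L2_cst (c : R) : L2 P (cst c).
Proof.
split; first exact: measurable_cst.
suff -> : (\int[P]_x (cst c x ^+ 2)%:E)%E = (c ^+ 2)%:E by exact: ltry.
transitivity (\int[P]_x (cst (c ^+ 2)%:E x))%E; first by [].
by rewrite integral_cst//= probability_setT mule1.
Qed.

(** (X - m) / s is standard normal, hence symmetric, hence of mean 0; so [m] is the mean of [X]. *)
Lemma normal_centered X (m s : R) : s != 0 -> L2 P X -> 'E_P[X]%E = 0%E ->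
  (forall A, measurable A -> distribution P X A = normal_prob m s A) -> m = 0.
Proof.
move=> s0 L2X EX XE.
pose U : {RV P >-> R} := s^-1 *: (X - cst m : {RV P >-> R}).
have UE := affine_normal s0 XE.
have L2Xm : L2 P (X - cst m : {RV P >-> R}) := domB (h := hP) L2X (L2_cst m).
have L2U : L2 P U := domZ (s := hP) s^-1 L2Xm.
pose V : {RV P >-> R} := - U.
have L2V : L2 P V := domN (h := hP) L2U.
have UV : same_law V U.
  move=> A mA; have mNA : measurable (-%R @^-1` A).
    by rewrite -[_ @^-1` _]setTI; exact: oppr_measurable.
  have -> : V @^-1` A = U @^-1` (-%R @^-1` A) by [].
  by rewrite UE// UE// normal_prob_sym.
have iU := L2_integrable L2U; have iV := L2_integrable L2V.
have EUV := same_law_expectation UV iV iU.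
have EV : 'E_P[V]%E = (- 'E_P[U])%E.
  rewrite unlock -mulN1e -EFinN -integralZl//; apply: eq_integral => w _.
  by rewrite -EFinM mulN1r.
have EU0 : 'E_P[U]%E = 0%E.
  have fU : 'E_P[U]%E \is a fin_num by rewrite unlock; exact: integrable_fin_num.
  move: EUV; rewrite EV -(fineK fU) -EFinN => -[] h; congr EFin; lra.
have : 'E_P[X]%E = (s%:E * 'E_P[U] + m%:E)%E.
  rewrite unlock -integralZl//.
  rewrite -[m%:E](mule1) -(probability_setT P) -integral_cst// -integralD//.
  - apply: eq_integral => w _; rewrite -EFinM -EFinD; congr EFin.
    have -> : U w = s^-1 * (X w - m) by [].
    by rewrite mulrA mulfV// mul1r subrK.
  - exact: integrableZl.
  - exact: integrable_cstP.
by rewrite EX EU0 mule0 add0e => -[].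
Qed.

Lemma gaussian_normal X : gaussian X -> L2 P X -> 'E_P[X]%E = 0%E -> n2 hP X != 0 ->
  exists2 s, s != 0 & forall A, measurable A -> distribution P X A = normal_prob 0 s A.
Proof.
move=> [m [s]]; case: eqVneq => [_ Xm|s0 XE] L2X EX X0; last first.
    by exists s => //; rewrite -(normal_centered s0 L2X EX XE).
  exfalso; move/eqP : X0; apply.
  have m0 : m = 0.
    move: EX; rewrite unlock (@ae_eq_integral _ _ _ P _ (cst m%:E))//.
    - by rewrite integral_cst//= probability_setT mule1 => -[].
    - by apply/measurable_EFinP; exact: RV_measurable.
    - by apply: filterS Xm => w /= H _; rewrite (H I).
  have : n2 hP ((X : Omega -> R) - cst m) = 0.
    by apply: ae_n2_eq0 => //; exact: RV_measurable.
  by rewrite m0 (_ : (X : Omega -> R) - cst 0 = X)//; apply/funext => w; exact: subr0.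
Qed.

Lemma gaussian_same_law X Y : gaussian X -> gaussian Y -> L2 P X -> L2 P Y ->
  'E_P[X]%E = 0%E -> 'E_P[Y]%E = 0%E -> n2 hP X = n2 hP Y -> same_law X Y.
Proof.
move=> gX gY L2X L2Y EX EY vXY.
have zero_ae (U : {RV P >-> R}) : L2 P U -> n2 hP U = 0 -> U = (0 : {RV P >-> R}) %[ae P].
  by move=> L2U U0; have := n2_eq0_ae L2U U0.
have [v0|v0] := eqVneq (n2 hP X) 0.
  apply: (@same_law_trans (0 : {RV P >-> R})).
    by apply: same_law_ae; exact: zero_ae.
  by apply: same_law_sym; apply: same_law_ae; apply: zero_ae => //; rewrite -vXY.
have [s s0 XE] := gaussian_normal gX L2X EX v0.
rewrite vXY in v0; have [t t0 YE] := gaussian_normal gY L2Y EY v0.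
have XE' := affine_normal s0 XE; have YE' := affine_normal t0 YE.
pose U : {RV P >-> R} := s^-1 *: (X - cst 0 : {RV P >-> R}).
pose V : {RV P >-> R} := t^-1 *: (Y - cst 0 : {RV P >-> R}).
have UV : same_law U V by move=> A mA; rewrite XE'// YE'.
have E0 (Z : {RV P >-> R}) : (Z : Omega -> R) - cst 0 = Z.
  by apply/funext => w; exact: subr0.
have L2U : L2 P U by rewrite /U /=; apply: (domZ (s := hP)); rewrite /= E0.
have L2V : L2 P V by rewrite /V /=; apply: (domZ (s := hP)); rewrite /= E0.
have nU : n2 hP U = s^-1 ^+ 2 * n2 hP X.
  transitivity (n2 hP (s^-1 *: (X : Omega -> R))); last exact: n2Z.
  by rewrite -[in RHS](E0 X).
have nV : n2 hP V = t^-1 ^+ 2 * n2 hP Y.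
  transitivity (n2 hP (t^-1 *: (Y : Omega -> R))); last exact: n2Z.
  by rewrite -[in RHS](E0 Y).
(* The standardised variables share their law, hence their second moment. Equal variances of [X] and
   [Y] then force [s ^+ 2 = t ^+ 2], without computing any moment of the normal law. *)
have : n2 hP U = n2 hP V.
  by apply: EFin_inj; rewrite -(L2_sqE L2U) -(L2_sqE L2V); exact: same_law_sqr.
rewrite nU nV vXY => /(mulIf v0).
rewrite !exprVn => /invr_inj st A mA.
by have := XE _ mA; have := YE _ mA; rewrite /distribution /pushforward => -> ->; exact: normal_prob_sqr.
Qed.

End gaussian_law.

Lemma cos_dist {R : realType} (a b : R) : `|cos a - cos b| <= `|a - b|.
Proof.
wlog ab : a b / b <= a.
  move=> H; have [/H//|/ltW/H] := leP b a.
  by rewrite distrC [leRHS]distrC.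
have [c _ ->] : exists2 c, c \in `[b, a] & cos a - cos b = - sin c * (a - b).
  apply: (@MVT_segment _ cos (fun x => - sin x)) => //.
  by apply: continuous_subspaceT => x; exact: continuous_cos.
by rewrite normrM normrN ler_piMl// sin_max.
Qed.

(** * Mean square estimates *)

Section mean_square.
Context {d : measure_display} {Omega : measurableType d} {R : realType}.
Variable P : probability Omega R.
Local Notation hP := (L2_inner P).
Implicit Types (X Y : {RV P >-> R}) (f g : Omega -> R).

(** The expectation is the difference of the integrals of the positive and negative parts; as
    [+oo - +oo] is [-oo], a finite value forces both to be finite. *)
Lemma fin_expectation_integrable X : 'E_P[X]%E \is a fin_num ->
  P.-integrable [set: Omega] (EFin \o X).
Proof.
rewrite unlock integralE => fX.
have mX : measurable_fun [set: Omega] (EFin \o X).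
  by apply/measurable_EFinP; exact: RV_measurable.
apply/integrableP; split => //.
have -> : (\int[P]_w `|(EFin \o X) w| = \int[P]_w ((EFin \o X)^\+%E w + (EFin \o X)^\-%E w))%E.
  by congr (integral P setT _); exact: fune_abse.
rewrite ge0_integralD//; last 2 first.
- exact: measurable_funepos.
- exact: measurable_funeneg.
move: fX; rewrite fin_numElt => /andP[].
have : (0 <= \int[P]_w (EFin \o X)^\+%E w)%E by apply: integral_ge0.
have : (0 <= \int[P]_w (EFin \o X)^\-%E w)%E by apply: integral_ge0.
case: (\int[P]_w _)%E => [r| |]//; case: (\int[P]_w _)%E => [s| |]//.
by move=> *; rewrite -EFinD ltry.
Qed.

Lemma dot_cst1 X : L2 P X -> 'E_P[X]%E = (dot hP X (cst 1))%:E.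
Proof.
move=> L2X; rewrite unlock -(ipE L2X (L2_cst P 1)).
by apply: eq_integral => w _; rewrite mulr1.
Qed.

Lemma mean_sqr_le f : bmfun f -> L2 P f -> mean P f ^+ 2 <= n2 hP f.
Proof.
move=> bf L2f.
have -> : mean P f = dot hP f (cst 1).
  by rewrite /dot /= /ip; congr fine; apply: eq_integral => w _; rewrite mulr1.
apply: le_trans (cauchy_schwarz (h := hP) L2f (L2_cst P 1)) _.
suff -> : n2 hP (cst 1) = 1 by rewrite mulr1.
apply: EFin_inj; rewrite -(L2_sqE (L2_cst P 1)).
transitivity (\int[P]_x (cst 1%:E x))%E; first by apply: eq_integral => x _; rewrite /cst expr1n.
by rewrite integral_cst//= probability_setT mule1.
Qed.

Lemma bmfun_cos X phi : bmfun (fun w => cos (X w + phi)).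
Proof.
split; last by exists 1 => w; exact: cos_max.
apply: (@measurableT_comp _ _ _ _ _ _ cos) => //.
  by apply: continuous_measurable_fun; exact: continuous_cos.
by apply: measurable_funD => //; exact: measurable_cst.
Qed.

Lemma mean_cos_dist X Y phi : L2 P (X - Y) ->
  (mean P (fun w => cos (X w + phi)) - mean P (fun w => cos (Y w + phi))) ^+ 2
  <= n2 hP (X - Y).
Proof.
move=> L2XY.
have bX := bmfun_cos X phi; have bY := bmfun_cos Y phi.
pose g w := cos (X w + phi) + -1 * cos (Y w + phi).
have bN : bmfun (fun w => -1 * cos (Y w + phi)) by apply: bmfunM => //; exact: bmfun_cst.
have bg : bmfun g by exact: bmfunD.
have -> : mean P (fun w => cos (X w + phi)) - mean P (fun w => cos (Y w + phi)) = mean P g.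
  by rewrite meanD// meanZ// mulN1r.
have le : (\int[P]_w (g w ^+ 2)%:E <= \int[P]_w ((X - Y : Omega -> R) w ^+ 2)%:E)%E.
  apply: ge0_le_integral => //.
  - by move=> w _; exact: sqr_EFin_ge0.
  - by apply: measurable_EFin_sqr; case: bg.
  - by apply: measurable_EFin_sqr; case: L2XY.
  - move=> w _; rewrite lee_fin -[leLHS]real_normK ?num_real// -[leRHS]real_normK ?num_real//.
    rewrite ler_sqr ?nnegrE// /g mulN1r; apply: le_trans (cos_dist _ _) _.
    by rewrite opprD addrACA subrr addr0.
have L2g : L2 P g := L2_le_integral bg.1 L2XY le.
apply: le_trans (mean_sqr_le bg L2g) _.
by rewrite -lee_fin -(L2_sqE L2g) -(L2_sqE L2XY).
Qed.

End mean_square.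

(** * The closed span of the increments of W *)

Section gaussian_space.
Context {d : measure_display} {Omega : measurableType d} {R : realType}.
Variable P : probability Omega R.
Local Notation mu := (@lebesgue_measure R).
Local Notation hR := (L2_inner mu).
Local Notation hP := (L2_inner P).
Local Notation hh := (prod_inner hR hP).
Variable W : R -> {RV P >-> R}.
Hypothesis gW : gaussian_process setT W.
Hypothesis cW : centered setT W.
Hypothesis W2 : forall u v, 'E_P[((W u - W v) ^+ 2)%R]%E = `|u - v|%:E.

Let W2' (D : set R) u v : D u -> D v -> 'E_P[((W u - W v) ^+ 2)%R]%E = `|u - v|%:E.
Proof. by move=> _ _; exact: W2. Qed.

Definition gspace := cl hh (increments setT W).

Let iL2 := incr_L2 W2 (D := setT).

Lemma Wpairs_gspace u : Wpairs W u `<=` gspace.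
Proof.
apply: cl_mono => _ [z [_ _ z12] <-]; by exists z.
Qed.

Lemma gspace_n2 p : gspace p -> n2 hR p.1 = n2 hP p.2.
Proof. exact: cl_n2 iL2 (incr_isometric W2 (D := setT)) p. Qed.

Lemma gspace_dot p q : gspace p -> gspace q -> dot hR p.1 q.1 = dot hP p.2 q.2.
Proof. exact: (cl_isometric iL2 (incr_isometric W2 (D := setT))). Qed.

Let L2W u v : L2 P (W u - W v).
Proof. exact: (@L2_increment _ _ _ _ setT W (@W2' setT)). Qed.

Lemma increment_mean u v : dot hP (W u - W v : {RV P >-> R}) (cst 1) = 0.
Proof.
apply: EFin_inj; rewrite -(dot_cst1 (L2W u v)).
have iW w : P.-integrable [set: Omega] (EFin \o W w).
  by apply: fin_expectation_integrable; rewrite cW.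
have -> : 'E_P[(W u - W v)%R]%E = (\int[P]_w (W u w)%:E - \int[P]_w (W v w)%:E)%E.
  rewrite unlock; have -> : (\int[P]_w ((W u - W v : {RV P >-> R}) w)%:E =
    \int[P]_w ((W u w)%:E - (W v w)%:E))%E by [].
  by rewrite integralB//; [exact: (iW u)|exact: (iW v)].
have E w : (\int[P]_x (W w x)%:E)%E = 0%E by have := cW (t := w) I; rewrite unlock.
by rewrite !E sube0.
Qed.

Lemma gspace_mean p : gspace p -> dot hP p.2 (cst 1) = 0.
Proof.
move=> /cl_snd H; apply: (dot_cl_eq0 (h := hP) (snd_dom iL2) (L2_cst P 1) _ H).
by move=> _ [_ [z _ <-] <-]; exact: increment_mean.
Qed.

Lemma span_increments_gaussian F X : span (increments setT W) (F, X) ->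
  exists2 Z : {RV P >-> R}, (Z : Omega -> R) = X & gaussian Z.
Proof.
move=> H; have : span (snd @` increments setT W) X.
  by have := image_span (@snd (R -> R) (Omega -> R)) H.
move=> {H}; have : snd @` increments setT W `<=` span (fns (range W)).
  move=> _ [_ [z _ <-] <-] /=.
  by apply: (@spanB _ _ _ (W z.2 : Omega -> R) (W z.1 : Omega -> R)); apply: sub_span; [exists (W z.2)|exists (W z.1)].
move=> /span_subset /[apply] /span_fns_linear [Z [n [c [U [UW ->]]]] <-].
exists (\sum_(i < n) c i *: U i) => //.
have /choice [t tU] i : exists t, W t = U i by have [t _ <-] := UW i; exists t.
have -> : \sum_(i < n) c i *: U i = \sum_(i < n) c i *: W (t i).
  by apply: eq_bigr => i _; rewrite tU.
by apply: gW.
Qed.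

(** A reference value for every variable of variance [v]: the real form of the characteristic
    function, with the phase [phi] in place of the imaginary part. *)
Definition psi (v phi : R) := mean P (fun w => cos ((W v - W 0 : {RV P >-> R}) w + phi)).

Lemma increment_gaussian u v : gaussian (W u - W v : {RV P >-> R}).
Proof.
have -> : W u - W v = \sum_(i < 2) (if i == ord0 then 1 else -1) *: W (if i == ord0 then u else v).
  by rewrite !big_ord_recl big_ord0 /= addr0 scale1r scaleN1r.
exact: gW.
Qed.

Lemma span_same_law F (Z : {RV P >-> R}) : gaussian Z -> span (increments setT W) (F, Z : Omega -> R) ->
  same_law Z (W (n2 hR F) - W 0).
Proof.
move=> gZ H; have K : gspace (F, Z : Omega -> R) by exact: span_cl.
have [_ L2Z] := cl_dom K.
apply: gaussian_same_law => //.
- exact: increment_gaussian.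
- by rewrite dot_cst1// (gspace_mean K).
- by rewrite dot_cst1// increment_mean.
- rewrite -(gspace_n2 K) (@n2_increment _ _ _ _ setT W (@W2' setT))// subr0.
  by rewrite ger0_norm// n2_ge0.
Qed.

Lemma psi_dist u v phi : (psi u phi - psi v phi) ^+ 2 <= `|u - v|.
Proof.
have E : (W u - W 0) - (W v - W 0) = W u - W v.
  by rewrite opprB addrA subrK.
have := @mean_cos_dist _ _ _ P (W u - W 0) (W v - W 0) phi.
by rewrite E (@n2_increment _ _ _ _ setT W (@W2' setT))//; exact.
Qed.

(** For finite combinations of increments, Gaussian laws of equal variance agree. Both sides depend
    continuously on the pair in mean square, so the identity extends to the closure. *)
Lemma gspace_cos F (X : {RV P >-> R}) phi : gspace (F, X : Omega -> R) ->
  mean P (fun w => cos (X w + phi)) = psi (n2 hR F) phi.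
Proof.
move=> K; have [DF DX] := cl_dom K.
have [f [fs fc]] := cl_seq iL2 K.
have sD n : dom hh (f n) := dom_span iL2 (fs n).
have /choice[Z ZE] n : exists Z : {RV P >-> R}, (Z : Omega -> R) = (f n).2 /\ gaussian Z.
  have := fs n; rewrite [f n]surjective_pairing => /span_increments_gaussian[Z ZE gZ].
  by exists Z.
have cX : n2 hP ((Z n - X : {RV P >-> R})) @[n --> \oo] --> 0.
  have := cvg_prod_snd (f := f) (p := (F, X : Omega -> R)) fc.
  under eq_fun do rewrite -(ZE _).1.
  by apply.
have cF : n2 hR (f n).1 @[n --> \oo] --> n2 hR F.
  have c := cvg_prod_fst (f := f) (p := (F, X : Omega -> R)) fc.
  apply: (cvg_dot (h := hR) (f := fun n => (f n).1) (g := fun n => (f n).1)) => //.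
  - by move=> n; case: (sD n).
  - by move=> n; case: (sD n).
apply/eqP; rewrite -subr_eq0 -sqrf_eq0; apply/eqP/le_anti; rewrite sqr_ge0 andbT.
set a := mean P _.
(* With [b] the expectation for [Z n] and [c] the limit value, (a - c)^2 <= 2 (b - a)^2 + 2 (b -
   c)^2. *)
have key n : (a - psi (n2 hR F) phi) ^+ 2 <=
    2 * n2 hP (Z n - X : {RV P >-> R}) + 2 * `|n2 hR (f n).1 - n2 hR F|.
  have [ZfE gZ] := ZE n.
  have := fs n; rewrite [f n]surjective_pairing -ZfE => sZ.
  have L2Z : L2 P (Z n) by rewrite ZfE; case: (sD n).
  have := same_law_mean (span_same_law gZ sZ) (f := fun x => cos (x + phi)).
  set b := mean P _; rewrite -/(psi (n2 hR (f n).1) phi) => bE.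
  have {}bE : b = psi (n2 hR (f n).1) phi.
    apply: bE; split; last by exists 1 => x; exact: cos_max.
    apply: (@measurableT_comp _ _ _ _ _ _ cos) => //.
      by apply: continuous_measurable_fun; exact: continuous_cos.
    by apply: measurable_funD => //; exact: measurable_cst.
  have h1 : (b - a) ^+ 2 <= n2 hP (Z n - X : {RV P >-> R}).
    by apply: mean_cos_dist; exact: (domB (h := hP) L2Z DX).
  have := psi_dist (n2 hR (f n).1) (n2 hR F) phi; rewrite -bE.
  set c := psi _ _ => h2; have := sqr_ge0 (a - 2 * b + c).
  by move: h1 h2; rewrite !expr2; lra.
have lim : 2 * n2 hP (Z n - X : {RV P >-> R}) + 2 * `|n2 hR (f n).1 - n2 hR F| @[n --> \oo] --> 2 * 0 + 2 * `|n2 hR F - n2 hR F|.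
  apply: cvgD; first exact: cvgMr.
  by apply: cvgMr; apply: cvg_norm; apply: cvgB => //; exact: cvg_cst.
rewrite subrr normr0 !mulr0 addr0 in lim.
rewrite -(cvg_lim (@Rhausdorff _) lim); apply: limr_ge; first exact: cvgP lim.
by apply: nearW.
Qed.

End gaussian_space.

Lemma dot_sumr {R : realType} {V : lmodType R} (h : semi_inner V) n (f : 'I_n -> V) x :
  dom h x -> (forall i, dom h (f i)) ->
  dom h (\sum_(i < n) f i) /\ dot h x (\sum_(i < n) f i) = \sum_(i < n) dot h x (f i).
Proof.
move=> Dx; elim: n f => [|n IH] f Df.
  by rewrite !big_ord0; split; [exact: dom0|rewrite dotC dot0l].
have [D1 E1] := IH (fun i => f (widen_ord (leqnSn n) i)) (fun i => Df _).
by rewrite !big_ord_recr/=; split; [exact: domD|rewrite dotDr// E1].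
Qed.

Lemma n2_sum {R : realType} {V : lmodType R} (h : semi_inner V) n (c : 'I_n -> R) (f : 'I_n -> V) :
  (forall i, dom h (f i)) ->
  n2 h (\sum_(i < n) c i *: f i) = \sum_(i < n) \sum_(j < n) c i * c j * dot h (f i) (f j).
Proof.
move=> Df; have Dc i : dom h (c i *: f i) by exact: domZ.
have [DS _] := dot_sumr (dom0 h) Dc.
rewrite /n2 (dot_sumr DS Dc).2; apply: eq_bigr => i _.
rewrite dotC (dot_sumr (Dc i) Dc).2; apply: eq_bigr => j _.
by rewrite dotZl// dotZr// mulrA.
Qed.

(** * Laws of tuples *)

Section tuple_law.
Context {d : measure_display} {Omega : measurableType d} {R : realType}.
Variable P : probability Omega R.

Let boxes n : set (set (n.-tuple R)) :=
  [set A | exists2 B : 'I_n -> set R, forall i, measurable (B i) &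
     A = [set x | forall i, B i (tnth x i)]].

Let boxes_measurable n : @boxes n `<=` measurable.
Proof.
move=> _ [B mB ->].
have -> : [set x : n.-tuple R | forall i, B i (tnth x i)] =
    \bigcap_(i in [set: 'I_n]) ((fun x : n.-tuple R => tnth x i) @^-1` B i).
  by apply/seteqP; split => x /= H i; [move=> _|]; exact: H.
apply: fin_bigcap_measurable => // i _.
by rewrite -[_ @^-1` _]setTI; exact: measurable_tnth.
Qed.

Let measurable_boxes n : @measurable _ (n.-tuple R) = <<s @boxes n >>.
Proof.
apply/seteqP; split; last first.
  by apply: smallest_sub; [exact: sigma_algebra_measurable|exact: boxes_measurable].
apply: smallest_sub; first exact: smallest_sigma_algebra.
rewrite -bigcup_seq => A [i _ [B mB <-]].
apply: sub_sigma_algebra; exists (fun j => if j == i then B else setT).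
  by move=> j; case: ifP.
apply/seteqP; split => x /=.
  by move=> [_ Bx] j; case: eqVneq => [->|].
by move=> /(_ i); rewrite eqxx.
Qed.

(** Boxes are stable under intersection and generate the measurable sets of tuples, so agreement on
    boxes suffices. *)
Lemma tuple_law n (X Y : 'I_n -> {RV P >-> R}) :
  (forall B : 'I_n -> set R, (forall i, measurable (B i)) ->
    P (\bigcap_(i in [set: 'I_n]) (X i @^-1` B i)) =
    P (\bigcap_(i in [set: 'I_n]) (Y i @^-1` B i))) ->
  forall A : set (n.-tuple R), measurable A ->
  P ((fun w => [tuple X i w | i < n]) @^-1` A) =
  P ((fun w => [tuple Y i w | i < n]) @^-1` A).
Proof.
move=> XY A mA.
have mt (Z : 'I_n -> {RV P >-> R}) (S : set (n.-tuple R)) : measurable S ->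
    measurable ((fun w => [tuple Z i w | i < n]) @^-1` S).
  move=> mS; rewrite -[_ @^-1` _]setTI.
  have : measurable_fun [set: Omega] (fun w => [tuple Z i w | i < n]).
    apply/measurable_fun_tnthP => i.
    rewrite (_ : _ \o _ = Z i); first exact: RV_measurable.
    by apply/funext => w /=; rewrite tnth_mktuple.
  by apply.
pose Q (S : set (n.-tuple R)) := P ((fun w => [tuple X i w | i < n]) @^-1` S) =
  P ((fun w => [tuple Y i w | i < n]) @^-1` S).
apply: (@dynkin_induction _ (n.-tuple R) (@boxes n) Q).
- exact: measurable_boxes.
- move=> _ _ [B mB ->] [C mC ->]; exists (fun i => B i `&` C i).
    by move=> i; exact: measurableI.
  apply/seteqP; split => x /=; first by move=> [H1 H2] i; split; [exact: H1|exact: H2].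
  by move=> H; split => i; have [] := H i.
- by rewrite /Q !preimage_setT.
- move=> _ [B mB ->]; rewrite /Q.
  have E (Z : 'I_n -> {RV P >-> R}) : (fun w => [tuple Z i w | i < n]) @^-1`
      [set x | forall i, B i (tnth x i)] = \bigcap_(i in [set: 'I_n]) (Z i @^-1` B i).
    apply/seteqP; split => w /= H i; last by rewrite tnth_mktuple; exact: H.
    by move=> _; have := H i; rewrite tnth_mktuple.
  by rewrite !E XY.
- move=> S mS; rewrite /Q => SE.
  by rewrite (preimage_setC _ S) (probability_setC P (mt X S mS)) (preimage_setC _ S)
    (probability_setC P (mt Y S mS)) SE.
- move=> F mF tF H; rewrite /Q preimage_bigcup preimage_bigcup.
  rewrite !measure_bigcup//.
  + by apply: eq_eseriesr => i _; exact: H.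
  + by move=> i _; exact: mt.
  + by move=> i j _ _ [w [Fi Fj]]; apply: (tF i j) => //; exists [tuple Y i w | i < n].
  + by move=> i _; exact: mt.
  + by move=> i j _ _ [w [Fi Fj]]; apply: (tF i j) => //; exists [tuple X i w | i < n].
- by rewrite -measurable_boxes.
Qed.

End tuple_law.

(** * Laws in the Gaussian space of W *)

Section gaussian_space.
Context {d : measure_display} {Omega : measurableType d} {R : realType}.
Variable P : probability Omega R.
Local Notation mu := (@lebesgue_measure R).
Local Notation hR := (L2_inner mu).
Local Notation hP := (L2_inner P).
Local Notation hh := (prod_inner hR hP).
Variable W : R -> {RV P >-> R}.
Hypothesis gW : gaussian_process setT W.
Hypothesis cW : centered setT W.
Hypothesis W2 : forall u v, 'E_P[((W u - W v) ^+ 2)%R]%E = `|u - v|%:E.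

Let W2' (D : set R) u v : D u -> D v -> 'E_P[((W u - W v) ^+ 2)%R]%E = `|u - v|%:E.
Proof. by move=> _ _; exact: W2. Qed.

Let iL2 := incr_L2 W2 (D := setT).

Definition gset : set {RV P >-> R} := [set X | exists F, gspace W (F, X : Omega -> R)].

Lemma gset_L2 X : gset X -> L2 P X.
Proof. by move=> [F /cl_dom[]]. Qed.

Lemma gset_Wpairs u F (X : {RV P >-> R}) : Wpairs W u (F, X : Omega -> R) -> gset X.
Proof. by move=> /Wpairs_gspace H; exists F. Qed.

Lemma gset_ae (X Y : {RV P >-> R}) : X = Y %[ae P] -> gset X -> gset Y.
Proof.
move=> XY [F H]; have [DF DX] := cl_dom H.
have L2Y : L2 P Y by apply: ae_L2 XY => //; exact: RV_measurable.
exists F; apply: (cl_eq0 (h := hh) (x := (F, X : Omega -> R)) iL2) => //.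
transitivity (n2 hR (F - F) + n2 hP ((X : Omega -> R) - (Y : Omega -> R))).
  exact: n2_prodE.
rewrite subrr n2_0 add0r.
by apply: ae_n2_eq0 => //; exact: RV_measurable.
Qed.

Lemma gset0 : gset 0.
Proof. by exists 0; apply: span_cl iL2 (span0 _). Qed.

Lemma gsetZ c X : gset X -> gset (c *: X).
Proof. by move=> [F H]; exists (c *: F); exact: (clZ (h := hh) c iL2 H). Qed.

Lemma gsetD X Y : gset X -> gset Y -> gset (X + Y).
Proof. by move=> [F HF] [G HG]; exists (F + G); exact: (clD (h := hh) iL2 HF HG). Qed.

Lemma gsetB X Y : gset X -> gset Y -> gset (X - Y).
Proof. by move=> gX gY; rewrite -scaleN1r; apply: gsetD => //; exact: gsetZ. Qed.

Lemma gset_sum n (c : 'I_n -> R) (X : 'I_n -> {RV P >-> R}) :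
  (forall i, gset (X i)) -> gset (\sum_(i < n) c i *: X i).
Proof.
move=> gX; apply: (big_ind gset); [exact: gset0|exact: gsetD|].
by move=> i _; exact: gsetZ.
Qed.

Lemma gset_increment u v : gset (W u - W v).
Proof.
wlog uv : u v / v <= u.
  move=> H; have [/H//|/ltW/H] := leP v u.
  by move=> /(gsetZ (-1)); rewrite scaleN1r opprB.
exists (\1_`]v, u]); apply: sub_cl iL2 _ _.
by exists (v, u).
Qed.

Lemma gset_expectation X : gset X -> 'E_P[X]%E = 0%E.
Proof.
move=> gX; rewrite dot_cst1; last exact: gset_L2.
by case: gX => F /(gspace_mean cW W2) /= ->.
Qed.

Lemma gset_cos X phi : gset X ->
  mean P (fun w => cos (X w + phi)) = psi W (n2 hP X) phi.
Proof.
move=> [F H]; rewrite (gspace_cos gW cW W2 phi H).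
by rewrite (gspace_n2 W2 H).
Qed.

Lemma RV_sumE n (c : 'I_n -> R) (X : 'I_n -> {RV P >-> R}) :
  ((\sum_(i < n) c i *: X i : {RV P >-> R}) : Omega -> R) =
  \sum_(i < n) c i *: (X i : Omega -> R).
Proof.
apply: (big_ind2 (fun (x : {RV P >-> R}) y => (x : Omega -> R) = y)) => //.
by move=> x1 x2 y1 y2 <- <-.
Qed.

(** A linear combination stays in the Gaussian space and its variance is read off the Gram matrix,
    so the cosine expectations of the two families coincide. *)
Lemma gset_joint_law n (X Y : 'I_n -> {RV P >-> R}) :
  (forall i, gset (X i)) -> (forall i, gset (Y i)) ->
  (forall i j, dot hP (X i) (X j) = dot hP (Y i) (Y j)) ->
  forall A : 'I_n -> set R, (forall i, measurable (A i)) ->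
  P (\bigcap_(i in [set: 'I_n]) (X i @^-1` A i)) =
  P (\bigcap_(i in [set: 'I_n]) (Y i @^-1` A i)).
Proof.
move=> gX gY XY; apply: joint_law.
- by move=> i; exact: RV_measurable.
- by move=> i; exact: RV_measurable.
move=> c phi.
have E (Z : 'I_n -> {RV P >-> R}) : (forall i, gset (Z i)) ->
    mean P (fun w => cos (\sum_(i < n) c i * Z i w + phi)) =
    psi W (\sum_(i < n) \sum_(j < n) c i * c j * dot hP (Z i) (Z j)) phi.
  move=> gZ; rewrite -n2_sum; last by move=> i; exact: gset_L2.
  rewrite -RV_sumE -gset_cos; last exact: gset_sum.
  congr mean; apply/funext => w; rewrite RV_sumE.
  by rewrite fct_sumE.
rewrite (E X gX) (E Y gY); congr (psi W _ phi).
by apply: eq_bigr => i _; apply: eq_bigr => j _; rewrite XY.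
Qed.

Lemma gset_same_law X Y : gset X -> gset Y -> n2 hP X = n2 hP Y -> same_law X Y.
Proof.
move=> gX gY XY A mA.
have := @gset_joint_law 1 (fun=> X) (fun=> Y) (fun=> gX) (fun=> gY) (fun _ _ => XY) (fun=> A) (fun=> mA).
have E (Z : {RV P >-> R}) : \bigcap_(i in [set: 'I_1]) (Z @^-1` A) = Z @^-1` A.
  by apply/seteqP; split => [w /(_ ord0 I)//|w H i _].
by rewrite !E.
Qed.

(** [X] has the law of the increment of [W] from 0 to its variance, which is Gaussian by hypothesis
    on [W]. *)
Lemma gset_gaussian X : gset X -> gaussian X.
Proof.
move=> gX; pose Y : {RV P >-> R} := W (n2 hP X) - W 0.
have nY : n2 hP Y = n2 hP X.
  rewrite (@n2_increment _ _ _ _ setT W (@W2' setT))// subr0.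
  by rewrite ger0_norm// n2_ge0.
have XY : same_law X Y.
  by apply: gset_same_law => //; exact: gset_increment.
have [X0|X0] := eqVneq (n2 hP X) 0.
  exists 0, 0; rewrite eqxx.
  by have := n2_eq0_ae (gset_L2 gX) X0.
have [||||s s0 YE] := @gaussian_normal _ _ _ P Y.
- exact: increment_gaussian gW _ _.
- by apply: gset_L2; exact: gset_increment.
- by apply: gset_expectation; exact: gset_increment.
- by rewrite nY.
exists 0, s; rewrite (negbTE s0) => A mA.
by rewrite -YE//; exact: XY.
Qed.

(** By scaling, [X] has the law of a multiple of [W 1 - W 0], to which [normal_prob_tail] applies.
    The variance enters squared, and this power above 1 is what continuity of paths requires. *)
Lemma gset_tail : exists2 C : R, 0 <= C & forall (X : {RV P >-> R}) (a : R), gset X -> 0 < a ->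
  (P [set w | (a <= `|X w|)%R] <= (C * n2 hP X ^+ 2 / a ^+ 4)%:E)%E.
Proof.
pose Z : {RV P >-> R} := W 1 - W 0.
have gZ : gset Z by exact: gset_increment.
have nZ : n2 hP Z = 1.
  by rewrite (@n2_increment _ _ _ _ setT W (@W2' setT))// subr0 normr1.
have [||||s s0 ZE] := @gaussian_normal _ _ _ P Z.
- exact: gset_gaussian.
- exact: gset_L2.
- exact: gset_expectation.
- by rewrite nZ oner_neq0.
exists (512 * s ^+ 4 / 9); first by rewrite divr_ge0// mulr_ge0// exprn_even_ge0.
move=> X a gX a0; pose v := n2 hP X; have v0 : 0 <= v := n2_ge0 hP X.
have mI (b : R) : measurable [set x : R | (b <= `|x|)%R].
  have -> : [set x : R | (b <= `|x|)%R] = (fun x : R => `|x|) @^-1` `[b, +oo[.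
    by apply/seteqP; split => x /=; rewrite in_itv/= andbT.
  by rewrite -[_ @^-1` _]setTI; exact: normr_measurable.
have -> : P [set w | (a <= `|X w|)%R] = P [set w | (a <= `|(Num.sqrt v *: Z : {RV P >-> R}) w|)%R].
  have := @gset_same_law X (Num.sqrt v *: Z) gX (gsetZ _ gZ) _ _ (mI a); apply.
  have -> : n2 hP (Num.sqrt v *: Z : {RV P >-> R}) = Num.sqrt v ^+ 2 * n2 hP Z.
    by apply: (n2Z (h := hP)); exact: gset_L2.
  by rewrite nZ mulr1 sqr_sqrtr.
have [v00|vn] := eqVneq v 0.
  rewrite v00 sqrtr0 (_ : [set w | _] = set0) ?measure0.
    by rewrite lee_fin -/v v00 expr0n mulr0 mul0r.
  apply/seteqP; split => w //=.
  by rewrite scale0r normr0 leNgt a0.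
have vp : 0 < Num.sqrt v by rewrite sqrtr_gt0 lt_neqAle eq_sym vn.
have -> : [set w | (a <= `|(Num.sqrt v *: Z : {RV P >-> R}) w|)%R] =
    Z @^-1` [set x | (a / Num.sqrt v <= `|x|)%R].
  have E w : (Num.sqrt v *: Z : {RV P >-> R}) w = Num.sqrt v * Z w by [].
  apply/seteqP; split => w; rewrite /mkset E /preimage /mkset.
    by rewrite normrM gtr0_norm// ler_pdivrMr// mulrC.
  by rewrite normrM gtr0_norm// ler_pdivrMr// mulrC.
have -> : P (Z @^-1` [set x | (a / Num.sqrt v <= `|x|)%R]) = normal_prob 0 s [set x | (a / Num.sqrt v <= `|x|)%R].
  by rewrite -ZE.
apply: (le_trans (normal_prob_tail s0 (divr_gt0 a0 vp))).
rewrite lee_fin -/v le_eqVlt; apply/orP; left; apply/eqP.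
have -> : v ^+ 2 = Num.sqrt v ^+ 4 by rewrite (exprM _ 2 2) sqr_sqrtr.
by field; rewrite !gt_eqF.
Qed.

Lemma dot_increments (V : lmodType R) (h : semi_inner V) (a b c e : V) :
  dom h a -> dom h b -> dom h c -> dom h e ->
  dot h (a - b) (c - e) =
  (n2 h (a - e) + n2 h (b - c) - n2 h (a - c) - n2 h (b - e)) / 2.
Proof.
move=> Da Db Dc De; rewrite !n2B// dotBl//; last exact: domB.
by rewrite !dotBr//; field.
Qed.

(** The increments of [T] have the Gram matrix of those of [W], by polarisation. Joint and marginal
    laws agree, and the product formula is carried over. *)
Lemma gset_independent_increments (D : set R) (T : R -> {RV P >-> R}) :
  independent_increments setT W ->
  (forall t, D t -> gset (T t)) ->
  (forall u v, D u -> D v -> n2 hP (T u - T v : {RV P >-> R}) = `|u - v|) ->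
  independent_increments D T.
Proof.
move=> iW gT T2 n t tD tS A mA.
pose U u : {RV P >-> R} := W u - W 0.
have gU u : gset (U u) by exact: gset_increment.
have gram (i j : 'I_n) : dot hP (T (t i.+1) - T (t i) : {RV P >-> R}) (T (t j.+1) - T (t j) : {RV P >-> R}) =
    dot hP (W (t i.+1) - W (t i) : {RV P >-> R}) (W (t j.+1) - W (t j) : {RV P >-> R}).
  have WU u v : W u - W v = U u - U v by rewrite /U opprB addrA subrK.
  have tD' (k : 'I_n) : D (t k) by apply: tD; exact: ltnW.
  have tDS (k : 'I_n) : D (t k.+1) by apply: tD.
  rewrite !WU.
  rewrite (@dot_increments _ hP) //; try by apply: gset_L2; exact: gT.
  rewrite (@dot_increments _ hP (U (t i.+1)) (U (t i)) (U (t j.+1)) (U (t j))); try exact: gset_L2.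
  have UE u v : n2 hP ((U u : Omega -> R) - U v) = `|u - v|.
    transitivity (n2 hP (W u - W v : {RV P >-> R})); first by rewrite WU.
    exact: (@n2_increment _ _ _ _ setT W (@W2' setT)).
  by rewrite !UE !(T2 _ _ _ _).
rewrite (@gset_joint_law n _ (fun i : 'I_n => W (t i.+1) - W (t i))) //.
- rewrite (iW n t)//; apply: eq_bigr => i _.
  apply: gset_same_law => //.
  + exact: gset_increment.
  + by apply: gsetB; apply: gT; apply: tD => //; exact: ltnW.
  + by rewrite /n2 gram.
- by move=> i; apply: gsetB; apply: gT; apply: tD => //; exact: ltnW.
- by move=> i; exact: gset_increment.
Qed.

End gaussian_space.

(** * Extension from dyadic times *)

Section dyadic.
Context {R : realType}.
Implicit Types (s t : R) (f : R -> R).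

(** For [t >= 0], the last point of the grid of step 2^-n not exceeding [t]. [Num.trunc] is 0 on
    negative numbers, so negative times are sent to 0. *)
Definition dyadic n t : R := (Num.trunc (2 ^+ n * t))%:R / 2 ^+ n.

Let p2 n : 0 < (2 ^+ n : R). Proof. by rewrite exprn_gt0. Qed.

Let natS (m : nat) : m.+1%:R = m%:R + 1 :> R. Proof. by rewrite natr1. Qed.

Lemma truncn_double (x : R) : 0 <= x ->
  Num.trunc (2 * x) = (2 * Num.trunc x)%N \/ Num.trunc (2 * x) = (2 * Num.trunc x).+1.
Proof.
move=> x0; have /andP[kx xk] := truncn_itv x0; set k := Num.trunc x in kx xk *.
have [h|h] := ltP (2 * x) (2 * k%:R + 1); [left|right]; apply: truncn_def.
  by rewrite (natS (2 * k)) natrM; apply/andP; split; lra.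
by move: xk; rewrite (natS (2 * k).+1) (natS (2 * k)) (natS k) natrM => xk; apply/andP; split; lra.
Qed.

Lemma truncn_le_succ (x y : R) : x <= y -> y <= x + 1 ->
  Num.trunc y = Num.trunc x \/ Num.trunc y = (Num.trunc x).+1.
Proof.
move=> xy yx; have [x0|x0] := leP 0 x; last first.
  left; rewrite (_ : Num.trunc x = 0%N); last by apply/truncn0Pn; rewrite -ltNge; lra.
  by apply/truncn0Pn; rewrite -ltNge; lra.
have /andP[kx xk] := truncn_itv x0; set k := Num.trunc x in kx xk *.
have y0 : 0 <= y by lra.
have [h|h] := ltP y k.+1%:R; [left|right]; apply: truncn_def.
  by rewrite h andbT; lra.
by rewrite h/=; move: xk; rewrite (natS k.+1) (natS k) => xk; lra.
Qed.

Lemma dyadic_ge0 n t : 0 <= dyadic n t.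
Proof. by rewrite divr_ge0// ltW. Qed.

Lemma dyadic_dist n t : 0 <= t -> `|dyadic n t - t| <= (2 ^+ n)^-1.
Proof.
move=> t0; have /andP[h1 h2] := truncn_itv (mulr_ge0 (ltW (p2 n)) t0).
have -> : dyadic n t - t = ((Num.trunc (2 ^+ n * t))%:R - 2 ^+ n * t) / 2 ^+ n.
  by rewrite mulrBl mulrAC mulfV ?mul1r// gt_eqF.
rewrite normrM [X in _ * X]gtr0_norm ?invr_gt0//; apply: ler_piMl; first by rewrite invr_ge0 ltW.
by rewrite ler_norml; move: h2; rewrite natS; lra.
Qed.

Variables (q : R) (N : nat) (f : R -> R).
Hypotheses (q0 : 0 < q) (q1 : q < 1).
Hypothesis fq : forall n k, (N <= n)%N -> (k < n * 2 ^ n)%N ->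
  `|f (k.+1%:R / 2 ^+ n) - f (k%:R / 2 ^+ n)| <= q ^+ n.

Let trunc_lt n M t : t <= M%:R -> (M < n)%N -> (Num.trunc ((2 : R) ^+ n * t) < n * 2 ^ n)%N.
Proof.
move=> tM Mn; have [t0|t0] := leP 0 t; last first.
  rewrite (_ : Num.trunc _ = 0%N) ?muln_gt0 ?expn_gt0 ?(leq_ltn_trans _ Mn)//.
  by apply/truncn0Pn; rewrite -ltNge (@le_lt_trans _ _ 0)// nmulr_lle0.
rewrite truncn_lt_nat ?mulr_ge0// ?ltW//.
rewrite natrM natrX mulrC ltr_pM2r// (le_lt_trans tM)// ltr_nat//.
Qed.

(** Passing to the finer grid moves the approximation of [t] by at most one cell; the bound [M] on
    [t] keeps that cell in the growing range where increments are controlled. *)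
Let step n M t : t <= M%:R -> (M <= n)%N -> (N <= n)%N ->
  `|f (dyadic n.+1 t) - f (dyadic n t)| <= 1 * q ^+ n.
Proof.
move=> tM Mn Nn.
have qS : q ^+ n.+1 <= 1 * q ^+ n by rewrite mul1r exprS; apply: ler_piMl; [exact/exprn_ge0/ltW|exact: ltW].
have Z : `|f (dyadic n t) - f (dyadic n t)| <= 1 * q ^+ n.
  by rewrite subrr normr0 mul1r; exact/exprn_ge0/ltW.
have [t0|t0] := leP 0 t; last first.
  rewrite (_ : dyadic n.+1 t = dyadic n t)//.
  have E m : Num.trunc ((2 : R) ^+ m * t) = 0%N.
    by apply/truncn0Pn; rewrite -ltNge (@le_lt_trans _ _ 0)// nmulr_lle0.
  by rewrite /dyadic !E !mul0r.
have dE : dyadic n t = (2 * Num.trunc (2 ^+ n * t))%:R / 2 ^+ n.+1.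
  by rewrite /dyadic natrM exprS invfM mulrACA mulfV// mul1r.
have := truncn_double (mulr_ge0 (ltW (p2 n)) t0); rewrite mulrA -exprS => -[h|h].
  by rewrite (_ : dyadic n.+1 t = dyadic n t)// dE /dyadic h.
apply: le_trans qS; rewrite dE {1}/dyadic h; apply: fq; first exact: leqW.
by have := trunc_lt tM (Mn : (M < n.+1)%N); rewrite h => /ltnW.
Qed.

Lemma dyadic_cvg t : cvgn (fun n => f (dyadic n t)).
Proof.
pose M := (Num.trunc t).+1.
have tM : t <= M%:R.
  have [t0|/ltW t0] := leP 0 t; last by rewrite (le_trans t0).
  by have /andP[_ /ltW] := truncn_itv t0.
apply: (@geometric_cvg _ _ 1 q (maxn N M)) => // k.
by rewrite geq_max => /andP[? ?]; exact: (@step _ M).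
Qed.

Lemma dyadic_lim n M t : t <= M%:R -> (M <= n)%N -> (N <= n)%N ->
  `|limn (fun n => f (dyadic n t)) - f (dyadic n t)| <= 1 / (1 - q) * q ^+ n.
Proof.
move=> tM Mn Nn.
apply: (@geometric_lim _ (fun n => f (dyadic n t)) 1 q (maxn N M)) => //.
  by move=> k; rewrite geq_max => /andP[? ?]; exact: (@step _ M).
by rewrite geq_max Nn.
Qed.

Let close n M s t : s <= t -> t <= M%:R -> t - s <= (2 ^+ n)^-1 -> (M < n)%N -> (N <= n)%N ->
  `|f (dyadic n t) - f (dyadic n s)| <= q ^+ n.
Proof.
move=> st tM ts Mn Nn.
have [||E|E] := @truncn_le_succ (2 ^+ n * s) (2 ^+ n * t).
- by rewrite ler_pM2l.
- rewrite -lerBlDl -mulrBr -(@ler_pM2l _ (2 ^+ n)^-1) ?invr_gt0//.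
  by rewrite mulrA mulVf ?gt_eqF// mul1r mulr1.
- by rewrite /dyadic E subrr normr0; exact/exprn_ge0/ltW.
- rewrite /dyadic E; apply: fq => //.
  by apply: (trunc_lt (M := M)) => //; exact: le_trans tM.
Qed.

(** Times at distance at most 2^-n have equal or adjacent grid points at level [n], so their images
    differ by at most [q ^+ n], and each limit is within [q ^+ n / (1 - q)] of its image. *)
Lemma dyadic_continuous : continuous (fun t => limn (fun n => f (dyadic n t))).
Proof.
move=> t; apply/cvgrPdist_lt => e e0.
pose M := (Num.trunc t).+2.
have tM : t + 1 <= M%:R.
  have [t0|/ltW t0] := leP 0 t.
    by have /andP[_ /ltW] := truncn_itv t0; rewrite (natS (Num.trunc t).+1); lra.
  by rewrite (natS (Num.trunc t).+1) natS; have := ler0n R (Num.trunc t); lra.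
pose K := 2 * (1 / (1 - q)) + 1.
have K0 : 0 < K by rewrite addr_gt0// mulr_gt0// divr_gt0// subr_gt0.
have [n [Nn Mn Kn]] : exists n, [/\ (N <= n)%N, (M < n)%N & K * q ^+ n < e].
  have qc : q ^+ n @[n --> \oo] --> (0 : R).
    by apply: cvg_expr; rewrite gtr0_norm.
  have e1 : 0 < e / K by rewrite divr_gt0.
  have := (cvgrPdist_lt _ _).1 qc _ e1 => -[n0 _ H].
  exists (maxn n0 (maxn N M.+1)); split.
  - by rewrite !leq_max leqnn orbT.
  - by rewrite !leq_max leqnn !orbT.
  - have := H (maxn n0 (maxn N M.+1)) (leq_maxl _ _); rewrite sub0r normrN.
    by rewrite gtr0_norm ?exprn_gt0// ltr_pdivlMr// mulrC.
have d0 : 0 < Num.min 1 (2 ^+ n : R)^-1 by rewrite lt_min ltr01 invr_gt0 p2.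
near=> s.
have : `|t - s| < Num.min 1 (2 ^+ n : R)^-1.
  by near: s; apply/nbhs_ballP; exists (Num.min 1 (2 ^+ n : R)^-1).
rewrite lt_min => /andP[s1 s2].
have sM : s <= M%:R by move: s1; rewrite ltr_norml => /andP[? ?]; lra.
have tM' : t <= M%:R by lra.
have ct := dyadic_lim tM' (ltnW Mn) Nn.
have cs := dyadic_lim sM (ltnW Mn) Nn.
have cst : `|f (dyadic n t) - f (dyadic n s)| <= q ^+ n.
  have [st|/ltW ts] := leP s t.
    by apply: (close st tM') => //; rewrite ltW// (le_lt_trans (ler_norm _)).
  rewrite distrC; apply: (close ts sM) => //.
  by rewrite ltW// (le_lt_trans (ler_norm _))// distrC.
apply: le_lt_trans Kn; move: ct cs cst; rewrite /K.
set a := limn _; set b := limn _; set c := f _; set e' := f _; set r := 1 / _; set Q := q ^+ n.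
rewrite !ler_norml => /andP[? ?] /andP[? ?] /andP[? ?].
by apply/andP; split; lra.
Unshelve. all: by end_near. Qed.

End dyadic.

(** * Continuous modification *)

Section continuous_modification.
Context {d : measure_display} {Omega : measurableType d} {R : realType}.
Variable P : probability Omega R.
Local Notation hP := (L2_inner P).
Variable U : R -> {RV P >-> R}.
Variable C : R.
Hypothesis C0 : 0 <= C.
Hypothesis L2U : forall s t, 0 <= s -> 0 <= t -> L2 P (U t - U s).
Hypothesis n2U : forall s t, 0 <= s -> 0 <= t -> n2 hP (U t - U s : {RV P >-> R}) = `|t - s|.
Hypothesis tailU : forall s t a, 0 <= s -> 0 <= t -> 0 < a ->
  (P [set w | (a <= `|(U t - U s : {RV P >-> R}) w|)%R] <= (C * `|t - s| ^+ 2 / a ^+ 4)%:E)%E.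

(* [2 * q ^ 4 > 1], so that the union bound over the [n * 2 ^ n] increments is summable. *)
Let q : R := 9 / 10.
Let q0 : 0 < q. Proof. by rewrite /q; lra. Qed.
Let q1 : q < 1. Proof. by rewrite /q; lra. Qed.

Let jump n k : {RV P >-> R} := U (k.+1%:R / 2 ^+ n) - U (k%:R / 2 ^+ n).
Let E n k := [set w | q ^+ n <= `|jump n k w|].
Let A n := \big[setU/set0]_(k < n * 2 ^ n) E n k.

Let p2 n : 0 < (2 ^+ n : R). Proof. by rewrite exprn_gt0. Qed.

Let mE n k : measurable (E n k).
Proof.
have -> : E n k = jump n k @^-1` ((fun x : R => `|x|) @^-1` `[q ^+ n, +oo[).
  by apply/seteqP; split => x /=; rewrite in_itv/= andbT.
rewrite -[_ @^-1` _]setTI; apply: RV_measurable => //.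
by rewrite -[_ @^-1` _]setTI; exact: normr_measurable.
Qed.

Let mA n : measurable (A n).
Proof. by apply: bigsetU_measurable => k _; exact: mE. Qed.

Let PE n k : (P (E n k) <= (C * ((4 * q ^+ 4) ^- n))%:E)%E.
Proof.
have k0 (m : nat) : 0 <= m%:R / 2 ^+ n :> R by rewrite divr_ge0// ltW.
apply: (le_trans (tailU (k0 k) (k0 k.+1) (exprn_gt0 n q0))).
have -> : `|k.+1%:R / 2 ^+ n - k%:R / 2 ^+ n| = (2 ^+ n)^-1 :> R.
  by rewrite -mulrBl -natr1 addrC addKr mul1r gtr0_norm// invr_gt0.
rewrite lee_fin -mulrA ler_wpM2l// le_eqVlt; apply/orP; left; apply/eqP.
rewrite exprVn -invfM; congr (_^-1).
have -> : 4 = 2 ^+ 2 :> R by ring.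
by rewrite [RHS]exprMn -!exprM [(n * 2)%N]mulnC [(n * 4)%N]mulnC.
Qed.

(** The union bound gives n 2^n / (4 q^4)^n = n (5000 / 6561)^n up to the constant [C], and the
    factor n is absorbed through n <= 10 (11 / 10)^n. *)
Let PA n : (P (A n) <= (C * 10 * (5500 / 6561) ^+ n)%:E)%E.
Proof.
apply: (le_trans (Boole_inequality P (fun k _ => mE n k))).
apply: (@le_trans _ _ (\sum_(k < n * 2 ^ n) (C * ((4 * q ^+ 4) ^- n))%:E)%E).
  by apply: lee_sum => k _; exact: PE.
rewrite sumEFin lee_fin sumr_const card_ord -(mulr_natr _ (n * 2 ^ n)) natrM natrX.
have -> : C * (4 * q ^+ 4) ^- n * (n%:R * 2 ^+ n) = C * (n%:R * (5000 / 6561) ^+ n).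
  rewrite -!mulrA; congr (_ * _); rewrite mulrCA -exprVn -exprMn; congr (_ * _ ^+ _).
  by rewrite /q; field.
have -> : (5500 / 6561 : R) = 11 / 10 * (5000 / 6561) by field.
have : 0 <= (5000 / 6561 : R) by lra.
move: (5000 / 6561 : R) => y y0.
have -> : C * 10 * (11 / 10 * y) ^+ n = C * (10 * (11 / 10) ^+ n * y ^+ n).
  by rewrite exprMn; ring.
apply: ler_wpM2l => //; apply: ler_wpM2r; first exact: exprn_ge0.
elim: n => [|n IH]; first by rewrite expr0; lra.
have : 1 <= (11 / 10 : R) ^+ n by apply: exprn_ege1; lra.
rewrite -[n.+1%:R]natr1 exprS; move: IH; set x := _ ^+ n => IH x1; lra.
Qed.

Let G := ~` lim_sup_set A.

Let mlim : measurable (lim_sup_set A).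
Proof.
apply: bigcap_measurable => // n _; apply: bigcup_measurable => // k _; exact: mA.
Qed.

Let mG : measurable G. Proof. exact: measurableC. Qed.

Let Plim : P (lim_sup_set A) = 0%E.
Proof.
apply: lim_sup_set_cvg0 => //.
apply: (@le_lt_trans _ _ (C * 10 / (1 - 5500 / 6561))%:E); last exact: ltry.
apply: lime_le; first by apply: is_cvg_nneseries => n _ _.
apply: nearW => n; rewrite /= big_mkord.
apply: (@le_trans _ _ (\sum_(k < n) (C * 10 * (5500 / 6561) ^+ k)%:E)%E).
  by apply: lee_sum => k _; exact: PA.
rewrite sumEFin lee_fin -mulr_sumr ler_wpM2l ?mulr_ge0//.
have -> : (1 - 5500 / 6561)^-1 = 6561 / 1061 :> R by field.
elim: n => [|n IH]; first by rewrite big_ord0; lra.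
rewrite big_ord_recl expr0.
have -> : \sum_(i < n) (5500 / 6561) ^+ lift ord0 i = 5500 / 6561 * \sum_(i < n) (5500 / 6561) ^+ i :> R.
  by rewrite mulr_sumr; apply: eq_bigr => i _; rewrite -exprS.
move: IH; set x := \sum_(_ < _) _ => IH; lra.
Qed.

Let aeG : \forall w \ae P, G w.
Proof.
exists (lim_sup_set A); split => //.
by move=> w nG; apply: contrapT.
Qed.

(** Multiplying by the indicator of [G], an event of probability 1 by Borel-Cantelli, makes every
    path satisfy the bound on increments, and not only almost every path. *)
Let path w x : R := \1_G w * U x w.

Let path_bound w : exists N, forall n k, (N <= n)%N -> (k < n * 2 ^ n)%N ->
  `|path w (k.+1%:R / 2 ^+ n) - path w (k%:R / 2 ^+ n)| <= q ^+ n.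
Proof.
have [Gw|Gw] := pselect (G w); last first.
  exists 0%N => n k _ _; rewrite /path indicE memNset// !mul0r subrr normr0.
  exact/exprn_ge0/ltW.
have /existsNP[N /not_implyP[_ HN]] := Gw.
exists N => n k Nn kn; rewrite /path indicE mem_set// !mul1r.
rewrite leNgt; apply/negP => h; apply: HN; exists n => //.
by rewrite /A -bigcup_mkord; exists k => //=; exact: ltW.
Qed.

Let T0 t w : R := limn (fun n => path w (dyadic n t)).

Let T0_cvg t w : path w (dyadic n t) @[n --> \oo] --> T0 t w.
Proof. by have [N HN] := path_bound w; exact: (@dyadic_cvg _ q N). Qed.

Let mpath x : measurable_fun [set: Omega] (fun w => path w x).
Proof.
apply: measurable_funM; [exact: measurable_indic|exact: RV_measurable].
Qed.

Let T0_measurable t : measurable_fun [set: Omega] (T0 t).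
Proof.
apply: (@measurable_fun_cvg _ _ _ _ (fun n w => path w (dyadic n t))) => [n|w _].
  exact: mpath.
exact: T0_cvg.
Qed.

(** The dyadic approximations of [t] converge to it, so [U] converges along them in mean square;
    Fatou's lemma identifies the pathwise limit with [U t]. *)
Let T0_modification t : 0 <= t -> T0 t = U t %[ae P].
Proof.
move=> t0; pose D n w := path w (dyadic n t) - path w t.
have mD n : measurable_fun [set: Omega] (D n) by apply: measurable_funB; exact: mpath.
pose g w := T0 t w - path w t.
have mg : measurable_fun [set: Omega] g by apply: measurable_funB => //; exact: mpath.
have Dg w : D n w @[n --> \oo] --> g w by apply: cvgB; [exact: T0_cvg|exact: cvg_cst].
have Dle n : (\int[P]_w (D n w ^+ 2)%:E <= ((2 ^+ n)^-1)%:E)%E.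
  apply: (@le_trans _ _ (\int[P]_w ((U (dyadic n t) - U t : {RV P >-> R}) w ^+ 2)%:E)%E).
    apply: ge0_le_integral => //.
    - by move=> w _; exact: sqr_EFin_ge0.
    - exact: measurable_EFin_sqr.
    - by apply: measurable_EFin_sqr; exact: RV_measurable.
    - by move=> w _; rewrite lee_fin /D /path -mulrBr exprMn ler_piMl ?sqr_ge0//.
  have L2D := L2U t0 (dyadic_ge0 n t).
  rewrite (L2_sqE L2D) lee_fin n2U//; last exact: dyadic_ge0.
  exact: dyadic_dist.
have g0 (e : R) : 0 < e -> (\int[P]_w (g w ^+ 2)%:E <= e%:E)%E.
  move=> e0; apply: (fatou_sqr mD Dg).
  have qc : (2^-1) ^+ n @[n --> \oo] --> (0 : R).
    by apply: cvg_expr; rewrite gtr0_norm; lra.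
  have := (cvgrPdist_lt _ _).1 qc _ e0 => -[N _ H]; exists N => n Nn.
  apply: (le_trans (Dle n)); rewrite lee_fin -exprVn.
  by have := H n Nn; rewrite sub0r normrN => /ltW; apply: le_trans; exact: ler_norm.
have L2g : L2 P g.
  by split => //; apply: le_lt_trans (g0 1 ltr01) (ltry _).
have g2 : n2 hP g = 0.
  apply/le_anti; rewrite n2_ge0 andbT; apply: le_epsilon0 => e /g0.
  by rewrite (L2_sqE L2g) lee_fin.
have := n2_eq0_ae L2g g2.
apply: (@filterS2 _ _ (ae_filter_ringOfSetsType P)) aeG => w /= Gw.
move=> /(_ I) + _; rewrite /g /path indicE mem_set// mul1r => /eqP.
by rewrite subr_eq0 => /eqP.
Qed.

Lemma continuous_modification : exists T : R -> {RV P >-> R},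
  (forall t, 0 <= t -> T t = U t %[ae P]) /\
  forall w, continuous (fun t => T t w).
Proof.
have /choice[T TE] t : exists X : {RV P >-> R}, (X : Omega -> R) = T0 t.
  exact/mfun_exists/T0_measurable.
exists T; split => [t t0|w]; first by rewrite TE; exact: T0_modification.
rewrite (_ : (fun t => T t w) = fun t => T0 t w); last by apply/funext => t; rewrite TE.
by have [N HN] := path_bound w; exact: (@dyadic_continuous _ q N).
Qed.

End continuous_modification.

(** * Ornstein-Uhlenbeck and Brownian processes in the Gaussian space *)

Section processes.
Context {d : measure_display} {Omega : measurableType d} {R : realType}.
Variable P : probability Omega R.
Local Notation hP := (L2_inner P).
Variable W : R -> {RV P >-> R}.
Hypothesis W_bm : brownian setT W.

Let gW : gaussian_process setT W. Proof. by case: W_bm. Qed.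
Let cW : centered setT W. Proof. by case: W_bm. Qed.
Let iW : independent_increments setT W. Proof. by case: W_bm. Qed.
Let W2 u v : 'E_P[((W u - W v) ^+ 2)%R]%E = `|u - v|%:E.
Proof. by case: W_bm => _ _ _ _; exact. Qed.

Lemma gset_gaussian_process (D : set R) (X : R -> {RV P >-> R}) :
  (forall t, D t -> gset W (X t)) -> gaussian_process D X.
Proof.
move=> gX n t c Dt; apply: (gset_gaussian gW cW W2).
by apply: gset_sum => // i; exact/gX/Dt.
Qed.

(** The covariance is invariant under translation of time, and in the Gaussian space covariances
    determine joint laws. *)
Lemma gset_ornstein_uhlenbeck (X : R -> {RV P >-> R}) : (forall u, gset W (X u)) ->
  (forall u v, dot hP (X u) (X v) = expR (- `|u - v| / 2)) -> ornstein_uhlenbeck X.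
Proof.
move=> gX XX; split.
- by apply: gset_gaussian_process.
- by move=> u _; exact: (gset_expectation cW W2).
- move=> n u h A mA.
  apply: (@tuple_law _ _ _ P n (fun i => X (u i + h)) (fun i => X (u i))) => // B mB.
  apply: (gset_joint_law gW cW W2) => // i j; rewrite !XX.
  by rewrite opprD addrACA subrr addr0.
- by move=> u v; rewrite -XX expectation_dot//; exact: gset_L2 (gX _).
Qed.

Lemma gset_brownian (X : R -> {RV P >-> R}) : (forall t, 0 <= t -> gset W (X t)) ->
  (forall u v, 0 <= u -> 0 <= v -> n2 hP (X u - X v : {RV P >-> R}) = `|u - v|) ->
  X 0 = cst 0 %[ae P] ->
  exists T : R -> {RV P >-> R},
    (forall t, 0 <= t -> T t = X t %[ae P]) /\ standard_brownian T.
Proof.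
move=> gX X2 X0.
have [C C0 tail] := gset_tail gW cW W2.
have gB u v : 0 <= u -> 0 <= v -> gset W (X v - X u).
  by move=> u0 v0; apply: gsetB => //; exact: gX.
have [s t s0 t0|s t s0 t0|s t a s0 t0 a0|T [TX Tc]] := @continuous_modification _ _ _ P X C C0.
- by apply: (@gset_L2 _ _ _ P W); exact: gB.
- by rewrite X2.
- by rewrite -X2//; apply: tail => //; exact: gB.
have gT t : 0 <= t -> gset W (T t).
  move=> t0; apply: (gset_ae W2) (gX t t0).
  by apply: filterS (TX _ t0) => w H /H.
have T2 u v : 0 <= u -> 0 <= v -> n2 hP (T u - T v : {RV P >-> R}) = `|u - v|.
  move=> u0 v0; rewrite -X2//.
  have L2uv : L2 P (T u - T v : {RV P >-> R}).
    by apply: (@gset_L2 _ _ _ P W); apply: gsetB => //; exact: gT.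
  have L2X : L2 P (X u - X v : {RV P >-> R}) by apply: (@gset_L2 _ _ _ P W); exact: gB.
  apply: EFin_inj; rewrite -(L2_sqE L2uv) -(L2_sqE L2X).
  apply: L2_ae_eq; [by case: L2uv|by case: L2X|].
  apply: (@filterS2 _ _ (ae_filter_ringOfSetsType P)) (TX u u0) (TX v v0) => w Hu Hv _.
  by change (T u w - T v w = X u w - X v w); rewrite Hu ?Hv.
have pos (t : R) : `[0, +oo[%classic t -> 0 <= t by rewrite /= in_itv/= andbT.
exists T; split => //; split.
- split.
  + by apply: gset_gaussian_process => t /pos; exact: gT.
  + by move=> t /pos t0; apply: (gset_expectation cW W2); exact: gT.
  + by apply: nearW => w; exact: continuous_subspaceT (Tc w).
  + apply: (gset_independent_increments gW cW W2) => // [t /pos|u v /pos u0 /pos v0].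
      exact: gT.
    exact: T2.
  + move=> u v /pos u0 /pos v0; rewrite expectation_n2 ?T2//.
    by apply: (@gset_L2 _ _ _ P W); apply: gsetB => //; exact: gT.
- by apply: (@filterS2 _ _ (ae_filter_ringOfSetsType P)) (TX 0 (lexx _)) X0 => w /= H1 H2 _; rewrite H1 ?H2.
Qed.

End processes.

(** * Exponential integrals, and the divergent case for random variables *)

Section exponential_integrals.
Context {d : measure_display} {Omega : measurableType d} {R : realType}.
Variable P : probability Omega R.
Local Notation mu := (@lebesgue_measure R).
Local Notation hR := (L2_inner mu).
Local Notation hP := (L2_inner P).
Local Notation hh := (prod_inner hR hP).
Variables (W B : R -> {RV P >-> R}) (p : nat -> R).
Hypothesis p0 : forall j, 0 < p j.
Hypothesis W2 : forall u v, 'E_P[((W u - W v) ^+ 2)%R]%E = `|u - v|%:E.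
Hypothesis B_gt0 : forall t, 0 < t ->
      wiener_integral W `]-oo, ln t] (fun r => expR (r / 2)) (B t).

Definition exp_integrals u : set {RV P >-> R} :=
  [set Y | exists j, wiener_integral W `]-oo, u] (fun r => expR (p j * r)) Y].

Definition exp_pairs u : set ((R -> R) * (Omega -> R)) :=
  [set q | exists j (Y : {RV P >-> R}),
     wiener_integral W `]-oo, u] (fun r => expR (p j * r)) Y /\
     q = (expR (p j * u) *: kexp (p j) u, Y : Omega -> R)].

Lemma exp_integralP j u (Y : {RV P >-> R}) :
  wiener_integral W `]-oo, u] (fun r => expR (p j * r)) Y <->
  Wpairs W u (expR (p j * u) *: kexp (p j) u, Y : Omega -> R).
Proof.
rewrite -zero_ext_exp; exact: (Wpairs_integral W2).
Qed.

Lemma exp_pairs_Wpairs u : exp_pairs u `<=` Wpairs W u.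
Proof. by move=> _ [j [Y [/exp_integralP HY ->]]]. Qed.

Lemma Wpairs_RV u F X : Wpairs W u (F, X) ->
  exists Y : {RV P >-> R}, (Y : Omega -> R) = X.
Proof. by move=> /cl_dom[_ [mX _]]; exact: mfun_exists. Qed.

Lemma exp_integral_exists j u : exists Y : {RV P >-> R},
  wiener_integral W `]-oo, u] (fun r => expR (p j * r)) Y.
Proof.
have [X HX] := Wpairs_kexp W2 B_gt0 u (p0 j).
have [Y YX] := Wpairs_RV HX.
exists (expR (p j * u) *: Y); apply/exp_integralP.
rewrite -YX in HX.
exact: (@clZ _ _ hh (increments `]-oo, u] W) (expR (p j * u)) _ (incr_L2 W2 (D := `]-oo, u])) HX).
Qed.

Lemma fst_exp_pairs u : pexps p u `<=` span (fst @` exp_pairs u).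
Proof.
move=> _ [j _ <-]; have [Y HY] := exp_integral_exists j u.
have -> : kexp (p j) u = (expR (p j * u))^-1 *: (expR (p j * u) *: kexp (p j) u).
  by rewrite scalerA mulVf ?scale1r// gt_eqF// expR_gt0.
apply: spanZ; apply: sub_span.
by exists (expR (p j * u) *: kexp (p j) u, Y : Omega -> R) => //; exists j, Y.
Qed.

Lemma snd_exp_pairs u : snd @` exp_pairs u = fns (exp_integrals u).
Proof.
apply/seteqP; split=> [_ [_ [j [Y [HY ->]]] <-]|_ [Y [j HY] <-]].
  by exists Y => //; exists j.
by exists (expR (p j * u) *: kexp (p j) u, Y : Omega -> R) => //; exists j, Y.
Qed.

Lemma exp_integrals_L2 u Y : exp_integrals u Y -> L2 P Y.
Proof. by move=> [j /exp_integralP /cl_dom[]]. Qed.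

Hypothesis p_inj : injective p.
Hypothesis pdiv : ~ (\sum_(0 <= j <oo) (p j / (p j ^+ 2 + 1))%:E < +oo)%E.

(** The transfer of [divergent_cl_pexps] by the Wiener isometry: the exponential integrals generate
    the whole space of [W] at time [u]. *)
Lemma divergent_closed_span u F (X : {RV P >-> R}) :
  Wpairs W u (F, X : Omega -> R) -> closed_span (exp_integrals u) X.
Proof.
move=> HX; apply/closed_spanP; first exact: exp_integrals_L2.
rewrite -snd_exp_pairs; apply/(Wpairs_sndP W2 _ (@exp_pairs_Wpairs u)); last by exists F.
move=> z z0; have fD : fst @` exp_pairs u `<=` dom hR.
  by move=> _ [q /exp_pairs_Wpairs /cl_dom[D1 _] <-].
apply: (cl_sub fD) (divergent_cl_pexps p0 p_inj pdiv u z0).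
by move=> f /fst_exp_pairs; exact: span_cl.
Qed.

(** [X] belongs to both summands and is therefore orthogonal to itself. *)
Lemma divergent_orthogonal u F (X : {RV P >-> R}) (H A : set {RV P >-> R}) :
  Wpairs W u (F, X : Omega -> R) -> A X -> (forall Y, A Y -> L2 P Y) ->
  orthogonal_sum H (closed_span A) (closed_span (exp_integrals u)) ->
  'E_P[(X * X)%R]%E = 0%E.
Proof.
move=> HX AX AL2 [HO _]; apply: HO; last exact: divergent_closed_span HX.
apply/closed_spanP => //; apply: sub_cl; last by exists X.
by move=> _ [Y AY <-]; exact: AL2.
Qed.

End exponential_integrals.

(** * The process S in the convergent case *)

Section muntz_process.
Context {d : measure_display} {Omega : measurableType d} {R : realType}.
Variable P : probability Omega R.
Local Notation mu := (@lebesgue_measure R).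
Local Notation hR := (L2_inner mu).
Local Notation hP := (L2_inner P).
Local Notation hh := (prod_inner hR hP).
Variables (W B : R -> {RV P >-> R}) (p : nat -> R).
Hypothesis p0 : forall j, 0 < p j.
Hypothesis p_inj : injective p.
Hypothesis pfin : (\sum_(0 <= j <oo) (p j / (p j ^+ 2 + 1))%:E < +oo)%E.
Hypothesis W_bm : brownian setT W.
Hypothesis B_gt0 : forall t, 0 < t ->
      wiener_integral W `]-oo, ln t] (fun r => expR (r / 2)) (B t).

Let W2 u v : 'E_P[((W u - W v) ^+ 2)%R]%E = `|u - v|%:E.
Proof. by case: W_bm => _ _ _ _; exact. Qed.

Local Notation eta := (muntz_eta p0 p_inj pfin).
Local Notation eta_u := (eta_at p0 p_inj pfin).

Lemma muntz_eta_lt0 x : x < 0 -> eta x = 0.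
Proof. by move=> x0; rewrite /muntz_eta leNgt x0. Qed.

Lemma zero_ext_eta_at u : zero_ext `]-oo, u] (eta_u u) = eta_u u.
Proof.
apply/funext => r; rewrite /zero_ext patchE; case: ifPn => // /negP.
rewrite inE /= in_itv/= => /negP; rewrite -ltNge => ur.
by rewrite /eta_at muntz_eta_lt0// subr_lt0.
Qed.

Lemma measurable_muntz_eta : measurable_fun [set: R] eta.
Proof.
have -> : (eta : R -> R) = eta_u 0 \o -%R.
  by apply/funext => x; rewrite /eta_at /= opprK add0r.
by apply: measurableT_comp; [case: (L2_eta_at p0 p_inj pfin 0)|exact: oppr_measurable].
Qed.

Lemma square_integrable_muntz_eta : square_integrable `[0, +oo[ eta.
Proof.
split; first by apply: measurable_funTS; exact: measurable_muntz_eta.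
have [_] := L2_eta_at p0 p_inj pfin 0; apply: le_lt_trans.
have m2 := measurable_EFin_sqr measurable_muntz_eta.
rewrite (ge0_integral_reflection 0 m2) => [|x]; last exact: sqr_EFin_ge0.
by apply: ge0_subset_integral => // x _; exact: sqr_EFin_ge0.
Qed.

Lemma muntz_process_exists : exists S : R -> {RV P >-> R},
  forall u, Wpairs W u (eta_u u, S u : Omega -> R).
Proof.
have /choice[S HS] u : exists Y : {RV P >-> R}, Wpairs W u (eta_u u, Y : Omega -> R).
  have [X HX] := Wpairs_eta W2 B_gt0 (cl_exps_eta_at p0 p_inj pfin u).
  by have [Y YX] := Wpairs_RV HX; exists Y; rewrite YX.
by exists S.
Qed.

Variable S : R -> {RV P >-> R}.
Hypothesis HS : forall u, Wpairs W u (eta_u u, S u : Omega -> R).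

Lemma muntz_process_integral u : wiener_integral W `]-oo, u] (fun v => eta (u - v)) (S u).
Proof. by apply/(Wpairs_integral W2); rewrite -[X in zero_ext _ X]/(eta_u u) zero_ext_eta_at. Qed.

Lemma muntz_process_L2 u : L2 P (S u).
Proof. by case: (cl_dom (HS u)). Qed.

Lemma muntz_process_dot u v : dot hP (S u) (S v) = expR (- `|u - v| / 2).
Proof.
wlog vu : u v / v <= u.
  move=> H; have [/H//|/ltW/H] := leP v u.
  by rewrite dotC distrC.
have := Wpairs_isometric W2 (HS u) (Wpairs_mono vu (HS v)).
rewrite -[X in X = _ -> _]/(dot hR (eta_u u) (eta_u v)) (dot_eta_at p0 p_inj pfin vu).
by rewrite -[X in _ = X -> _]/(dot hP (S u) (S v)) => <-; rewrite ger0_norm// subr_ge0.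
Qed.

Lemma muntz_process_ou : ornstein_uhlenbeck S.
Proof.
apply: (gset_ornstein_uhlenbeck W_bm) => [u|u v]; last exact: muntz_process_dot.
exact: gset_Wpairs (HS u).
Qed.

Lemma muntz_process_dot_exp u r Y : r <= u -> exp_integrals W p u Y ->
  dot hP (S r) Y = 0.
Proof.
move=> ru [j /(exp_integralP p W2) HY].
have := Wpairs_isometric W2 (Wpairs_mono ru (HS r)) HY.
rewrite -[X in X = _ -> _]/(dot hR (eta_u r) (expR (p j * u) *: kexp (p j) u)).
rewrite -[X in _ = X -> _]/(dot hP (S r) Y) => <-.
rewrite dotZr; [|exact: L2_eta_at|exact: L2_kexp].
by rewrite dot_eta_at_pexp// mulr0.
Qed.

Let S_L2 u Y : (S @` `]-oo, u]) Y -> L2 P Y.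
Proof. by move=> [r _ <-]; exact: muntz_process_L2. Qed.

(** The image of [cl_etas_pexps] under the Wiener isometry. *)
Lemma muntz_process_generates u (Z : {RV P >-> R}) :
  (exists F, Wpairs W u (F, Z : Omega -> R)) <->
  cl hP (fns (S @` `]-oo, u]) `|` fns (exp_integrals W p u)) Z.
Proof.
pose Q : set ((R -> R) * (Omega -> R)) :=
  [set (eta_u r, S r : Omega -> R) | r in `]-oo, u]] `|` exp_pairs W p u.
have QW : Q `<=` Wpairs W u.
  move=> q [[r /= ru <-]|]; last exact: exp_pairs_Wpairs.
  by apply: Wpairs_mono (HS r); move: ru; rewrite in_itv.
have -> : fns (S @` `]-oo, u]) `|` fns (exp_integrals W p u) = snd @` Q.
  rewrite image_setU snd_exp_pairs; congr (_ `|` _).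
  rewrite /fns !image_comp; apply: eq_imagel => r _ //.
apply: (Wpairs_sndP W2) => // z z0.
have fD : fst @` Q `<=` dom hR by move=> _ [q /QW /cl_dom[D1 _] <-].
apply: (cl_sub fD) (cl_etas_pexps p0 p_inj pfin u z0) => f [[r ru <-]|].
  by apply: sub_cl => //; exists (eta_u r, S r : Omega -> R) => //; left; exists r.
move=> /(fst_exp_pairs p0 W2 B_gt0) Hf; apply: span_cl => //.
by apply: span_mono Hf; apply: image_subset; exact: subsetUr.
Qed.

Lemma muntz_process_orthogonal_sum u : orthogonal_sum (wiener_space W u)
  (closed_span (S @` `]-oo, u])) (closed_span (exp_integrals W p u)).
Proof.
apply: orthogonal_sum_cl.
- exact: S_L2.
- exact: exp_integrals_L2.
- move=> _ Y [r /= ru <-]; apply: muntz_process_dot_exp.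
  by move: ru; rewrite in_itv.
- by move=> Z; rewrite -muntz_process_generates; exact: (wiener_spaceP W2).
Qed.

End muntz_process.

(** * The process T in the convergent case *)

Section brownian_transform.
Context {d : measure_display} {Omega : measurableType d} {R : realType}.
Variable P : probability Omega R.
Local Notation mu := (@lebesgue_measure R).
Local Notation hR := (L2_inner mu).
Local Notation hP := (L2_inner P).
Local Notation hh := (prod_inner hR hP).
Variables (W B : R -> {RV P >-> R}) (lambda p : nat -> R).
Hypothesis p0 : forall j, 0 < p j.
Hypothesis pE : forall j, p j = lambda j + 1 / 2.
Hypothesis W_bm : brownian setT W.
Hypothesis B_bm : standard_brownian B.
Hypothesis B_gt0 : forall t, 0 < t ->
      wiener_integral W `]-oo, ln t] (fun r => expR (r / 2)) (B t).

Let W2 u v : 'E_P[((W u - W v) ^+ 2)%R]%E = `|u - v|%:E.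
Proof. by case: W_bm => _ _ _ _; exact. Qed.

Let B2 u v : 0 <= u -> 0 <= v -> 'E_P[((B u - B v) ^+ 2)%R]%E = `|u - v|%:E.
Proof. by case: B_bm => -[_ _ _ _ H] _ u0 v0; apply: H; rewrite /= in_itv/= andbT. Qed.

Let B0 : B 0 = cst 0 %[ae P]. Proof. by case: B_bm. Qed.

Let p_inj : injective lambda -> injective p.
Proof. by move=> li i j; rewrite !pE => /addIr /li. Qed.

Definition power_integrals t : set {RV P >-> R} :=
  [set Y | exists j, wiener_integral B `[0, t] (fun s => s `^ lambda j) Y].

Lemma exp_integrandE j :
  (fun r => expR (p j * r)) = (fun r => expR (r / 2) * expR r `^ lambda j).
Proof.
by apply/funext => r; rewrite -expRM -expRD pE; congr expR; field.
Qed.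

(** Since [p j] is [lambda j + 1 / 2], the Lamperti map turns the power of exponent [lambda j] into
    the exponential of rate [p j], and the two integrals are the same random variables. *)
Lemma power_integralsE t : 0 < t -> power_integrals t = exp_integrals W p (ln t).
Proof.
move=> t0; have mf j : measurable_fun (`[0, t] : set R) (fun s => s `^ lambda j).
  by apply: measurable_funTS; exact: measurable_powR.
apply/seteqP; split => Y [j HY]; exists j.
  have [Z HZ] := exp_integral_exists p0 W2 B_gt0 j (ln t).
  rewrite exp_integrandE in HZ *.
  exact: (W_integral_of_B W2 B2 B0 B_gt0 t0 (mf j) HY HZ).
apply: (Bincr_integral_of_W W2 B2 B0 B_gt0 t0 (mf j)).
by rewrite -exp_integrandE.
Qed.

Lemma Bincr_integral_ae t f (X Y : {RV P >-> R}) : X = Y %[ae P] ->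
  wiener_integral B `[0, t] f X -> wiener_integral B `[0, t] f Y.
Proof.
move=> XY /(Bincr_integral B2) H; apply/(Bincr_integral B2).
have [DF DX] := cl_dom H.
have L2Y : L2 P Y by apply: ae_L2 XY => //; exact: RV_measurable.
have iB : increments `[0, t] B `<=` dom hh.
  apply: increments_L2 => u v /= ; rewrite !in_itv/= => /andP[u0 _] /andP[v0 _]; exact: B2.
apply: (cl_eq0 (h := hh) (x := (zero_ext `[0, t] f, X : Omega -> R)) iB) => //.
transitivity (n2 hR (zero_ext `[0, t] f - zero_ext `[0, t] f) + n2 hP ((X : Omega -> R) - (Y : Omega -> R))).
  exact: n2_prodE.
rewrite subrr n2_0 add0r.
by apply: ae_n2_eq0 => //; exact: RV_measurable.
Qed.

Section convergent.
Hypothesis p_inj' : injective p.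
Hypothesis pfin : (\sum_(0 <= j <oo) (p j / (p j ^+ 2 + 1))%:E < +oo)%E.
Local Notation eta := (muntz_eta p0 p_inj' pfin).
Local Notation eta_u := (eta_at p0 p_inj' pfin).

(** sqrt y eta (ln y) for y > 0: with it, the Lamperti image of s -> rho (t / s) is sqrt t eta (ln t
    - r), as [lamperti_rho] states. *)
Definition muntz_rho y := expR (ln y / 2) * eta (ln y) * \1_`]0, +oo[ y.

Lemma muntz_rhoE (t s : R) : 0 < t -> muntz_rho (t / s) =
  expR ((ln t - ln s) / 2) * eta_u (ln t) (ln s) * \1_`]0, +oo[ s.
Proof.
move=> t0; rewrite /muntz_rho !indicE.
have E (x : R) : (x \in `]0, +oo[%classic) = (0 < x).
  by apply/idP/idP; rewrite inE /= in_itv/= andbT.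
rewrite !E; have [s0|s0] := ltP 0 s; last first.
  by rewrite ltNge mulr_ge0_le0 ?invr_le0// ?ltW// !mulr0.
by rewrite divr_gt0// ln_div.
Qed.

Lemma measurable_muntz_rho : measurable_fun [set: R] muntz_rho.
Proof.
apply: measurable_funM; last by apply: measurable_indic.
apply: measurable_funM.
  apply: measurableT_comp => //; apply: measurable_funM => //; exact: measurable_ln.
by apply: measurableT_comp (measurable_muntz_eta _ _ _) _; exact: measurable_ln.
Qed.

Lemma measurable_muntz_rho_div (t : R) : 0 < t ->
  measurable_fun [set: R] (fun s => muntz_rho (t / s)).
Proof.
move=> t0; under eq_fun do rewrite muntz_rhoE//.
apply: measurable_funM; last by apply: measurable_indic.
apply: measurable_funM.
  apply: measurableT_comp => //; apply: measurable_funM => //.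
  by apply: measurable_funB => //; exact: measurable_ln.
apply: measurableT_comp (measurable_muntz_eta _ _ _) _.
by apply: measurable_funB => //; exact: measurable_ln.
Qed.

Lemma lamperti_rho (t r : R) : 0 < t ->
  expR (r / 2) * muntz_rho (t / expR r) = expR (ln t / 2) * eta_u (ln t) r.
Proof.
move=> t0; rewrite muntz_rhoE// expRK indicE mem_set ?mulr1; last first.
  by rewrite /= in_itv/= andbT expR_gt0.
by rewrite mulrA -expRD; congr (expR _ * _); field.
Qed.

Lemma class_M_muntz_rho : class_M muntz_rho.
Proof.
split; first by apply: measurable_funTS; exact: measurable_muntz_rho.
pose f (v : R) := muntz_rho (1 / v).
have mf : measurable_fun [set: R] f := measurable_muntz_rho_div ltr01.
have f0 (x : R) : x <= 0 -> f x = 0.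
  move=> x0; rewrite /f muntz_rhoE// indicE memNset ?mulr0//.
  by rewrite /= in_itv/= andbT ltNge x0.
have [_] := L2_eta_at p0 p_inj' pfin 0.
have -> : eta_u 0 = lamperti f.
  apply/funext => r; rewrite /lamperti /f lamperti_rho// ln1 mul0r expR0 mul1r//.
rewrite integral_lamperti//; apply: le_lt_trans.
have -> : (\int[mu]_(v in `]0%R, 1%R]) (muntz_rho v^-1 ^+ 2)%:E =
    \int[mu]_(v in `]0%R, 1%R]) (f v ^+ 2)%:E)%E.
  by apply: eq_integral => v _; rewrite /f div1r.
apply: ge0_subset_integral => //.
  exact: measurable_EFin_sqr.
by move=> x _; exact: sqr_EFin_ge0.
Qed.

Variable S : R -> {RV P >-> R}.
Hypothesis HS : forall u, Wpairs W u (eta_u u, S u : Omega -> R).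

(** The Lamperti transform sqrt t S (ln t), which turns the Ornstein-Uhlenbeck covariance into the
    minimum of the two times. Its paths need not be continuous; the process of the theorem is a
    modification of it. *)
Definition muntz_T t : {RV P >-> R} := if 0 < t then expR (ln t / 2) *: S (ln t) else 0.

Let SL2 u : L2 P (S u) := muntz_process_L2 HS u.
Let Sdot := muntz_process_dot W_bm HS.

Lemma gset_muntz_T t : gset W (muntz_T t).
Proof.
rewrite /muntz_T; case: ifP => _; last exact: (gset0 W2).
by apply: (gsetZ W2); exact: gset_Wpairs (HS _).
Qed.

Lemma dot_muntz_T u v : 0 < u -> 0 < v -> u <= v -> dot hP (muntz_T u) (muntz_T v) = u.
Proof.
move=> u0 v0 uv; rewrite /muntz_T u0 v0.
transitivity (expR (ln u / 2) * (expR (ln v / 2) * dot hP (S (ln u)) (S (ln v)))).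
  transitivity (dot hP (expR (ln u / 2) *: (S (ln u) : Omega -> R)) (expR (ln v / 2) *: (S (ln v) : Omega -> R))); first by [].
  rewrite dotZl ?dotZr//; try exact: SL2.
  by apply: (domZ (s := hP)); exact: SL2.
rewrite Sdot distrC ger0_norm ?subr_ge0 ?ler_ln// mulrA -!expRD.
by rewrite -[RHS]lnK//; congr expR; field.
Qed.

Lemma n2_muntz_T u v : 0 <= u -> 0 <= v ->
  n2 hP (muntz_T u - muntz_T v : {RV P >-> R}) = `|u - v|.
Proof.
have TL2 t : L2 P (muntz_T t) := gset_L2 (gset_muntz_T t).
wlog uv : u v / u <= v.
  move=> H u0 v0; have [/H|/ltW/H] := leP u v; first exact.
  rewrite distrC => <-//.
  by apply: (n2_distC (h := hP)); exact: TL2.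
move=> u0 v0.
have -> : n2 hP (muntz_T u - muntz_T v : {RV P >-> R}) =
    n2 hP (muntz_T u) - 2 * dot hP (muntz_T u) (muntz_T v) + n2 hP (muntz_T v).
  by apply: (n2B (h := hP)); exact: TL2.
have T0E t : t <= 0 -> (muntz_T t : Omega -> R) = 0.
  by move=> t0; rewrite /muntz_T ltNge t0.
have nT t : 0 <= t -> n2 hP (muntz_T t) = t.
  rewrite le_eqVlt => /predU1P[<-|t0]; first by rewrite T0E// n2_0.
  exact: dot_muntz_T.
rewrite !nT// distrC ger0_norm ?subr_ge0//.
move: u0; rewrite le_eqVlt => /predU1P[u0|u0].
  by rewrite -u0 T0E// (dot0l (h := hP)); [lra|exact: TL2].
rewrite dot_muntz_T//; first by lra.
exact: lt_le_trans uv.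
Qed.

Lemma muntz_T_integral t : 0 < t ->
  wiener_integral B `[0, t] (fun s => muntz_rho (t / s)) (muntz_T t).
Proof.
move=> t0; apply: (Bincr_integral_of_W W2 B2 B0 B_gt0 t0).
  by apply: measurable_funTS; exact: measurable_muntz_rho_div.
rewrite (_ : (fun r => _) = fun r => expR (ln t / 2) * eta_u (ln t) r); last first.
  by apply/funext => r; exact: lamperti_rho.
apply/(Wpairs_integral W2); rewrite /muntz_T t0.
have -> : zero_ext `]-oo, ln t] (fun r => expR (ln t / 2) * eta_u (ln t) r) =
    expR (ln t / 2) *: eta_u (ln t).
  rewrite -[in RHS](zero_ext_eta_at p0 p_inj' pfin (ln t)); apply/funext => r.
  transitivity (expR (ln t / 2) * zero_ext `]-oo, ln t] (eta_u (ln t)) r); last by [].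
  by rewrite !zero_ext_indic /= mulrA.
exact: (@clZ _ _ hh (increments `]-oo, ln t] W) (expR (ln t / 2)) _ (incr_L2 W2 (D := `]-oo, ln t])) (HS (ln t))).
Qed.

(** For s > 0, [T s] is almost surely a nonzero multiple of [S (ln s)], and [T 0] is null, so both
    families generate the same closed space and [muntz_process_generates] applies. *)
Lemma muntz_T_orthogonal_sum t (T : R -> {RV P >-> R}) :
  0 < t -> (forall t, 0 <= t -> T t = muntz_T t %[ae P]) ->
  orthogonal_sum (closed_span (B @` `[0, t])) (closed_span (T @` `[0, t]))
    (closed_span (power_integrals t)).
Proof.
move=> t0 TX; rewrite power_integralsE//.
have XL2 s : L2 P (muntz_T s) := gset_L2 (gset_muntz_T s).
have TL2 s : 0 <= s -> L2 P (T s).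
  move=> s0; apply: (ae_L2 (XL2 s)); first exact: RV_measurable.
  by apply: filterS (TX s s0) => w H /H.
have TX0 s : 0 <= s -> n2 hP ((T s : Omega -> R) - muntz_T s) = 0.
  by move=> s0; apply: ae_n2_eq0 (TX s s0); exact: RV_measurable.
have itvP s : `[0, t]%classic s -> 0 <= s <= t by rewrite /= in_itv.
have eL2 : fns (exp_integrals W p (ln t)) `<=` dom hP.
  by move=> _ [Y HY <-]; exact: (exp_integrals_L2 W2 HY).
have TfL2 : fns (T @` `[0, t]) `<=` dom hP.
  by move=> _ [_ [s /itvP/andP[s0 _] <-] <-]; exact: TL2.
have SfL2 : fns (S @` `]-oo, ln t]) `<=` dom hP.
  by move=> _ [_ [s _ <-] <-]; exact: SL2.
apply: orthogonal_sum_cl.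
- by move=> _ [s /itvP/andP[s0 _] <-]; exact: TL2.
- by move=> Y HY; exact: (exp_integrals_L2 W2 HY).
- move=> _ Y [s /itvP/andP[s0 st] <-] HY.
  have L2Y := exp_integrals_L2 W2 HY.
  rewrite (dot_eq0 (h := hP) (TL2 s s0) (XL2 s) L2Y (TX0 s s0)).
  rewrite /muntz_T; case: ifP => [s1|_]; last exact: (dot0l (h := hP) L2Y).
  transitivity (expR (ln s / 2) * dot hP (S (ln s)) Y).
    by apply: (dotZl (s := hP)) => //; exact: SL2.
  by rewrite (muntz_process_dot_exp W_bm HS (u := ln t)) ?mulr0// ler_ln.
move=> Z.
have BL2 Y : (B @` `[0, t]) Y -> L2 P Y.
  move=> [s /itvP/andP[s0 _] <-].
  have L2B0 : L2 P (B 0).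
    apply: (ae_L2 (L2_cst P 0)); first exact: RV_measurable.
    by apply: filterS B0 => w H /H.
  have L2d : L2 P (B s - B 0 : {RV P >-> R}).
    by apply: L2_RV; rewrite B2// ltry.
  suff -> : (B s : Omega -> R) = ((B s - B 0 : {RV P >-> R}) : Omega -> R) + B 0.
    exact: (domD (s := hP) L2d L2B0).
  by apply/funext => w; symmetry; exact: subrK.
apply: (iff_trans (closed_spanP _ BL2)).
apply: (iff_trans (cl_fnsB W2 B2 B0 B_gt0 _ t0)).
apply: (iff_trans (muntz_process_generates W_bm B_gt0 HS (ln t) Z)).
have UL2 (A : set (Omega -> R)) : A `<=` dom hP -> A `|` fns (exp_integrals W p (ln t)) `<=` dom hP.
  by move=> AD f [/AD|/eL2].
split; apply: cl_sub; try exact: UL2.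
  move=> f [[_ [r /= rt <-] <-]|ef]; last by apply: sub_cl; [exact: UL2|right].
  have er : 0 < expR r by exact: expR_gt0.
  (* The factor [expR (- r / 2)] undoes the square root of time in [muntz_T (expR r)]. *)
  have C : cl hP (fns (T @` `[0, t]) `|` fns (exp_integrals W p (ln t))) (expR (- r / 2) *: (T (expR r) : Omega -> R)).
    apply: clZ; [exact: UL2|apply: sub_cl; [exact: UL2|left]].
    exists (T (expR r)) => //; exists (expR r) => //=.
    by rewrite in_itv/= (ltW er)/= -[leRHS]lnK// ler_expR; move: rt; rewrite in_itv.
  apply: cl_eq0 C; [exact: UL2|exact: SL2|].
  have -> : (S r : Omega -> R) = expR (- r / 2) *: (muntz_T (expR r) : Omega -> R).
    rewrite /muntz_T er expRK; apply/funext => w.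
    change (S r w = expR (- r / 2) * (expR (r / 2) * S r w)).
    by rewrite mulrA -expRD mulNr addNr expR0 mul1r.
  rewrite -scalerBr n2Z; first by rewrite TX0 ?mulr0// ltW.
  by apply: domB; [apply: TL2; exact: ltW|exact: XL2].
move=> f [[_ [s /itvP/andP[s0 st] <-] <-]|ef]; last by apply: sub_cl; [exact: UL2|right].
have C : cl hP (fns (S @` `]-oo, ln t]) `|` fns (exp_integrals W p (ln t))) (muntz_T s).
  rewrite /muntz_T; case: ifP => [s1|_]; last by apply: span_cl (span0 _); exact: UL2.
  apply: (@clZ _ _ hP _ (expR (ln s / 2)) (S (ln s) : Omega -> R)); first exact: UL2.
  apply: sub_cl; [exact: UL2|left; exists (S (ln s)) => //; exists (ln s) => //=].
  by rewrite in_itv/= ler_ln.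
apply: cl_eq0 C; [exact: UL2|exact: TL2|].
by rewrite n2_distC; [exact: TX0|exact: XL2|exact: TL2].
Qed.

End convergent.
End brownian_transform.

(** * The equivalence *)

Theorem theorem3p1 (R : realType) (d : measure_display)
    (Omega : measurableType d) (P : probability Omega R)
    (lambda p : nat -> R)
    (lambda_inj : injective lambda)
    (lambda_gt : forall j, - (1 / 2) < lambda j)
    (pE : forall j, p j = lambda j + 1 / 2)
    (W B : R -> {RV P >-> R})
    (W_bm : brownian setT W)
    (B_bm : standard_brownian B)
    (W_ge0 : forall u, 0 <= u ->
      wiener_integral B `[1, expR u] (fun s => 1 / Num.sqrt s) (W u - B 1))
    (W_le0 : forall u, u <= 0 ->
      wiener_integral B `[expR u, 1] (fun s => 1 / Num.sqrt s) (B 1 - W u))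
    (B_gt0 : forall t, 0 < t ->
      wiener_integral W `]-oo, ln t] (fun r => expR (r / 2)) (B t)) :
  [<-> (\sum_(0 <= j <oo) (p j / (p j ^+ 2 + 1))%:E < +oo)%E ;
       exists (eta : R -> R) (S : R -> {RV P >-> R}),
         [/\ square_integrable `[0, +oo[ eta,
             forall u,
               wiener_integral W `]-oo, u] (fun v => eta (u - v)) (S u),
             ornstein_uhlenbeck S &
             forall u,
               orthogonal_sum (wiener_space W u)
                 (closed_span (S @` `]-oo, u]))
                 (closed_span [set Y | exists j,
                    wiener_integral W `]-oo, u]
                      (fun r => expR (p j * r)) Y])] ;
       exists (rho : R -> R) (T : R -> {RV P >-> R}),
         [/\ class_M rho,
             forall t, 0 < t ->
               wiener_integral B `[0, t] (fun s => rho (t / s)) (T t),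
             standard_brownian T &
             forall t, 0 < t ->
               orthogonal_sum (closed_span (B @` `[0, t]))
                 (closed_span (T @` `[0, t]))
                 (closed_span [set Y | exists j,
                    wiener_integral B `[0, t] (fun s => s `^ lambda j) Y])]
  ].
Proof.
have W2 u v : 'E_P[((W u - W v) ^+ 2)%R]%E = `|u - v|%:E.
  by case: W_bm => _ _ _ _; exact.
have B2 u v : 0 <= u -> 0 <= v -> 'E_P[((B u - B v) ^+ 2)%R]%E = `|u - v|%:E.
  by case: B_bm => -[_ _ _ _ H] _ u0 v0; apply: H; rewrite /= in_itv/= andbT.
have B0 : B 0 = cst 0 %[ae P] by case: B_bm.
have p0 j : 0 < p j by have := lambda_gt j; rewrite pE; lra.
have p_inj : injective p by move=> i j; rewrite !pE => /addIr /lambda_inj.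
have powE t : 0 < t -> power_integrals B lambda t = exp_integrals W p (ln t).
  exact: (power_integralsE p0 pE W_bm B_bm B_gt0).
have conv2 : (\sum_(0 <= j <oo) (p j / (p j ^+ 2 + 1))%:E < +oo)%E ->
  exists (eta : R -> R) (S : R -> {RV P >-> R}),
         [/\ square_integrable `[0, +oo[ eta,
             forall u,
               wiener_integral W `]-oo, u] (fun v => eta (u - v)) (S u),
             ornstein_uhlenbeck S &
             forall u,
               orthogonal_sum (wiener_space W u)
                 (closed_span (S @` `]-oo, u]))
                 (closed_span (exp_integrals W p u))].
  move=> pfin; have [S HS] := muntz_process_exists p0 p_inj pfin W_bm B_gt0.
  exists (muntz_eta p0 p_inj pfin), S; split.
  - exact: square_integrable_muntz_eta.
  - exact: muntz_process_integral.
  - exact: muntz_process_ou HS.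
  - exact: (muntz_process_orthogonal_sum W_bm B_gt0 HS).
have conv3 : (\sum_(0 <= j <oo) (p j / (p j ^+ 2 + 1))%:E < +oo)%E ->
  exists (rho : R -> R) (T : R -> {RV P >-> R}),
         [/\ class_M rho,
             forall t, 0 < t ->
               wiener_integral B `[0, t] (fun s => rho (t / s)) (T t),
             standard_brownian T &
             forall t, 0 < t ->
               orthogonal_sum (closed_span (B @` `[0, t]))
                 (closed_span (T @` `[0, t]))
                 (closed_span (power_integrals B lambda t))].
  move=> pfin; have [S HS] := muntz_process_exists p0 p_inj pfin W_bm B_gt0.
  have [] := gset_brownian W_bm (X := muntz_T S).
  - by move=> t _; exact: gset_muntz_T.
  - exact: (n2_muntz_T W_bm HS).
  - by apply: nearW => w _; rewrite /muntz_T ltxx.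
  move=> T [TX bT]; exists (muntz_rho p0 p_inj pfin), T; split => //.
  - exact: class_M_muntz_rho.
  - move=> t t0; apply: (Bincr_integral_ae B_bm); last first.
      exact: (muntz_T_integral W_bm B_bm B_gt0 HS t0).
    by apply: filterS (TX t (ltW t0)) => w H /H.
  - by move=> t t0; exact: (muntz_T_orthogonal_sum pE W_bm B_bm B_gt0 HS t0 TX).
(* Were the series divergent, [S 0] would be orthogonal to itself, against its variance 1. Time 0 is
   enough for the contradiction. *)
have div2 (eta : R -> R) (S : R -> {RV P >-> R}) :
    (forall u, wiener_integral W `]-oo, u] (fun v => eta (u - v)) (S u)) ->
    ornstein_uhlenbeck S ->
    orthogonal_sum (wiener_space W 0) (closed_span (S @` `]-oo, 0]))
      (closed_span (exp_integrals W p 0)) ->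
    (\sum_(0 <= j <oo) (p j / (p j ^+ 2 + 1))%:E < +oo)%E.
  move=> IS [_ _ _ S2] OS; apply: contrapT => pdiv.
  have HS u := (Wpairs_integral W2 u _ (S u)).1 (IS u).
  have : 'E_P[(S 0 * S 0)%R]%E = 0%E.
    apply: (divergent_orthogonal p0 W2 B_gt0 p_inj pdiv (HS 0) _ _ OS).
      by exists 0; rewrite /= ?in_itv/= ?lexx.
    by move=> _ [r _ <-]; case: (cl_dom (HS r)).
  by rewrite S2 subrr normr0 oppr0 mul0r expR0 => -[] /eqP; rewrite oner_eq0.
have div3 (rho : R -> R) (T : R -> {RV P >-> R}) :
    (forall t, 0 < t -> wiener_integral B `[0, t] (fun s => rho (t / s)) (T t)) ->
    standard_brownian T ->
    orthogonal_sum (closed_span (B @` `[0, 1])) (closed_span (T @` `[0, 1]))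
      (closed_span (power_integrals B lambda 1)) ->
    (\sum_(0 <= j <oo) (p j / (p j ^+ 2 + 1))%:E < +oo)%E.
  move=> IT [[_ _ _ _ T2] T0]; rewrite powE// => OS; apply: contrapT => pdiv.
  have HT t t0 := (Bincr_integral B2 t _ (T t)).1 (IT t t0).
  have TL2 t : 0 < t -> L2 P (T t) by move=> t0; case: (cl_dom (HT t t0)).
  have [F HF] := Bincr_Wpairs W2 B2 B0 B_gt0 ltr01 (HT 1 ltr01).
  have E1 : 'E_P[(T 1 * T 1)%R]%E = 0%E.
    apply: (divergent_orthogonal p0 W2 B_gt0 p_inj pdiv HF _ _ OS).
      by exists 1; rewrite /= ?in_itv/= ?lexx ?ler01.
    move=> Y [r /=]; rewrite in_itv/= => /andP[r0 _] <-; move: r0.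
    rewrite le_eqVlt => /predU1P[<-|/TL2//].
    apply: (ae_L2 (L2_cst P 0)); first exact: RV_measurable.
    by apply: filterS T0 => w H /H.
  (* The variance of [T 1] is read from its increment from 0, because [T 0] vanishes almost
     surely. *)
  have : 'E_P[((T 1 - T 0) ^+ 2)%R]%E = 1%E.
    by rewrite T2 /= ?in_itv/= ?lexx ?ler01// subr0 normr1.
  rewrite expectation_sqr (@L2_ae_eq _ _ _ P _ (T 1)).
  - have -> : (\int[P]_w (T 1 w ^+ 2)%:E = 'E_P[(T 1 * T 1)%R])%E.
      by rewrite expectation_mul; apply: eq_integral => w _; rewrite expr2.
    by rewrite E1 => -[] /eqP; rewrite eq_sym oner_eq0.
  - exact: RV_measurable.
  - exact: RV_measurable.
  - by apply: filterS T0 => w H _; change (T 1 w - T 0 w = T 1 w); rewrite H// subr0.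
tfae.
- exact: conv2.
(* The two decompositions are linked through the series: the one for [S] forces its convergence,
   which in turn produces [T]. *)
- by move=> [eta [S [_ IS OU OS]]]; apply: conv3; exact: (div2 eta S IS OU (OS 0)).
- by move=> [rho [T [_ IT bT OS]]]; exact: (div3 rho T IT bT (OS 1 ltr01)).
Qed.
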